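(* Let $f(\cdot)=\mathbb{E}_{\xi\sim\mathbb{P}_\mu}[F(\cdot,\xi)]$ on $\mathbb{R}^d$, $d\ge1$. Suppose that $F(\cdot,\xi)$ is $L(\xi)$-Lipschitz with $\mathbb{E}_{\xi\sim\mathbb{P}_\mu}[L^2(\xi)]\le G^2$ for some $G>0$. Let $\mathbf{x}^0\in\mathbb{R}^d$ be the initial point and let $\Delta>0$ be an upper bound for the initial objective function gap $f(\mathbf{x}^0)-\inf_{\mathbf{x}\in\mathbb{R}^d}f(\mathbf{x})>0$. Let $\delta>0$ and $0<\epsilon<1$. Then there exists some $T>0$ such that the output $\mathbf{x}^R$ of the Stochastic Gradient-Free Method (SGFM), run with initial point $\mathbf{x}^0$, smoothing parameter $\delta$, iteration number $T$ and stepsize $$\eta=\frac{1}{10}\sqrt{\frac{\delta(\Delta+\delta G)}{c\,d^{3/2}G^3T}},$$ satisfies $$\mathbb{E}\left[\min\{\|\mathbf{g}\|:\mathbf{g}\in\partial_\delta f(\mathbf{x}^R)\}\right]\le\epsilon,$$ and the total number of calls of the noisy function value oracle is bounded by $$O\left(d^{\frac32}\left(\frac{G^4}{\epsilon^4}+\frac{\Delta G^3}{\delta\epsilon^4}\right)\right).$$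
   Context: $\|\cdot\|$ is the Euclidean norm. A function $h:\mathbb{R}^d\to\mathbb{R}$ is $L$-Lipschitz if $|h(\mathbf{x})-h(\mathbf{x}')|\le L\|\mathbf{x}-\mathbf{x}'\|$ for all $\mathbf{x},\mathbf{x}'$. $\mathbb{P}_\mu$ is a probability distribution of a data sample $\xi$; $F(\mathbf{x},\xi)$ is the noisy function value, with $\mathbb{E}[F(\mathbf{x},\xi^t)]=f(\mathbf{x})$ for all $\mathbf{x}$ when $\xi^t$ is simulated from $\mathbb{P}_\mu$. The noisy function value oracle returns $F(\mathbf{x},\xi)$. Goldstein subdifferential: $\partial_\delta f(\mathbf{x}):=\mathrm{conv}(\bigcup_{\mathbf{y}\in\mathbb{B}_\delta(\mathbf{x})}\partial f(\mathbf{y}))$, where $\mathbb{B}_\delta(\mathbf{x})$ is the closed Euclidean ball of radius $\delta$ around $\mathbf{x}$ and $\partial f(\mathbf{y})$ is the Clarke generalized gradient, i.e. $\partial f(\mathbf{y})=\{\mathbf{g}:\mathbf{g}^\top\mathbf{v}\le\limsup_{\mathbf{z}\to\mathbf{y},t\downarrow0}\frac{f(\mathbf{z}+t\mathbf{v})-f(\mathbf{z})}{t}\ \forall\mathbf{v}\in\mathbb{R}^d\}$. The constant $c>0$ is an absolute constant with the following (known) property: for every $d\ge1$, every $L>0$, every $L$-Lipschitz $h:\mathbb{R}^d\to\mathbb{R}$ and every $\delta>0$, the function $h_\delta(\mathbf{x})=\mathbb{E}[h(\mathbf{x}+\delta\mathbf{u})]$, with $\mathbf{u}$ uniform on the Euclidean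 unit ball, is differentiable with $\frac{cL\sqrt d}{\delta}$-Lipschitz gradient. Stochastic Gradient-Free Method (SGFM). Input: $\mathbf{x}^0\in\mathbb{R}^d$, stepsize $\eta>0$, dimension $d$, smoothing parameter $\delta$, integer iteration number $T\ge1$. For $t=0,1,\ldots,T-1$: simulate $\xi^t$ from $\mathbb{P}_\mu$ and sample $\mathbf{w}^t$ uniformly from the unit sphere in $\mathbb{R}^d$ (independently of each other and of the past); compute $\hat{\mathbf{g}}^t=\frac{d}{2\delta}\left(F(\mathbf{x}^t+\delta\mathbf{w}^t,\xi^t)-F(\mathbf{x}^t-\delta\mathbf{w}^t,\xi^t)\right)\mathbf{w}^t$; set $\mathbf{x}^{t+1}=\mathbf{x}^t-\eta\hat{\mathbf{g}}^t$. Output: $\mathbf{x}^R$, where $R\in\{0,1,\ldots,T-1\}$ is sampled uniformly (independently of the rest). Each iteration uses two oracle calls. Convention: a number being bounded by $O(Q)$ means it is at most $C\max\{1,Q\}$ for an absolute constant $C>0$ (independent of $d,G,\Delta,\delta,\epsilon,F,\mathbb{P}_\mu,\mathbf{x}^0$). *)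

(* Defs.v *)
From HB Require Import structures.
From mathcomp Require Import all_boot all_order all_algebra.
From mathcomp Require Import all_classical all_reals all_analysis.

Set Implicit Arguments.
Unset Strict Implicit.
Unset Printing Implicit Defensive.

Import Order.TTheory GRing.Theory Num.Theory.
Import numFieldNormedType.Exports.

Local Open Scope classical_set_scope.
Local Open Scope ring_scope.

(* The canonical norm of 'rV[R]_d in the library is the sup norm: it is used
   below only for its topology, which is the Euclidean one *)
Section euclidean.
Context {R : realType} {d : nat}.
Implicit Types (x y g : 'rV[R]_d) (h : 'rV[R]_d -> R).

Definition dotv x y : R := \sum_(i < d) x ord0 i * y ord0 i.

Definition enorm x : R := Num.sqrt (dotv x x).

Definition eball x (r : R) : set 'rV[R]_d := [set y | enorm (y - x) <= r].

Definition elipschitz (k : R) h : Prop :=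
  forall x x', `|h x - h x'| <= k * enorm (x - x').

Definition gradient h x : 'rV[R]_d := \row_(i < d) 'D_(delta_mx ord0 i) h x.

Definition convex_hull (S : set 'rV[R]_d) : set 'rV[R]_d :=
  smallest (@convex_set R 'rV[R]_d) S.

Definition clarke_dd h y (v : 'rV[R]_d) : \bar R :=
  limf_esup (fun p : 'rV[R]_d * R => ((h (p.1 + p.2 *: v) - h p.1) / p.2)%:E)
            (filter_prod (nbhs y) (0 : R)^'+).

Definition clarke_subdiff h y : set 'rV[R]_d :=
  [set g | forall v, ((dotv g v)%:E <= clarke_dd h y v)%E].

Definition goldstein_subdiff (delta : R) h x : set 'rV[R]_d :=
  convex_hull (\bigcup_(y in eball x delta) clarke_subdiff h y).

(* min {|g| : g in S}. The infimum ranges over the minimizers only, so that the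
   value is the minimum if it is attained, and +oo otherwise (also if S is
   empty) *)
Definition min_norm (S : set 'rV[R]_d) : \bar R :=
  ereal_inf [set (enorm g)%:E |
             g in [set g | S g /\ forall g', S g' -> enorm g <= enorm g']].

End euclidean.

(* Borel sigma-algebra of R^d, generated by the coordinates *)
Section measurable_rV.
Context {R : realType} {d : nat}.

Let coor : 'I_d -> 'rV[R]_d -> measurableTypeR R := fun i x => x ord0 i.

Let rV_set0 : g_sigma_preimage coor set0.
Proof. exact: sigma_algebra0. Qed.

Let rV_setC A : g_sigma_preimage coor A -> g_sigma_preimage coor (~` A).
Proof. exact: sigma_algebraC. Qed.

Let rV_bigcup (F : _^nat) : (forall i, g_sigma_preimage coor (F i)) ->
  g_sigma_preimage coor (\bigcup_i (F i)).
Proof. exact: sigma_algebra_bigcup. Qed.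

HB.instance Definition _ :=
  @isMeasurable.Build (measure_tuple_display default_measure_display)
    'rV[R]_d (g_sigma_preimage coor) rV_set0 rV_setC rV_bigcup.

Lemma measurable_fun_rV d1 (T1 : measurableType d1) (f : T1 -> 'rV[R]_d) :
  (forall i, measurable_fun [set: T1]
               (fun t => f t ord0 i : measurableTypeR R)) ->
  measurable_fun [set: T1] f.
Proof.
move=> mf _ A mA; rewrite setTI.
have: (g_sigma_preimage coor `<=` [set B | measurable (f @^-1` B)]); last exact.
apply: smallest_sub.
  split=> /=.
  - by rewrite preimage_set0.
  - by move=> B mB; rewrite setTD preimage_setC; exact: measurableC.
  - by move=> B mB; rewrite preimage_bigcup; exact: bigcup_measurable.
rewrite -bigcup_seq/= => B [i _] [C mC <-] /=; rewrite setTI.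
by have := mf i measurableT C mC; rewrite setTI.
Qed.

End measurable_rV.

Section pushforward_sigma_finite.
Context d1 d2 d3 (T1 : measurableType d1) (T2 : measurableType d2)
  (T3 : measurableType d3) (R : realType).

Lemma sigma_finite_pushforward_product
    (m1 : {sigma_finite_measure set T1 -> \bar R})
    (m2 : {sigma_finite_measure set T2 -> \bar R})
    (f : T1 * T2 -> T3) (g : T3 -> T1 * T2) :
  measurable_fun [set: _] f -> measurable_fun [set: _] g -> cancel f g ->
  exists mu : {sigma_finite_measure set T3 -> \bar R},
    mu = pushforward (m1 \x m2)%E f :> (set T3 -> \bar R).
Proof.
move=> mf mg fK.
pose pm :=
  lebesgue_integral_fubini_product_measure1__canonical__measure_function_Measure
    m1 m2.
have pms : sigma_finite [set: T1 * T2] (m1 \x m2)%E.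
  have /sigma_finiteP[F [TF ndF Foo]] := sigma_finiteT m1.
  have /sigma_finiteP[G [TG ndG Goo]] := sigma_finiteT m2.
  exists (fun n => F n `*` G n).
    rewrite -setXTT TF TG; apply/seteqP; split=> -[x y] /=.
      move=> [[n _ Fnx] [k _ Gky]]; exists (maxn n k) => //; split=> /=.
      - by move: x Fnx; exact/subsetPset/ndF/leq_maxl.
      - by move: y Gky; exact/subsetPset/ndG/leq_maxr.
    by move=> [n _ []/= ? ?]; split; exists n.
  move=> k; have [? ?] := Foo k; have [? ?] := Goo k.
  split; first exact: measurableX.
  by rewrite product_measure1E// lte_mul_pinfty// ge0_fin_numE.
pose nu : {measure set T3 -> \bar R} :=
  measure_function_pushforward__canonical__measure_function_Measure pm mf.
have nus : sigma_finite [set: T3] nu.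
  have [F FT Foo] := pms.
  exists (fun i => g @^-1` (F i)); first by rewrite -preimage_bigcup -FT.
  move=> i; have [mFi Fioo] := Foo i; split.
    by rewrite -[X in measurable X]setTI; exact: mg.
  rewrite /nu/= /pushforward -comp_preimage.
  by rewrite (_ : g \o f = id) //; apply/funext.
pose h := Measure_isSigmaFinite.Build _ _ _ nu nus.
pose nu' : {sigma_finite_measure set T3 -> \bar R} :=
  HB.pack (pushforward (m1 \x m2)%E f) nu h.
by exists (nu' mf).
Qed.

End pushforward_sigma_finite.

(* d-dimensional Lebesgue measure, as an iterated product *)
Section lebesgue_rV.
Context (R : realType).
Local Notation R' := (measurableTypeR R).

Fixpoint lebesgue_tuple (d : nat) : set (d.-tuple R') -> \bar R :=
  match d with
  | 0 => dirac [tuple]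
  | d'.+1 => pushforward (product_measure1 (@lebesgue_measure R)
                                           (@lebesgue_tuple d'))
                         (fun p => [tuple of p.1 :: p.2])
  end.

Lemma lebesgue_tuple_ex d : exists mu :
  {sigma_finite_measure set (d.-tuple R') -> \bar R},
  mu = @lebesgue_tuple d :> (set _ -> _).
Proof.
elim: d => [|d [mu muE]].
  by exists (dirac [tuple] : {sigma_finite_measure set (0.-tuple R') -> \bar R}).
rewrite /= -muE.
apply: (@sigma_finite_pushforward_product _ _ _ _ _ _ R (@lebesgue_measure R) mu
  _ (fun t : d.+1.-tuple R' => (thead t, [tuple of behead t]))).
- exact: measurable_cons.
- by apply: measurable_fun_pair; [exact: measurable_tnth|
                                  exact: measurable_behead].
- by case=> a t; congr pair; exact/val_inj.
Qed.

Definition rV_of_tuple d (t : d.-tuple R') : 'rV[R]_d := \row_(i < d) tnth t i.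

Definition lebesgue_rV d : set 'rV[R]_d -> \bar R :=
  pushforward (@lebesgue_tuple d) (@rV_of_tuple d).

Lemma measurable_rV_of_tuple d : measurable_fun [set: _] (@rV_of_tuple d).
Proof.
apply: measurable_fun_rV => i; under eq_fun do rewrite mxE.
exact: measurable_tnth.
Qed.

Let lebesgue_rV0 d : @lebesgue_rV d set0 = 0%E.
Proof.
by rewrite /lebesgue_rV /pushforward preimage_set0;
  have [mu <-] := lebesgue_tuple_ex d; rewrite measure0.
Qed.

Let lebesgue_rV_ge0 d A : (0 <= @lebesgue_rV d A)%E.
Proof.
by rewrite /lebesgue_rV /pushforward;
  have [mu <-] := lebesgue_tuple_ex d; exact: measure_ge0.
Qed.

Let lebesgue_rV_sigma_additive d : semi_sigma_additive (@lebesgue_rV d).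
Proof.
rewrite /lebesgue_rV; have [mu <-] := lebesgue_tuple_ex d.
pose nu : {measure set _ -> \bar R} := 
  measure_function_pushforward__canonical__measure_function_Measure mu
    (@measurable_rV_of_tuple d).
exact: (@measure_semi_sigma_additive _ _ _ nu).
Qed.

HB.instance Definition _ d := isMeasure.Build _ _ _ (@lebesgue_rV d)
  (@lebesgue_rV0 d) (@lebesgue_rV_ge0 d) (@lebesgue_rV_sigma_additive d).

End lebesgue_rV.

Section uniform_laws.
Context {R : realType} {d : nat}.

Definition unit_ball : set 'rV[R]_d := eball 0 1.

Definition ball_volume : R := fine (lebesgue_rV unit_ball).

(* E[h(x + delta u)] with u uniform on the unit ball *)
Definition smoothing (h : 'rV[R]_d -> R) (delta : R) (x : 'rV[R]_d) : R :=
  ball_volume^-1 *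
    (\int[@lebesgue_rV R d]_(u in unit_ball) h (x + delta *: u))%R.

(* Uniform distribution on the unit sphere, i.e. the normalized surface
   measure: the surface measure of a part A of the sphere is d times the volume
   of the cone {r x : 0 < r <= 1, x in A}, and the total mass d times the
   volume of the ball *)
Definition sphere_uniform (A : set 'rV[R]_d) : \bar R :=
  (ball_volume^-1 * fine (lebesgue_rV
     [set y | 0 < enorm y <= 1 /\ A ((enorm y)^-1 *: y)]))%:E.

End uniform_laws.

Definition smoothing_constant (R : realType) (c : R) : Prop :=
  0 < c /\
  forall (d : nat) (L : R) (h : 'rV[R]_d -> R) (delta : R),
    (0 < d)%N -> 0 < L -> elipschitz L h -> 0 < delta ->
    (forall x, differentiable (smoothing h delta) x) /\
    (forall x x',
       enorm (gradient (smoothing h delta) x - gradient (smoothing h delta) x')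
         <= c * L * Num.sqrt d%:R / delta * enorm (x - x')).

Section objective.
Context {R : realType} {d : nat} {dX : measure_display} {Xi : measurableType dX}.
Variables (P : probability Xi R) (F : 'rV[R]_d -> Xi -> R).

Definition objective (x : 'rV[R]_d) : R := fine 'E_P[F x].

(* f x0 - inf f, equal to +oo if f is unbounded below *)
Definition objective_gap (x0 : 'rV[R]_d) : \bar R :=
  ((objective x0)%:E - ereal_inf (range (fun x => (objective x)%:E)))%E.

End objective.

Section independence.
Context dO (Omega : measurableType dO) (R : realType) (Q : probability Omega R).

Definition mutually_independent (I : finType)
    (E : I -> set (set Omega)) : Prop :=
  forall (J : {set I}) (A : I -> set Omega),
    (forall i, i \in J -> E i (A i)) ->
    Q (\bigcap_(i in [set` J]) A i) = (\prod_(i in J) Q (A i))%E.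

End independence.

Section sgfm.
Context {R : realType} {d : nat} {dX : measure_display} {Xi : measurableType dX}.
Local Notation V := 'rV[R]_d.
Variables (F : V -> Xi -> R) (delta eta : R) (x0 : V).

Definition sgfm_queries (x w : V) (xi : Xi) : seq (V * Xi) :=
  [:: (x + delta *: w, xi); (x - delta *: w, xi)].

Definition sgfm_grad (x w : V) (xi : Xi) : V :=
  let y := [seq F q.1 q.2 | q <- sgfm_queries x w xi] in
  (d%:R / (2 * delta) * (y`_0 - y`_1)) *: w.

Fixpoint sgfm_iter (w : nat -> V) (xi : nat -> Xi) (t : nat) : V :=
  match t with
  | 0 => x0
  | t'.+1 => let x := sgfm_iter w xi t' in x - eta *: sgfm_grad x (w t') (xi t')
  end.

Definition sgfm_oracle_calls (w : nat -> V) (xi : nat -> Xi) (T : nat) : nat :=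
  \sum_(t < T) size (sgfm_queries (sgfm_iter w xi t) (w t) (xi t)).

End sgfm.

(* Sampling in a run of T iterations: xi^t ~ P, w^t uniform on the sphere, rho
   uniform on {0, ..., T - 1}, all of them mutually independent *)
Section sgfm_sampling.
Context {R : realType} {d : nat} {dX : measure_display} {Xi : measurableType dX}
  (P : probability Xi R).
Context dO (Omega : measurableType dO) (Q : probability Omega R).
Variables (xi : nat -> {RV Q >-> Xi}) (w : nat -> {RV Q >-> 'rV[R]_d})
  (rho : {RV Q >-> nat}) (T : nat).

Definition sgfm_sigma (i : 'I_T + 'I_T + unit) : set (set Omega) :=
  match i with
  | inl (inl t) => g_sigma_algebra_preimage (xi t)
  | inl (inr t) => g_sigma_algebra_preimage (w t)
  | inr _ => g_sigma_algebra_preimage rho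
  end.

Record sgfm_sampling : Prop := SgfmSampling {
  sgfm_law_xi : forall t A, (t < T)%N -> measurable A ->
    distribution Q (xi t) A = P A;
  sgfm_law_w : forall t A, (t < T)%N -> measurable A ->
    distribution Q (w t) A = sphere_uniform A;
  sgfm_law_rho : forall t, (t < T)%N ->
    distribution Q rho [set t] = (T%:R^-1)%:E;
  sgfm_indep : mutually_independent Q sgfm_sigma
}.

End sgfm_sampling.

(* Main.v *)
From HB Require Import structures.
Require Import Defs.
From mathcomp Require Import all_boot all_order all_fingroup all_algebra.
From mathcomp Require Import all_classical all_reals all_analysis.
From mathcomp Require Import measurable_realfun ring lra.

(** Write [f] for the objective, [fd] for its smoothing over balls of radius
    [delta] and [n x] for the norm of the gradient of [fd] at [x]. The method is
    stochastic gradient descent on [fd], and three facts make it work.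

    The gradient of [fd] at [x] lies in the Goldstein subdifferential of [f] at
    [x] ([smoothing_gradient_goldstein]). Averages of difference quotients over
    the ball are at most the largest Clarke derivative over the ball, which is
    the support function of the subdifferential, and a closed convex set is the
    intersection of its half-spaces. The subdifferential is compact
    ([compact_goldstein]: Clarke gradients form a compact set, and hulls of
    compact sets are compact by Caratheodory's theorem), so the minimal norm is
    attained and at most [n x] ([goldstein_min_norm_le]).

    The estimator is unbiased for the gradient of [fd] ([mean_estimator]): this
    is the divergence theorem on the ball ([divergence_ball]), which turns the
    derivative of a ball average into an average over the sphere.

    Its second moment is [O(d G^2)] ([second_moment]), a factor [d] better than
    the trivial bound, because the central difference is an odd Lipschitz
    function [k] of the direction and [k^2] has mean [O(K^2 / d)] on the sphere
    ([odd_second_moment]). To see the latter, extend [k] 1-homogeneously to a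
    function [h], and let [(x, y)] be uniform on the unit ball of [R^(2d)].
    Rotating [(x, y)] by the angle [pi] in [n] small steps leads from [x] to
    [- x] and changes [h x] by [2 h x]. Each step preserves the law of the pair
    and changes [h x] by about [pi / n] times the derivative of [h] at [x] in the
    direction of [y], whose mean square is [|grad h x|^2 E|y|^2 / d] by symmetry
    ([poincare_half_turn]). As [h] need not be differentiable, it is smoothed
    first; the constant [c] guarantees that the error of a step is [O(n^-2)].

    Since the gradient of [fd] is Lipschitz with constant [c G sqrt d / delta],
    the descent inequality gives in expectation a decrease of [fd] by
    [eta (n x)^2] up to an error of order [eta^2 c d^(3/2) G^3 / delta]
    ([descent_step]). The iterate is independent of the next sample
    ([iterate_independent]), so these inequalities can be averaged and telescope
    ([telescoped]), starting from a gap of at most [Delta + delta G]. As the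
    stopping index is uniform and independent of the iterates, this bounds the
    mean of [(n x)^2] at the output, and the step size is chosen such that both
    contributions are of order [1 / sqrt T]. They are at most [epsilon^2] for [T]
    of the announced order ([iteration_number_enough]). *)

Set Implicit Arguments.
Unset Strict Implicit.
Unset Printing Implicit Defensive.

Import Order.TTheory GRing.Theory Num.Theory.
Import numFieldNormedType.Exports.

Local Open Scope classical_set_scope.
Local Open Scope ring_scope.

(** * Euclidean geometry *)
Section euclidean_geometry.
Context {R : realType} {d : nat}.
Implicit Types (x y z g : 'rV[R]_d) (a : R).

Lemma dotvC x y : dotv x y = dotv y x.
Proof. by rewrite /dotv; apply: eq_bigr => i _; rewrite mulrC. Qed.

Lemma dotvDl x y z : dotv (x + y) z = dotv x z + dotv y z.
Proof. by rewrite /dotv -big_split; apply: eq_bigr => i _; rewrite mxE mulrDl. Qed.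

Lemma dotvZl a x y : dotv (a *: x) y = a * dotv x y.
Proof. by rewrite /dotv mulr_sumr; apply: eq_bigr => i _; rewrite mxE mulrA. Qed.

Lemma dotvDr x y z : dotv x (y + z) = dotv x y + dotv x z.
Proof. by rewrite dotvC dotvDl !(dotvC x). Qed.

Lemma dotvZr a x y : dotv x (a *: y) = a * dotv x y.
Proof. by rewrite dotvC dotvZl dotvC. Qed.

Lemma dotvNl x y : dotv (- x) y = - dotv x y.
Proof. by rewrite -scaleN1r dotvZl mulN1r. Qed.

Lemma dotvNr x y : dotv x (- y) = - dotv x y.
Proof. by rewrite dotvC dotvNl dotvC. Qed.

Lemma dotvBl x y z : dotv (x - y) z = dotv x z - dotv y z.
Proof. by rewrite dotvDl dotvNl. Qed.

Lemma dotvBr x y z : dotv x (y - z) = dotv x y - dotv x z.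
Proof. by rewrite dotvDr dotvNr. Qed.

Lemma dotv0r x : dotv x 0 = 0.
Proof. by rewrite /dotv big1// => i _; rewrite mxE mulr0. Qed.

Lemma dotvv_ge0 x : 0 <= dotv x x.
Proof. by rewrite /dotv sumr_ge0// => i _; rewrite -expr2 sqr_ge0. Qed.

Lemma enorm_ge0 x : 0 <= enorm x.
Proof. exact: sqrtr_ge0. Qed.

Lemma enorm_sq x : enorm x ^+ 2 = dotv x x.
Proof. by rewrite sqr_sqrtr// dotvv_ge0. Qed.

Lemma enorm0 : enorm (0 : 'rV[R]_d) = 0.
Proof. by rewrite /enorm dotv0r sqrtr0. Qed.

Lemma enormN x : enorm (- x) = enorm x.
Proof. by rewrite /enorm dotvNl dotvNr opprK. Qed.

Lemma enormB x y : enorm (x - y) = enorm (y - x).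
Proof. by rewrite -enormN opprB. Qed.

Lemma enormZ a x : enorm (a *: x) = `|a| * enorm x.
Proof.
by rewrite /enorm dotvZl dotvZr mulrA -expr2 sqrtrM ?sqr_ge0// sqrtr_sqr.
Qed.

Lemma coord_le_enorm x i : `|x ord0 i| <= enorm x.
Proof.
rewrite -sqrtr_sqr ler_sqrt ?dotvv_ge0// /dotv (bigD1 i)//= -expr2 lerDl.
by apply: sumr_ge0 => j _; rewrite -expr2 sqr_ge0.
Qed.

Lemma enorm_eq0 x : (enorm x == 0) = (x == 0).
Proof.
apply/eqP/eqP => [x0|->]; last exact: enorm0.
apply/rowP => i; rewrite mxE; apply/eqP; rewrite -normr_eq0.
by rewrite eq_le normr_ge0 -x0 coord_le_enorm.
Qed.

Lemma enorm_gt0 x : (0 < enorm x) = (x != 0).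
Proof. by rewrite lt_def enorm_ge0 andbT enorm_eq0. Qed.

Lemma cauchy_schwarz x y : dotv x y <= enorm x * enorm y.
Proof.
have [->|y0] := eqVneq y 0; first by rewrite dotv0r enorm0 mulr0.
have ny : 0 < enorm y by rewrite enorm_gt0.
have [xy|xy] := leP (dotv x y) 0.
  by rewrite (le_trans xy)// mulr_ge0 ?enorm_ge0.
rewrite -(@ler_pXn2r _ 2)// ?nnegrE ?(ltW xy)//; last by rewrite mulr_ge0 ?enorm_ge0.
have := dotvv_ge0 (enorm y ^+ 2 *: x - dotv x y *: y).
rewrite dotvBl !dotvBr !dotvZl !dotvZr -!enorm_sq (dotvC y x).
set p := dotv x y; set a := enorm x; set b := enorm y => h.
have : 0 <= b ^+ 2 * ((a * b) ^+ 2 - p ^+ 2) by apply: le_trans h _; rewrite le_eqVlt; apply/orP; left; apply/eqP; ring.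
by rewrite pmulr_rge0 ?exprn_gt0// subr_ge0.
Qed.

Lemma normr_dotv_le x y : `|dotv x y| <= enorm x * enorm y.
Proof.
rewrite ler_norml cauchy_schwarz andbT -lerN2 opprK -dotvNl.
by rewrite (le_trans (cauchy_schwarz _ _))// enormN.
Qed.

Lemma enormD x y : enorm (x + y) <= enorm x + enorm y.
Proof.
rewrite -(@ler_pXn2r _ 2)// ?nnegrE ?addr_ge0 ?enorm_ge0//.
rewrite enorm_sq dotvDl !dotvDr -!enorm_sq (dotvC y x).
have := cauchy_schwarz x y; lra.
Qed.

Lemma enorm_triangle z x y : enorm (x - y) <= enorm (x - z) + enorm (z - y).
Proof. by rewrite (le_trans _ (enormD _ _))// addrA subrK. Qed.

Lemma enorm_dist x y : `|enorm x - enorm y| <= enorm (x - y).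
Proof.
rewrite ler_norml; apply/andP; split.
  by rewrite lerNl opprB lerBlDr enormB (le_trans _ (enormD _ _))// subrK.
by rewrite lerBlDr (le_trans _ (enormD _ _))// subrK.
Qed.

Lemma enorm_unit x : x != 0 -> enorm ((enorm x)^-1 *: x) = 1.
Proof.
rewrite -enorm_gt0 => x0.
by rewrite enormZ gtr0_norm ?invr_gt0// mulVf// gt_eqF.
Qed.

Lemma enorm_sum (I : Type) (r : seq I) (P : pred I) (f : I -> 'rV[R]_d) :
  enorm (\sum_(i <- r | P i) f i) <= \sum_(i <- r | P i) enorm (f i).
Proof.
elim/big_ind2 : _ => //; first by rewrite enorm0.
by move=> u a v b ua vb; rewrite (le_trans (enormD _ _))// lerD.
Qed.

Lemma enorm_delta (i : 'I_d) : enorm (delta_mx ord0 i : 'rV[R]_d) = 1.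
Proof.
rewrite /enorm /dotv (bigD1 i)//= mxE !eqxx mulr1 big1 ?addr0 ?sqrtr1// => j ji.
by rewrite mxE (negbTE ji) mulr0.
Qed.

Lemma enorm_le_sum x : enorm x <= \sum_(i < d) `|x ord0 i|.
Proof.
rewrite [in leLHS](row_sum_delta x) (le_trans (enorm_sum _ _ _))// ler_sum// => i _.
by rewrite enormZ enorm_delta mulr1.
Qed.

Lemma coord_le_norm x i : `|x ord0 i| <= `|x|.
Proof.
rewrite [leRHS]/Num.norm/= mx_normrE.
exact: (le_bigmax_cond _ (fun ij : 'I_1 * 'I_d => `|x ij.1 ij.2|) (j := (ord0, i))).
Qed.

Lemma norm_le_enorm x : `|x| <= enorm x.
Proof.
rewrite [leLHS]/Num.norm/= mx_normrE; apply/bigmax_leP; split; first exact: enorm_ge0.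
by move=> [i j] _ /=; rewrite ord1 coord_le_enorm.
Qed.

Lemma enorm_le_norm x : enorm x <= d%:R * `|x|.
Proof.
rewrite (le_trans (enorm_le_sum x))//.
rewrite (@le_trans _ _ (\sum_(i < d) `|x|))//; first by apply: ler_sum => i _; exact: coord_le_norm.
by rewrite sumr_const card_ord mulr_natl lexx.
Qed.

End euclidean_geometry.

(** * The Euclidean norm and the topology of row vectors *)

Lemma continuousT_add (R : realType) (T : topologicalType) (f g : T -> R) :
  continuous f -> continuous g -> continuous (fun x => f x + g x).
Proof. by move=> cf cg x; apply: cvgD; [exact: cf|exact: cg]. Qed.

Lemma continuousT_mul (R : realType) (T : topologicalType) (f g : T -> R) :
  continuous f -> continuous g -> continuous (fun x => f x * g x).
Proof. by move=> cf cg x; apply: cvgM; [exact: cf|exact: cg]. Qed.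

Lemma continuousT_opp (R : realType) (T : topologicalType) (f : T -> R) :
  continuous f -> continuous (fun x => - f x).
Proof. by move=> cf x; apply: cvgN; exact: cf. Qed.

Lemma continuousT_cst (R : realType) (T : topologicalType) (a : R) :
  continuous (fun _ : T => a).
Proof. by move=> x; exact: cvg_cst. Qed.

Section euclidean_topology.
Context {R : realType} {d : nat}.
Implicit Types (x y z g : 'rV[R]_d) (a : R) (h : 'rV[R]_d -> R).

Lemma nbhs_enormP x (A : set 'rV[R]_d) :
  nbhs x A <-> exists2 e : R, 0 < e & forall y, enorm (y - x) < e -> A y.
Proof.
split=> [/nbhs_ballP[e /= e0 eA]|[e e0 eA]].
  exists e => // y yx; apply: eA; rewrite -ball_normE /= distrC.
  exact: le_lt_trans (norm_le_enorm _) yx.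
apply/nbhs_ballP; exists (e / (d%:R + 1)) => /=; first by rewrite divr_gt0// ltr_wpDl.
move=> y; rewrite -ball_normE /= distrC => yx; apply: eA.
apply: le_lt_trans (enorm_le_norm _) _.
have d1 : 0 < d%:R + 1 :> R by rewrite ltr_wpDl.
rewrite ltr_pdivlMr// in yx; apply: le_lt_trans yx.
by rewrite mulrC ler_wpM2l// lerDl.
Qed.

Lemma near_enorm x e : 0 < e -> \forall y \near x, enorm (y - x) < e.
Proof. by move=> e0; apply/nbhs_enormP; exists e. Qed.

Lemma elipschitz_ge0 (k : R) h : (0 < d)%N -> elipschitz k h -> 0 <= k.
Proof.
move=> d0 /(_ (delta_mx ord0 (Ordinal d0)) 0); rewrite subr0 enorm_delta mulr1.
by apply: le_trans.
Qed.

Lemma elipschitz_continuous k h : elipschitz k h -> continuous h.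
Proof.
move=> hk x; apply/(@cvgrPdist_lt _ _ _ (nbhs x) (nbhs_filter x)) => e e0.
apply/nbhs_enormP; exists (e / (`|k| + 1)); first by rewrite divr_gt0// ltr_wpDl.
move=> y; rewrite ltr_pdivlMr ?ltr_wpDl// enormB => yx.
rewrite (le_lt_trans (hk _ _))//; apply: le_lt_trans yx.
rewrite mulrC ler_wpM2l ?enorm_ge0//.
by rewrite (le_trans (ler_norm _))// lerDl.
Qed.

Lemma continuous_edist y : continuous (fun x => enorm (x - y)).
Proof.
apply: (@elipschitz_continuous 1) => u v.
by rewrite mul1r (le_trans (enorm_dist _ _))// opprB addrA subrK.
Qed.

Lemma closed_bounded_compact (A : set 'rV[R]_d) (M : R) :
  closed A -> (forall x, A x -> enorm x <= M) -> compact A.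
Proof.
move=> cA AM; apply: bounded_closed_compact => //.
exists M; split; first exact: num_real.
by move=> r Mr x /AM xM; apply: (le_trans (norm_le_enorm _)); rewrite (le_trans xM)// ltW.
Qed.

Lemma compact_eball x r : compact (eball x r).
Proof.
apply: (@closed_bounded_compact _ (r + enorm x)); last first.
  move=> y; rewrite /eball/= => yr.
  by rewrite -(subrK x y) (le_trans (enormD _ _))// lerD2r.
rewrite (_ : eball x r = (fun y => enorm (y - x)) @^-1` [set z | z <= r]) //.
apply: closed_comp; last exact: closed_le.
by move=> y _; exact: continuous_edist.
Qed.

(** Bolzano-Weierstrass gives nearest points: a point of a nonempty closed set
    minimises the distance to a given point. *)
Lemma closed_nearest_point (A : set 'rV[R]_d) (p : 'rV[R]_d) :
  closed A -> A !=set0 ->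
  exists2 q, A q & forall y, A y -> enorm (q - p) <= enorm (y - p).
Proof.
move=> cA [y0 Ay0].
pose B := A `&` eball p (enorm (y0 - p)).
have cB : compact B.
  by rewrite /B setIC; apply: compact_closedI => //; exact: compact_eball.
have ctn : {within B, continuous (fun y => - enorm (y - p))}.
  by apply: continuous_subspaceT; apply: continuousT_opp; exact: continuous_edist.
have B0 : B !=set0 by exists y0; split => //; rewrite /eball/=.
have [q /set_mem[Aq Bq] qmin] := @compact_EVT_max _ _ _ B B0 cB ctn.
exists q => // y Ay; have [yB|yB] := leP (enorm (y - p)) (enorm (y0 - p)).
  by have := qmin y (mem_set (conj Ay yB)); rewrite lerN2.
by rewrite (le_trans Bq)// ltW.
Qed.

End euclidean_topology.

(** * Convex hulls in finite dimension *)
Section convex_hulls.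
Context {R : realType} {d : nat}.
Local Notation V := 'rV[R]_d.
Implicit Types (x y p q g : V) (S K : set V).

Lemma convex_combination K x y (t : R) :
  @convex_set R V K -> 0 <= t <= 1 -> K x -> K y ->
  K (t *: x + (1 - t) *: y).
Proof.
move=> cK /andP[t0 t1] Kx Ky.
by have /set_mem := cK x y (Itv01 t0 t1) (mem_set Kx) (mem_set Ky).
Qed.

Lemma convex_setP K :
  (forall x y (t : R), 0 <= t <= 1 -> K x -> K y -> K (t *: x + (1 - t) *: y)) ->
  @convex_set R V K.
Proof.
move=> cK x y t /set_mem Kx /set_mem Ky; apply/mem_set.
by apply: cK => //; rewrite ge0 le1.
Qed.

Lemma convex_hull_sub S : S `<=` convex_hull S.
Proof. exact: sub_gen_smallest. Qed.

Lemma convex_convex_hull S : @convex_set R V (convex_hull S).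
Proof.
apply: convex_setP => x y t t01 Sx Sy A [cA SA].
by apply: convex_combination => //; [exact: Sx|exact: Sy].
Qed.

Definition combination S n : set V :=
  [set x | exists (l : 'I_n -> R) (s : 'I_n -> V),
    [/\ forall i, 0 <= l i, \sum_i l i = 1, forall i, S (s i) &
        x = \sum_i l i *: s i]].

Lemma convex_combinations S : @convex_set R V (\bigcup_n combination S n).
Proof.
apply: convex_setP => x y t /andP[t0 t1] [n _ [l [s [l0 l1 Ss ->]]]].
move=> [n' _ [l' [s' [l'0 l'1 Ss' ->]]]]; exists (n + n')%N => //.
exists (fun k : 'I_(n + n') => match fintype.split k with inl i => t * l i | inr j => (1 - t) * l' j end).
exists (fun k : 'I_(n + n') => match fintype.split k with inl i => s i | inr j => s' j end).
have splitL (i : 'I_n) : fintype.split (lshift n' i) = inl i.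
  by have := unsplitK (inl i : 'I_n + 'I_n').
have splitR (j : 'I_n') : fintype.split (rshift n j) = inr j.
  by have := unsplitK (inr j : 'I_n + 'I_n').
split.
- by move=> k; case: splitP => i _; rewrite mulr_ge0// subr_ge0.
- rewrite big_split_ord/=.
  rewrite (eq_bigr (fun i => t * l i)); last by move=> i _; rewrite splitL.
  rewrite [X in _ + X](eq_bigr (fun i => (1 - t) * l' i)); last by move=> i _; rewrite splitR.
  by rewrite -!mulr_sumr l1 l'1; lra.
- by move=> k; case: splitP.
- rewrite big_split_ord/= !scaler_sumr; congr (_ + _); apply: eq_bigr => i _.
    by rewrite splitL scalerA.
  by rewrite splitR scalerA.
Qed.

Lemma combination_drop S n (l : 'I_n.+1 -> R) (s : 'I_n.+1 -> V) i0 :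
  (forall i, 0 <= l i) -> \sum_i l i = 1 -> (forall i, S (s i)) -> l i0 = 0 ->
  combination S n (\sum_i l i *: s i).
Proof.
move=> l0 l1 Ss li0; exists (fun j => l (lift i0 j)), (fun j => s (lift i0 j)).
split=> //; first by rewrite -l1 (bigD1_ord i0)//= li0 add0r.
by rewrite (bigD1_ord i0)//= li0 scale0r add0r.
Qed.

(** More than [d + 1] points of [R^d] are affinely dependent, and moving along
    an affine dependency until the first coefficient vanishes removes a point
    from a convex combination. *)
Lemma caratheodory_step S n x :
  (d.+1 < n.+1)%N -> combination S n.+1 x -> combination S n x.
Proof.
move=> dn [l [s [l0 l1 Ss ->]]].
pose B : 'M[R]_(n.+1, d + 1) := \matrix_i (row_mx (s i) (1%:M : 'M[R]_1)).
have kB : kermx B != 0.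
  rewrite kermx_eq0 /row_free neq_ltn; apply/orP; left.
  by rewrite (leq_ltn_trans (rank_leq_col _))// addn1.
have [mu [mu0 muB]] : exists mu : 'rV[R]_n.+1, mu != 0 /\ mu *m B = 0.
  have /rowV0Pn[mu /sub_kermxP muB mu0] := kB.
  by exists mu.
have sums : \sum_i mu ord0 i *: row_mx (s i) (1%:M : 'M[R]_1) = 0.
  transitivity (mu *m B); last by [].
  rewrite mulmx_sum_row.
  apply: eq_bigr => i _.
  by rewrite rowK.
have mus : \sum_i mu ord0 i *: s i = 0.
  apply/rowP => j; have /rowP/(_ (lshift 1 j)) := sums.
  rewrite !summxE [RHS]mxE => sj; rewrite [RHS]mxE -[RHS]sj.
  by apply: eq_bigr => i _; rewrite [RHS]mxE row_mxEl mxE.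
have mu1 : \sum_i mu ord0 i = 0.
  have /rowP/(_ (rshift d ord0)) := sums.
  rewrite summxE [RHS]mxE => sj; rewrite -[RHS]sj.
  by apply: eq_bigr => i _; rewrite mxE row_mxEr mxE eqxx mulr1.
have [i1 mui1] : exists i, 0 < mu ord0 i.
  apply/not_existsP => mule; move/negP: mu0; apply; apply/eqP/rowP => i.
  have mule0 j : mu ord0 j <= 0 by rewrite leNgt; apply/negP; exact: mule.
  have : \sum_j - mu ord0 j = 0 by rewrite sumrN mu1 oppr0.
  move/eqP; rewrite psumr_eq0; last by move=> j _; rewrite oppr_ge0.
  by move=> /allP/(_ i); rewrite mem_index_enum oppr_eq0 !mxE => /(_ isT)/eqP.
pose i0 := [arg min_(i < i1 | 0 < mu ord0 i) (l i / mu ord0 i)]%O.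
have [mui0 i0min] : 0 < mu ord0 i0 /\
    forall j, 0 < mu ord0 j -> l i0 / mu ord0 i0 <= l j / mu ord0 j.
  by rewrite /i0; case: arg_minP.
set tau := l i0 / mu ord0 i0 in i0min.
have -> : \sum_i l i *: s i = \sum_i (l i - tau * mu ord0 i) *: s i.
  under [in RHS]eq_bigr do rewrite scalerBl -scalerA.
  by rewrite sumrB -scaler_sumr mus scaler0 subr0.
apply: (@combination_drop S n _ s i0) => //.
- move=> i; have [mui|mui] := ltP 0 (mu ord0 i).
    by rewrite subr_ge0 -ler_pdivlMr// i0min.
  rewrite subr_ge0 (le_trans _ (l0 i))// mulr_ge0_le0// /tau divr_ge0//.
  exact: ltW.
- by rewrite sumrB l1 -mulr_sumr mu1 mulr0 subr0.
- by rewrite /tau divfK ?subrr// gt_eqF.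
Qed.

Lemma combinationS S n x : combination S n x -> combination S n.+1 x.
Proof.
case: n => [[l [s [_ /eqP]]]|n]; first by rewrite big_ord0 eq_sym oner_eq0.
move=> [l [s [l0 l1 Ss ->]]].
exists (fun k => if unlift ord0 k is Some i then l i else 0).
exists (fun k => if unlift ord0 k is Some i then s i else s ord0).
split.
- by move=> i; case: unliftP.
- rewrite big_ord_recl unlift_none add0r -l1.
  by apply: eq_bigr => i _; rewrite liftK.
- by move=> i; case: unliftP.
- rewrite [RHS]big_ord_recl unlift_none scale0r add0r.
  by apply: eq_bigr => i _; rewrite liftK.
Qed.

Lemma combination_point S k x : S x -> combination S k.+1 x.
Proof.
move=> Sx; elim: k => [|k]; last exact: combinationS.
by exists (fun=> 1), (fun=> x); split => //; rewrite big_ord1// scale1r.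
Qed.

Lemma convex_hull_combination S x :
  convex_hull S x -> exists n, combination S n x.
Proof.
move=> /(_ (\bigcup_n combination S n)) []; last by move=> n _; exists n.
split; first exact: convex_combinations.
by move=> s Ss; exists 1%N => //; exact: combination_point.
Qed.

(** A combination of [n > d + 1] points is shortened one point at a time. *)
Lemma caratheodory S x : convex_hull S x -> combination S d.+1 x.
Proof.
move=> /convex_hull_combination[n Sx].
have [nd|/ltnW] := leqP n d.+1.
  rewrite -(subnKC nd); elim: (d.+1 - n)%N => [|k ih]; first by rewrite addn0.
  by rewrite addnS; exact: combinationS.
move=> dn; move: Sx; rewrite -(subnKC dn); elim: (n - d.+1)%N => [|k ih].
  by rewrite addn0.
by rewrite addnS => /caratheodory_step Sx; apply/ih/Sx; rewrite ltnS leq_addr.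
Qed.

(** The convex combinations of [k + 1] points, adding one point at a time:
    each stage is a continuous image of a compact set. *)
Fixpoint join_hull S k : set V :=
  if k is k'.+1 then
    [set z.1 *: z.2.1 + (1 - z.1) *: z.2.2 |
      z in `[0, 1]%classic `*` (S `*` join_hull S k')]
  else S.

Lemma join_hull_sub S k : join_hull S k `<=` convex_hull S.
Proof.
elim: k => [|k ih] /=; first exact: convex_hull_sub.
move=> _ [[t [s y]] /= [t01 [Ss /ih ky]] <-].
rewrite /= in_itv/= in t01.
apply: (convex_combination (@convex_convex_hull S) t01) => //.
exact: convex_hull_sub.
Qed.

Lemma combination_join_hull S k x : combination S k.+1 x -> join_hull S k x.
Proof.
elim: k x => [|k ih] x [l [s [l0 l1 Ss ->]]].
  by move: l1; rewrite !big_ord1 => ->; rewrite scale1r; exact: Ss.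
rewrite big_ord_recl; have l1' := l1; rewrite big_ord_recl in l1'.
have rest0 : 0 <= \sum_(i < k.+1) l (lift ord0 i) by exact: sumr_ge0.
have [l01|l01] := eqVneq (l ord0) 1.
  have r0 : \sum_(i < k.+1) l (lift ord0 i) = 0.
    by apply: (addrI (l ord0)); rewrite l1' addr0.
  have li0 i : l (lift ord0 i) = 0.
    move/eqP: r0; rewrite psumr_eq0// => /allP/(_ i).
    by rewrite mem_index_enum => /(_ isT)/eqP.
  exists (1, (s ord0, s ord0)) => /=; last first.
    rewrite subrr scale0r l01; congr (_ + _).
    by rewrite big1// => i _; rewrite li0 scale0r.
  split; first by rewrite /= in_itv/= ler01 lexx.
  by split=> //; apply/ih/combination_point/Ss.
have l0lt1 : 0 < 1 - l ord0.
  by rewrite subr_gt0 lt_neqAle l01/= -l1' lerDl.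
exists (l ord0, (s ord0, (1 - l ord0)^-1 *: \sum_(i < k.+1) l (lift ord0 i) *: s (lift ord0 i))) => /=; last first.
  by rewrite scalerA divff ?scale1r// gt_eqF.
split; first by rewrite /= in_itv/= l0 -subr_ge0 ltW.
split=> //; apply: ih.
exists (fun i => (1 - l ord0)^-1 * l (lift ord0 i)), (fun i => s (lift ord0 i)).
split=> //.
- by move=> i; rewrite mulr_ge0// invr_ge0 ltW.
- rewrite -mulr_sumr (_ : \sum_(i < _) _ = 1 - l ord0); last first.
    by rewrite -[X in X - _]l1' addrAC subrr add0r.
  by rewrite mulVf// gt_eqF.
- by rewrite scaler_sumr; apply: eq_bigr => i _; rewrite scalerA.
Qed.

Lemma compact_join_hull S k : compact S -> compact (join_hull S k).
Proof.
move=> cS; elim: k => [//|k ih] /=.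
apply: continuous_compact; last first.
  apply: compact_setX; first exact: segment_compact.
  exact: compact_setX.
apply: continuous_subspaceT => -[t [s y]].
apply: cvgD; apply: cvgZ.
- exact: cvg_fst.
- by apply: cvg_comp; [exact: cvg_snd|exact: cvg_fst].
- by apply: cvgB; [exact: cvg_cst|exact: cvg_fst].
- by apply: cvg_comp; [exact: cvg_snd|exact: cvg_snd].
Qed.

Lemma compact_convex_hull S : compact S -> compact (convex_hull S).
Proof.
move=> cS; rewrite (_ : convex_hull S = join_hull S d).
  exact: compact_join_hull.
apply/seteqP; split; last exact: join_hull_sub.
by move=> x /caratheodory; exact: combination_join_hull.
Qed.

(** If [p] were outside [K], the direction from the nearest point of [K] to [p]
    would separate them. *)
Lemma convex_separation K p :
  closed K -> @convex_set R V K -> K !=set0 ->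
  (forall v (a : R), (forall g, K g -> dotv g v <= a) -> dotv p v <= a) -> K p.
Proof.
move=> cK cvK K0 Kp.
have [q Kq qmin] := closed_nearest_point p cK K0.
have angle g : K g -> dotv (g - q) (p - q) <= 0.
  move=> Kg; set D := dotv (g - q) (p - q).
  have quad (t : R) : 0 <= t <= 1 -> 2 * t * D <= t ^+ 2 * enorm (g - q) ^+ 2.
    move=> t01; have Ky := convex_combination cvK t01 Kg Kq.
    have := qmin _ Ky; rewrite -(@ler_pXn2r _ 2)// ?nnegrE ?enorm_ge0//.
    have -> : t *: g + (1 - t) *: q - p = t *: (g - q) - (p - q).
      by apply/rowP => i; rewrite !mxE; ring.
    rewrite /D enormB !enorm_sq; move: (g - q) (p - q) => u w.
    by rewrite dotvBl !dotvBr !dotvZl !dotvZr (dotvC w u); lra.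
  rewrite leNgt; apply/negP => D0.
  have := quad 1; rewrite ler01 lexx => /(_ isT).
  set N := enorm (g - q) ^+ 2 => N2.
  have N0 : 0 < N by lra.
  have t01 : 0 <= D / N <= 1.
    by apply/andP; split; [rewrite divr_ge0// ltW|rewrite ler_pdivrMr//; lra].
  have := quad _ t01.
  have -> : (D / N) ^+ 2 * N = D / N * D by field; rewrite gt_eqF.
  have : 0 < D / N * D by rewrite mulr_gt0// divr_gt0.
  lra.
have := Kp (p - q) (dotv q (p - q)).
have H g : K g -> dotv g (p - q) <= dotv q (p - q).
  by move=> /angle; rewrite dotvBl subr_le0.
move=> /(_ H); rewrite -subr_le0 -dotvBl -enorm_sq => pq.
have /eqP : enorm (p - q) ^+ 2 = 0.
  by apply/eqP; rewrite eq_le pq sqr_ge0.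
by rewrite sqrf_eq0 enorm_eq0 subr_eq0 => /eqP ->.
Qed.

End convex_hulls.

(** * Sublinear functions are suprema of linear ones *)
Section sublinear.
Context {R : realType} {d : nat}.
Local Notation V := 'rV[R]_d.

(** Passage to the limit [s -> 0] in an inequality with an error of order [s]. *)
Lemma le_linear_perturbation (a b c : R) :
  (forall s, 0 < s < 1 -> a <= b + s * c) -> a <= b.
Proof.
move=> h; apply/ler_addgt0Pr => e e0.
have c0 : 0 < `|c| + 1 by rewrite ltr_wpDl.
pose s := Num.min 2^-1 (e / (`|c| + 1)).
have s0 : 0 < s by rewrite lt_min invr_gt0 ltr0n divr_gt0.
have s1 : s < 1 by rewrite gt_min invf_lt1// ltr1n.
rewrite (le_trans (h s _)) ?s0//.
rewrite lerD2l (@le_trans _ _ (s * (`|c| + 1)))//.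
  by rewrite ler_pM2l// (le_trans (ler_norm _))// lerDl.
by rewrite -ler_pdivlMr// ge_min lexx orbT.
Qed.

Variables (p : V -> R) (K : R).
Hypothesis p_add : forall v w, p (v + w) <= p v + p w.
Hypothesis p_scale : forall s v, 0 < s -> p (s *: v) = s * p v.
Hypothesis p_bound : forall v, p v <= K * enorm v.

Lemma sublinear_lipschitz : elipschitz K p.
Proof.
have H v w : p v - p w <= K * enorm (v - w).
  by rewrite lerBlDl (le_trans _ (lerD (lexx _) (p_bound _)))// (le_trans _ (p_add _ _))// addrC subrK.
by move=> v w; rewrite ler_norml H andbT -lerN2 opprK opprB enormB H.
Qed.

(** Finite-dimensional Hahn-Banach, up to [e]: a minimiser [w] of
    [p v + |v - v0|^2 / (2 tau)] exists by compactness, and the first-order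
    condition at [w] says that the linear form [(v0 - w) / tau] lies below [p]
    and touches it at [w], which is close to [v0] when [tau] is small. *)
Lemma sublinear_support v0 e : 0 <= K -> 0 < e ->
  exists g, (forall v, dotv g v <= p v) /\ p v0 - e <= dotv g v0.
Proof.
move=> K0 e0.
have [tau tau0 tauE] : exists2 tau, 0 < tau & tau * (2 * K ^+ 2) <= e.
  have K21 : 0 < 2 * K ^+ 2 + 1 by rewrite ltr_wpDl// mulr_ge0// sqr_ge0.
  exists (e / (2 * K ^+ 2 + 1)); first by rewrite divr_gt0.
  by rewrite mulrAC ler_pdivrMr// ler_pM2l// lerDl.
pose phi v := p v + enorm (v - v0) ^+ 2 / (2 * tau).
have cphi : continuous phi.
  have cp : continuous p by exact: (elipschitz_continuous sublinear_lipschitz).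
  apply: continuousT_add => //; apply: continuousT_mul; last exact: continuousT_cst.
  by under eq_fun do rewrite expr2; apply: continuousT_mul; exact: continuous_edist.
pose B := eball v0 (2 * tau * K + 1).
have tK0 : 0 <= 2 * tau * K by rewrite !mulr_ge0// ltW.
have Bv0 : B v0 by rewrite /B /eball/= subrr enorm0 addr_ge0.
have ctn : {within B, continuous (fun v => - phi v)}.
  by apply: continuous_subspaceT; exact: continuousT_opp.
have [w wB wmin] := @compact_EVT_max _ _ _ B (ex_intro _ v0 Bv0)
  (@compact_eball _ _ v0 _) ctn.
have far v : 2 * tau * K <= enorm (v - v0) -> p v0 <= phi v.
  move=> Kv; have := sublinear_lipschitz v v0; rewrite ler_norml => /andP[+ _].
  rewrite /phi; set N := enorm (v - v0) in Kv *.
  have N0 : 0 <= N by exact: enorm_ge0.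
  have : K * N <= N ^+ 2 / (2 * tau).
    have h : 2 * tau * K * N <= N * N by exact: ler_wpM2r.
    by rewrite ler_pdivlMr ?mulr_gt0//; lra.
  lra.
have phi0 : phi v0 = p v0 by rewrite /phi subrr enorm0 expr0n/= mul0r addr0.
have wmin' v : phi w <= phi v.
  have [vB|vB] := leP (enorm (v - v0)) (2 * tau * K + 1).
    by have := wmin v (mem_set vB); rewrite lerN2.
  rewrite (@le_trans _ _ (p v0))//; last by apply: far; lra.
  by have := wmin _ (mem_set Bv0); rewrite lerN2 phi0.
have wv0 : enorm (w - v0) <= 2 * tau * K.
  have [//|Kw] := leP (enorm (w - v0)) (2 * tau * K).
  have := wmin' v0; rewrite phi0 /phi.
  have := sublinear_lipschitz w v0; rewrite ler_norml => /andP[+ _].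
  set N := enorm (w - v0) in Kw *.
  have : K * N < N ^+ 2 / (2 * tau).
    have N0 : 0 < N by apply: le_lt_trans Kw.
    by have h : 2 * tau * K * N < N * N; [rewrite ltr_pM2r|
      rewrite ltr_pdivlMr ?mulr_gt0//; lra].
  lra.
pose g := tau^-1 *: (v0 - w).
have sqD v s : enorm (w + s *: v - v0) ^+ 2 / (2 * tau) =
    enorm (w - v0) ^+ 2 / (2 * tau) - s * dotv g v + s * (s * (enorm v ^+ 2 / (2 * tau))).
  rewrite (_ : w + s *: v - v0 = s *: v - (v0 - w)); last first.
    by apply/rowP => i; rewrite !mxE; ring.
  rewrite (enormB w) /g; move: (v0 - w) => u.
  rewrite !enorm_sq dotvBl !dotvBr !dotvZl !dotvZr (dotvC v).
  by field; rewrite gt_eqF.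
have gp v : dotv g v <= p v.
  apply: (@le_linear_perturbation _ _ (enorm v ^+ 2 / (2 * tau))) => s /andP[s0 s1].
  have := wmin' (w + s *: v); rewrite /phi sqD => h1.
  have h2 := p_add w (s *: v); rewrite p_scale// in h2.
  rewrite -(ler_pM2l s0); lra.
have gw : p w <= dotv g w.
  apply: (@le_linear_perturbation _ _ (enorm w ^+ 2 / (2 * tau))) => s /andP[s0 s1].
  have := wmin' (w + (- s) *: w); rewrite /phi sqD => h1.
  have h2 : p (w + (- s) *: w) = (1 - s) * p w.
    by rewrite -p_scale ?subr_gt0// scalerBl scale1r scaleNr.
  rewrite h2 in h1.
  rewrite -(ler_pM2l s0); lra.
exists g; split => //.
have -> : dotv g v0 = dotv g w + tau * enorm g ^+ 2.
  have tg : tau *: g = v0 - w by rewrite /g scalerA divff ?gt_eqF// scale1r.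
  by rewrite enorm_sq -dotvZr -dotvDr tg addrC subrK.
have : 0 <= tau * enorm g ^+ 2 by rewrite mulr_ge0 ?sqr_ge0// ltW.
have := sublinear_lipschitz v0 w; rewrite enormB ler_norml => /andP[_ h1] h2.
have h3 : K * enorm (w - v0) <= e.
  rewrite (@le_trans _ _ (K * (2 * tau * K)))// ?ler_wpM2l//.
  by have -> : K * (2 * tau * K) = tau * (2 * K ^+ 2) by ring.
lra.
Qed.

End sublinear.

(** * Clarke and Goldstein subdifferentials of Lipschitz functions *)
Section clarke.
Context {R : realType} {d : nat}.
Local Notation V := 'rV[R]_d.
Variables (f : V -> R) (K : R).
Hypotheses (d_gt0 : (0 < d)%N) (fK : elipschitz K f).
Implicit Types (x y z v w g : V) (r s t : R).

(** The difference quotients in direction [v] are eventually at most [r]: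
    [clarke_dd f y v] is the infimum of such [r]. *)
Definition quotient_bound y v r := exists2 e, 0 < e &
  forall z t, enorm (z - y) < e -> 0 < t < e -> f (z + t *: v) - f z <= t * r.

Lemma clarke_dd_le y v r : quotient_bound y v r -> (clarke_dd f y v <= r%:E)%E.
Proof.
move=> [e e0 fr]; apply: ereal_inf_le.
exists (ereal_sup ((fun p : V * R => ((f (p.1 + p.2 *: v) - f p.1) / p.2)%:E) @`
  [set p | enorm (p.1 - y) < e /\ 0 < p.2 < e])); last first.
  apply: ge_ereal_sup => _ [[z t] [/= zy t0] <-]; rewrite lee_fin.
  by rewrite ler_pdivrMr ?(andP t0).1// mulrC fr.
exists [set p : V * R | enorm (p.1 - y) < e /\ 0 < p.2 < e] => //.
exists ([set z | enorm (z - y) < e], [set t | 0 < t < e]) => /=.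
  split; first exact: near_enorm.
  near=> t; apply/andP; split; near: t; first exact: nbhs_right_gt.
  exact: nbhs_right_lt.
by move=> [z t] [].
Unshelve. all: end_near. Qed.

Lemma clarke_dd_lt y v r : (clarke_dd f y v < r%:E)%E -> quotient_bound y v r.
Proof.
move=> /ereal_inf_lt[_ [A [[B C] /= [By C0] BCA] <-] Ar].
have /nbhs_enormP[e1 e10 eB] := By.
have [e2 /= e20 eC] := C0.
exists (Num.min e1 e2); first by rewrite lt_min e10.
move=> z t; rewrite !lt_min => /andP[z1 z2] /andP[t0 /andP[t1 t2]].
have Azt : A (z, t).
  apply: BCA; split => /=; first exact: eB.
  by apply: eC => //=; rewrite sub0r normrN gtr0_norm.
have := le_lt_trans (ereal_sup_ubound (ex_intro2 _ _ (z, t) Azt erefl)) Ar.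
by rewrite /= lte_fin ltr_pdivrMr// mulrC => /ltW.
Qed.

Lemma quotient_bound_lipschitz y v : quotient_bound y v (K * enorm v).
Proof.
exists 1 => // z t _ /andP[t0 _].
rewrite (le_trans (ler_norm _))// (le_trans (fK _ _))//.
by rewrite addrAC subrr add0r enormZ gtr0_norm// mulrCA.
Qed.

Lemma quotient_bound_ge y v r : quotient_bound y v r -> - (K * enorm v) <= r.
Proof.
move=> [e e0 fr].
have e20 : 0 < e / 2 by rewrite divr_gt0.
have := fr y (e / 2); rewrite subrr enorm0 e0 e20 => /(_ isT).
rewrite ltr_pdivrMr// ltr_pMr// ltr1n => /(_ isT).
have := fK (y + (e / 2) *: v) y; rewrite ler_norml => /andP[+ _].
rewrite addrAC subrr add0r enormZ gtr0_norm// => h1 h2.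
rewrite -(ler_pM2l e20); lra.
Qed.

Lemma quotient_boundD y v w r s :
  quotient_bound y v r -> quotient_bound y w s -> quotient_bound y (v + w) (r + s).
Proof.
move=> [e1 e10 fr] [e2 e20 fs].
have v1 : 0 < 2 * (enorm v + 1) by rewrite mulr_gt0// ltr_wpDl// enorm_ge0.
pose e := Num.min (Num.min e1 (e2 / 2)) (e2 / (2 * (enorm v + 1))).
exists e; first by rewrite !lt_min e10 !divr_gt0.
move=> z t; rewrite !lt_min => /andP[/andP[z1 z2] _] /andP[t0 /andP[/andP[t1 t2] t3]].
have h1 : f (z + t *: v) - f z <= t * r by apply: fr; rewrite ?z1// t0.
have h2 : f (z + t *: v + t *: w) - f (z + t *: v) <= t * s.
  apply: fs; last by rewrite t0/=; lra.
  rewrite -addrA [t *: v - _]addrC addrA (le_lt_trans (enormD _ _))//.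
  rewrite enormZ gtr0_norm//; move: t3; rewrite ltr_pdivlMr// => t3.
  lra.
by rewrite scalerDr addrA; lra.
Qed.

Lemma quotient_boundZ y v r s : 0 < s ->
  quotient_bound y v r -> quotient_bound y (s *: v) (s * r).
Proof.
move=> s0 [e e0 fr]; exists (Num.min e (e / s)); first by rewrite lt_min e0 divr_gt0.
move=> z t; rewrite !lt_min => /andP[z1 _] /andP[t0 /andP[_ ts]].
rewrite scalerA mulrA; apply: fr => //.
by rewrite mulr_gt0//= -ltr_pdivlMr.
Qed.

Lemma clarke_dd_fin y v : clarke_dd f y v \is a fin_num.
Proof.
rewrite fin_numE; apply/andP; split; apply/eqP => h.
  have /clarke_dd_lt/quotient_bound_ge : (clarke_dd f y v < (- (K * enorm v) - 1)%:E)%E.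
    by rewrite h ltNyr.
  lra.
by have := clarke_dd_le (quotient_bound_lipschitz y v); rewrite h leye_eq.
Qed.

Let p y v : R := fine (clarke_dd f y v).

Let pE y v : clarke_dd f y v = (p y v)%:E.
Proof. by rewrite /p fineK// clarke_dd_fin. Qed.

Let p_le y v r : quotient_bound y v r -> p y v <= r.
Proof. by rewrite -lee_fin -pE; exact: clarke_dd_le. Qed.

Let p_lt y v r : p y v < r -> quotient_bound y v r.
Proof. by rewrite -lte_fin -pE; exact: clarke_dd_lt. Qed.

Let p_add y v w : p y (v + w) <= p y v + p y w.
Proof.
apply/ler_addgt0Pr => e e0.
rewrite (_ : _ + e = (p y v + e / 2) + (p y w + e / 2)); last by lra.
by apply: p_le; apply: quotient_boundD; apply: p_lt; rewrite ltrDl divr_gt0.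
Qed.

Let p_scale_le y s v : 0 < s -> p y (s *: v) <= s * p y v.
Proof.
move=> s0; apply/ler_addgt0Pr => e e0.
rewrite (_ : _ + e = s * (p y v + e / s)); last by field; rewrite gt_eqF.
by apply: p_le; apply: quotient_boundZ => //; apply: p_lt; rewrite ltrDl divr_gt0.
Qed.

Let p_scale y s v : 0 < s -> p y (s *: v) = s * p y v.
Proof.
move=> s0; apply/eqP; rewrite eq_le p_scale_le//=.
have := @p_scale_le y s^-1 (s *: v); rewrite invr_gt0 => /(_ s0).
by rewrite scalerA mulVf ?gt_eqF// scale1r -(ler_pM2l s0) mulrA divff ?gt_eqF// mul1r.
Qed.

(** The Clarke derivative is sublinear in [v] and bounded by [K |v|]. *)
Lemma clarke_support y v e : 0 < e ->
  exists2 g, clarke_subdiff f y g & (clarke_dd f y v - e%:E <= (dotv g v)%:E)%E.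
Proof.
move=> e0.
have [g [gp gv]] := sublinear_support (@p_add y) (@p_scale y)
  (fun v => p_le (quotient_bound_lipschitz y v)) v (elipschitz_ge0 d_gt0 fK) e0.
by exists g; [move=> w; rewrite pE lee_fin|rewrite pE -EFinB lee_fin].
Qed.

Lemma clarke_subdiff_bounded y g : clarke_subdiff f y g -> enorm g <= K.
Proof.
move=> /(_ g) /le_trans /(_ (clarke_dd_le (quotient_bound_lipschitz y g))).
rewrite lee_fin -enorm_sq expr2.
have [->|g0] := eqVneq g 0; first by rewrite enorm0 (elipschitz_ge0 d_gt0 fK).
by rewrite ler_pM2r// enorm_gt0.
Qed.

(** Upper semicontinuity of [clarke_dd] in the point makes the graph of the
    subdifferential closed. *)
Lemma compact_clarke_union x r :
  compact (\bigcup_(y in eball x r) clarke_subdiff f y).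
Proof.
pose Gr := [set z : V * V | eball x r z.1 /\ clarke_subdiff f z.1 z.2].
rewrite (_ : \bigcup_(y in _) _ = snd @` Gr); last first.
  apply/seteqP; split=> [g [y yB yg]|_ [[y g] [/= yB yg] <-]]; last by exists y.
  by exists (y, g).
apply: continuous_compact.
  by apply: continuous_subspaceT => z; exact: cvg_snd.
have cB : compact (eball x r `*` eball (0 : V) K).
  by apply: compact_setX; exact: compact_eball.
apply: (subclosed_compact _ cB); last first.
  move=> [y g] [/= yB yg]; split => //=.
  by rewrite /eball/= subr0 (clarke_subdiff_bounded yg).
move=> [y g] yg; split => /=.
  have : closed (eball x r) by apply: compact_closed; [exact: norm_hausdorff|exact: compact_eball].
  apply => A Ay.
  have [|[y' g'] [[/= y'B _] [Ay' _]]] := yg (A `*` setT).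
    by exists (A, setT) => //=; split => //; exact: filterT.
  by exists y'.
move=> v; rewrite pE lee_fin leNgt; apply/negP => pg.
pose s := (p y v + dotv g v) / 2.
have [e e0 fe] : quotient_bound y v s by apply: p_lt; rewrite /s; lra.
have v1 : 0 < enorm v + 1 by rewrite ltr_wpDl// enorm_ge0.
pose eta := (dotv g v - s) / (enorm v + 1).
have eta0 : 0 < eta by rewrite divr_gt0// /s; lra.
have [|[y' g'] [[/= y'B y'g'] [/= yy' gg']]] :=
  yg ([set z | enorm (z - y) < e / 2] `*` [set z | enorm (z - g) < eta]).
  exists ([set z | enorm (z - y) < e / 2], [set z | enorm (z - g) < eta]) => //=.
  by split; apply: near_enorm => //; rewrite divr_gt0.
have : dotv g' v <= s.
  rewrite -lee_fin (le_trans (y'g' v))// clarke_dd_le//.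
  exists (e / 2); first by rewrite divr_gt0.
  move=> z t zy' /andP[t0 te]; apply: fe; last by rewrite t0/=; lra.
  by rewrite (le_lt_trans (enorm_triangle y' _ _))//; lra.
have := normr_dotv_le (g' - g) v; rewrite dotvBl ler_norml => /andP[h1 _].
have h2 : enorm (g' - g) * enorm v <= eta * enorm v by rewrite ler_wpM2r ?enorm_ge0// ltW.
have h3 : eta * enorm v < dotv g v - s.
  by rewrite /eta mulrAC ltr_pdivrMr// ltr_pM2l ?ltrDl//; rewrite /s; lra.
lra.
Qed.

Lemma compact_goldstein x r : compact (goldstein_subdiff r f x).
Proof. by apply: compact_convex_hull; exact: compact_clarke_union. Qed.

Lemma goldstein_subdiff_neq0 x r : 0 <= r -> goldstein_subdiff r f x !=set0.
Proof.
move=> r0; have [g xg _] := @clarke_support x 0 1 ltr01.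
exists g; apply: convex_hull_sub; exists x => //.
by rewrite /eball/= subrr enorm0.
Qed.

Lemma closed_goldstein x r : closed (goldstein_subdiff r f x).
Proof. by apply: compact_closed; [exact: norm_hausdorff|exact: compact_goldstein]. Qed.

(** The support function of the Goldstein subdifferential in direction [v] is
    the largest Clarke derivative over the ball. *)
Lemma goldstein_subdiff_mem x r q : 0 <= r ->
  (forall v a, (forall y, eball x r y -> (clarke_dd f y v <= a%:E)%E) ->
     dotv q v <= a) ->
  goldstein_subdiff r f x q.
Proof.
move=> r0 qv; apply: convex_separation.
- exact: closed_goldstein.
- exact: convex_convex_hull.
- exact: goldstein_subdiff_neq0.
move=> v a ga; apply: qv => y yB; rewrite pE lee_fin.
apply/ler_addgt0Pr => e e0; have [g yg] := clarke_support y v e0.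
rewrite pE -EFinB lee_fin lerBlDr => /le_trans; apply.
rewrite lerD2r; apply: ga; rewrite /goldstein_subdiff; apply: convex_hull_sub.
by exists y.
Qed.

Lemma goldstein_min_norm_le x r q :
  goldstein_subdiff r f x q -> (min_norm (goldstein_subdiff r f x) <= (enorm q)%:E)%E.
Proof.
move=> Sq.
have [|g Sg gmin] := @closed_nearest_point _ _ (goldstein_subdiff r f x) 0 (@closed_goldstein x r).
  by exists q.
have gmin' g' : goldstein_subdiff r f x g' -> enorm g <= enorm g'.
  by move=> /gmin; rewrite !subr0.
apply: (@le_trans _ _ (enorm g)%:E); last by rewrite lee_fin gmin'.
by apply: ereal_inf_lbound; exists g.
Qed.

(** Compactness makes the bound on the difference quotients uniform over the
    ball. *)
Lemma clarke_dd_uniform x r v a e : 0 < e ->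
  (forall y, eball x r y -> (clarke_dd f y v <= a%:E)%E) ->
  \forall t \near (0 : R)^'+, forall y, eball x r y ->
     f (y + t *: v) - f y <= t * (a + e).
Proof.
move=> e0 fa.
have /compact_near_coveringP := @compact_eball R d x r.
move=> /(_ R (0^'+) (fun t y => f (y + t *: v) - f y <= t * (a + e)) _).
apply => y yB.
have [e1 e10 fe1] : quotient_bound y v (a + e).
  by apply: clarke_dd_lt; rewrite (le_lt_trans (fa y yB))// lte_fin ltrDl.
exists ([set z | enorm (z - y) < e1], [set t | 0 < t < e1]) => /=.
  split; first exact: near_enorm.
  near=> t; apply/andP; split; near: t; first exact: nbhs_right_gt.
  exact: nbhs_right_lt.
by move=> [z t] [/= zy t0]; exact: fe1.
Unshelve. all: end_near. Qed.

End clarke.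

(** * Lebesgue measure on row vectors *)
Section lebesgue_boxes.
Context {R : realType}.
Local Notation R' := (measurableTypeR R).

Lemma measurable_coord d (i : 'I_d) :
  measurable_fun [set: 'rV[R]_d] (fun x => x ord0 i : R').
Proof.
move=> _ A mA; rewrite setTI; apply: sub_sigma_algebra.
rewrite -bigcup_seq; exists i; first by rewrite /= mem_index_enum.
by exists A => //; rewrite setTI.
Qed.

Definition box d (A : 'I_d -> set R') : set 'rV[R]_d :=
  [set x | forall i, A i (x ord0 i)].

Lemma boxE d (A : 'I_d -> set R') :
  box A = \bigcap_(i in [set: 'I_d]) ((fun x : 'rV[R]_d => x ord0 i) @^-1` A i).
Proof. by apply/seteqP; split => x /= xA i; [move=> _; exact: xA|exact: xA]. Qed.

Lemma measurable_box d (A : 'I_d -> set R') :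
  (forall i, measurable (A i)) -> measurable (box A).
Proof.
move=> mA; rewrite boxE; apply: fin_bigcap_measurable => // i _.
by rewrite -[X in measurable X]setTI; exact: measurable_coord.
Qed.

Lemma lebesgue_tuple_box d (A : 'I_d -> set R') :
  (forall i, measurable (A i)) ->
  lebesgue_tuple [set t : d.-tuple R' | forall i, A i (tnth t i)] =
  (\prod_(i < d) lebesgue_measure (A i))%E.
Proof.
elim: d A => [|d ih] A mA.
  by rewrite big_ord0 /= diracE mem_set//= => -[].
have [mu muE] := lebesgue_tuple_ex R d.
rewrite big_ord_recl /= /pushforward -muE.
pose B : set (d.-tuple R') := [set t | forall i, A (lift ord0 i) (tnth t i)].
have mB : measurable B.
  rewrite (_ : B = \bigcap_(i in [set: 'I_d]) ((fun t => tnth t i) @^-1` A (lift ord0 i))).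
    apply: fin_bigcap_measurable => // i _.
    by rewrite -[X in measurable X]setTI; exact: measurable_tnth.
  by apply/seteqP; split => x /= xA i; [move=> _; exact: xA|exact: xA].
rewrite (_ : _ @^-1` _ = A ord0 `*` B); last first.
  apply/seteqP; split => -[a t] /=.
    move=> h; split; first by have := h ord0.
    by move=> i; have := h (lift ord0 i); rewrite tnthS.
  move=> [Aa Bt] i; case: (unliftP ord0 i) => [j ->|->//].
  by rewrite tnthS; exact: Bt.
rewrite product_measure1E//; congr (_ * _)%E.
by rewrite muE; apply: (ih (fun i => A (lift ord0 i))) => i; exact: mA.
Qed.

Lemma lebesgue_box d (A : 'I_d -> set R') :
  (forall i, measurable (A i)) ->
  lebesgue_rV (box A) = (\prod_(i < d) lebesgue_measure (A i))%E.
Proof.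
move=> mA; rewrite /lebesgue_rV /pushforward -lebesgue_tuple_box//.
congr lebesgue_tuple; apply/seteqP; split => t /= h i; have := h i; by rewrite mxE.
Qed.

Lemma measurable_rV_boxes d :
  (measurable : set (set 'rV[R]_d)) =
  <<s [set box A | A in [set A : 'I_d -> set R' | forall i, measurable (A i)]] >>.
Proof.
apply/seteqP; split.
  apply: smallest_sub; first exact: smallest_sigma_algebra.
  rewrite -bigcup_seq => _ [i _ [C mC <-]]; apply: sub_sigma_algebra.
  exists (fun j => if j == i then C else setT).
    by move=> j; case: ifP.
  rewrite setTI; apply/seteqP; split => x /=.
    by move=> /(_ i); rewrite eqxx.
  by move=> Cx j; case: eqP => // ->.
apply: smallest_sub; first exact: sigma_algebra_measurable.
by move=> _ [A mA <-]; exact: measurable_box.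
Qed.

Definition cube d (n : nat) : set 'rV[R]_d :=
  box (fun=> `[(- n%:R : R), n%:R]%classic : set R').

Lemma lebesgue_cube_lty d n : (lebesgue_rV (@cube d n) < +oo)%E.
Proof.
rewrite /cube lebesgue_box; last by move=> i; exact: measurable_itv.
rewrite ltey_eq; apply/orP; left.
elim/big_ind : _ => //; first exact: fin_numM.
by move=> i _; rewrite lebesgue_measure_itv/=; case: ifP.
Qed.

Lemma bigcup_cube d : \bigcup_n (@cube d n) = setT.
Proof.
apply/seteqP; split => // x _.
exists (Num.truncn (enorm x)).+1 => // i /=.
rewrite in_itv/= -ler_norml (le_trans (coord_le_enorm _ _))// ltW//.
by rewrite truncnS_gt.
Qed.

(** The boxes form a pi-system that generates the Borel sets, and the cubes
    exhaust the space. *)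
Lemma measure_rV_unique d (m1 m2 : {measure set 'rV[R]_d -> \bar R}) :
  (forall n, m1 (@cube d n) < +oo)%E ->
  (forall A : 'I_d -> set R', (forall i, measurable (A i)) ->
     m1 (box A) = m2 (box A)) ->
  forall A, measurable A -> m1 A = m2 A.
Proof.
move=> m1oo m12.
apply: (measure_unique
  [set box A | A in [set A : 'I_d -> set R' | forall i, measurable (A i)]] (@cube d)).
- exact: measurable_rV_boxes.
- move=> _ _ [A mA <-] [B mB <-]; exists (fun i => A i `&` B i).
    by move=> i; exact: measurableI.
  apply/seteqP; split => x /=; first by move=> h; split=> i; have [] := h i.
  by move=> [h1 h2] i; split; [exact: h1|exact: h2].
- by move=> n; exists (fun=> `[(- n%:R : R), n%:R]%classic) => // i; exact: measurable_itv.
- exact: bigcup_cube.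
- by move=> _ [A mA <-]; exact: m12.
- exact: m1oo.
Qed.

Lemma sigma_finite_lebesgue_rV d : sigma_finite [set: 'rV[R]_d] (@lebesgue_rV R d).
Proof.
exists (@cube d); first by rewrite bigcup_cube.
move=> n; split; last exact: lebesgue_cube_lty.
by apply: measurable_box => i; exact: measurable_itv.
Qed.

HB.instance Definition _ d := @Measure_isSigmaFinite.Build _ _ _ (@lebesgue_rV R d)
  (@sigma_finite_lebesgue_rV d).

End lebesgue_boxes.

Section lebesgue_affine.
Context {R : realType}.
Local Notation R' := (measurableTypeR R).

Lemma lebesgue_measure_affine (a b : R) (A : set R') : a != 0 -> measurable A ->
  lebesgue_measure ((fun x : R' => a * x + b : R') @^-1` A) =
  (`|a|^-1%:E * lebesgue_measure A)%E.
Proof.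
move=> a0 mA.
have mphi : measurable_fun setT (fun x : R' => a * x + b : R').
  by apply: measurable_funD => //; exact: mulrl_measurable.
pose nu := pushforward lebesgue_measure (fun x : R' => a * x + b : R').
pose nu' : {measure set R' -> \bar R} :=
  measure_function_pushforward__canonical__measure_function_Measure lebesgue_measure mphi.
pose mu := mscale (NngNum (normr_ge0 a)) nu'.
have na0 : `|a| != 0 by rewrite normr_eq0.
have muE : forall X, measurable X -> lebesgue_measure X = mu X.
  apply: lebesgue_measure_unique => _ [[u v] /= uv <-].
  rewrite /mu /mscale/= /pushforward.
  case: (ltgtP 0 a) a0 => // a0 _.
  - rewrite (_ : _ @^-1` _ = `](u - b) / a, (v - b) / a]%classic); last first.
      by apply/seteqP; split => x /=; rewrite !in_itv/= ltr_pdivrMr// ler_pdivlMr// ltrBlDr lerBrDr mulrC.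
    rewrite !lebesgue_measure_itv/= !lte_fin ltr_pM2r ?invr_gt0// ltrD2r gtr0_norm//.
    case: ifP => _; last by rewrite mule0.
    by rewrite -!EFinB -EFinM; congr EFin; field; rewrite gt_eqF.
  - rewrite (_ : _ @^-1` _ = `[(v - b) / a, (u - b) / a[%classic); last first.
      by apply/seteqP; split => x /=; rewrite !in_itv/= ler_ndivrMr// ltr_ndivlMr// ltrBlDr lerBrDr mulrC andbC.
    rewrite !lebesgue_measure_itv/= !lte_fin ltr_nM2r ?invr_lt0// ltrD2r ltr0_norm//.
    case: ifP => _; last by rewrite mule0.
    by rewrite -!EFinB -EFinM; congr EFin; field; rewrite lt_eqF.
have := muE _ mA; rewrite /mu /mscale/= => ->.
by rewrite /pushforward muleA -EFinM mulVf// mul1e.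
Qed.


(** Lebesgue measure is equivariant under permuting the coordinates and
    applying an affine map to each of them: all the symmetries below
    (translations, dilations, reflections, transpositions) are of this form. *)
Lemma lebesgue_rV_affine d (s : {perm 'I_d}) (a b : 'I_d -> R)
    (A : set 'rV[R]_d) : (forall i, a i != 0) -> measurable A ->
  lebesgue_rV ((fun x : 'rV[R]_d => \row_i (a i * x ord0 (s i) + b i)) @^-1` A) =
  ((\prod_i `|a i|^-1)%:E * lebesgue_rV A)%E.
Proof.
move=> a0 mA.
pose phi := fun x : 'rV[R]_d => \row_i (a i * x ord0 (s i) + b i) : 'rV[R]_d.
have mphi : measurable_fun setT phi.
  apply: measurable_fun_rV => i; rewrite /phi; under eq_fun do rewrite mxE.
  apply: measurable_funD => //.
  by apply: (measurableT_comp (mulrl_measurable (a i))); exact: measurable_coord.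
pose m1 : {measure set 'rV[R]_d -> \bar R} :=
  measure_function_pushforward__canonical__measure_function_Measure (@lebesgue_rV R d) mphi.
have p0 : 0 <= \prod_i `|a i|^-1 by apply: prodr_ge0 => i _; rewrite invr_ge0.
pose m2 := mscale (NngNum p0) (@lebesgue_rV R d).
rewrite [RHS](_ : _ = m2 A)//; symmetry.
apply: (@measure_rV_unique _ _ m2 m1) => //.
  by move=> n; rewrite /m2/= /mscale/= lte_mul_pinfty// lebesgue_cube_lty.
move=> B mB; rewrite /m1 /m2 /= /mscale /pushforward/=.
rewrite lebesgue_box//.
rewrite (_ : _ @^-1` _ =
    box (fun j => (fun x : R' => a ((s^-1)%g j) * x + b ((s^-1)%g j)) @^-1` B ((s^-1)%g j))); last first.
  apply/seteqP; split => x /= h i.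
    by have := h ((s^-1)%g i); rewrite mxE permKV.
  by have := h (s i); rewrite mxE permK.
have maff i : measurable_fun setT (fun x : R' => a i * x + b i : R').
  by apply: measurable_funD => //; exact: mulrl_measurable.
rewrite lebesgue_box; last first.
  by move=> i; rewrite -[X in measurable X]setTI; exact: maff.
rewrite [RHS](reindex_inj (@perm_inj _ s))/=.
under [RHS]eq_bigr do rewrite permK lebesgue_measure_affine//.
by rewrite big_split/= prodEFin.
Qed.

End lebesgue_affine.

Section integral_scaling.
Local Open Scope ereal_scope.
Context dT (T : measurableType dT) (R : realType) (mu : {measure set T -> \bar R}).
Variables (phi : T -> T) (c : R).
Hypotheses (mphi : measurable_fun setT phi) (c0 : (0 < c)%R).
Hypothesis muphi : forall A, measurable A -> mu (phi @^-1` A) = c%:E * mu A.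

Lemma ge0_integral_scaling_map (f : T -> \bar R) : measurable_fun setT f ->
  (forall x, 0 <= f x) -> \int[mu]_x f (phi x) = c%:E * \int[mu]_x f x.
Proof.
move=> mf f0.
have -> : \int[mu]_x f (phi x) = \int[pushforward mu phi]_x f x.
  by rewrite ge0_integral_pushforward.
rewrite -(ge0_integral_mscale mu measurableT (NngNum (ltW c0)) mf) => [|x _]; last exact: f0.
pose nu : {measure set T -> \bar R} :=
  measure_function_pushforward__canonical__measure_function_Measure mu mphi.
apply: (@eq_measure_integral _ _ _ setT (mscale (NngNum (ltW c0)) mu) nu).
by move=> A mA _; rewrite /nu /mscale/= /pushforward muphi.
Qed.

Lemma integral_scaling_map (f : T -> \bar R) : measurable_fun setT f ->
  \int[mu]_x f (phi x) = c%:E * \int[mu]_x f x.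
Proof.
move=> mf; rewrite integralE [in RHS]integralE.
have -> : \int[mu]_x (fun x => f (phi x))^\+ x = \int[mu]_x f^\+ (phi x) by apply: eq_integral => x _; rewrite funeposE funeposE.
have -> : \int[mu]_x (fun x => f (phi x))^\- x = \int[mu]_x f^\- (phi x) by apply: eq_integral => x _; rewrite funenegE funenegE.
rewrite !ge0_integral_scaling_map//; [|exact: measurable_funeneg|exact: measurable_funepos].
have : 0 <= \int[mu]_x f^\+ x by exact: integral_ge0.
have : 0 <= \int[mu]_x f^\- x by exact: integral_ge0.
case: (\int[mu]_x f^\- x) => [b| |] // _; case: (\int[mu]_x f^\+ x) => [a| |] // _.
- by rewrite -!EFinM -EFinB mulrBr.
- by rewrite gt0_muley ?lte_fin// -EFinM.
- by rewrite gt0_muley ?lte_fin// -EFinM /= gt0_muleNy ?lte_fin.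
- by rewrite gt0_muley ?lte_fin//= gt0_muleNy ?lte_fin.
Qed.

End integral_scaling.

(** * Borel measurability on row vectors *)
Section measurability.
Context {R : realType} {d : nat}.
Local Notation V := 'rV[R]_d.

Definition rational_row (n : nat) : V :=
  map_mx ratr (odflt 0 (unpickle n : option 'rV[rat]_d)).

Lemma rational_row_dense (x : V) (e : R) : 0 < e ->
  exists n, enorm (rational_row n - x) < e.
Proof.
move=> e0.
have ed : 0 < e / (d%:R + 1) by rewrite divr_gt0// ltr_wpDl.
have /choice[q qx] : forall i : 'I_d, exists q : rat,
    x ord0 i < ratr q < x ord0 i + e / (d%:R + 1).
  move=> i; have : x ord0 i < x ord0 i + e / (d%:R + 1) by rewrite ltrDl.
  by move=> /rat_in_itvoo[q]; rewrite in_itv/= => ?; exists q.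
exists (pickle (\row_i q i)); rewrite /rational_row pickleK/=.
rewrite (le_lt_trans (enorm_le_sum _))//.
rewrite (@le_lt_trans _ _ (\sum_(i < d) (e / (d%:R + 1))))//.
  apply: ler_sum => i _; rewrite !mxE.
  by have /andP[h1 h2] := qx i; rewrite ger0_norm; lra.
rewrite sumr_const card_ord -[X in X < _]mulr_natl mulrA ltr_pdivrMr ?ltr_wpDl//.
by rewrite mulrC ltr_pM2l// ltrDl.
Qed.

Lemma measurable_enorm : measurable_fun setT (@enorm R d).
Proof.
have ms : measurable_fun setT (Num.sqrt : R -> R).
  by apply: continuous_measurable_fun; exact: sqrt_continuous.
have md : measurable_fun setT (fun x : 'rV[R]_d => dotv x x).
  rewrite /dotv; apply: measurable_sum => i.
  by apply: measurable_funM; exact: measurable_coord.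
exact: (measurableT_comp ms md).
Qed.

Lemma measurable_rV_comp dT (T : measurableType dT) (g : T -> V) :
  measurable_fun setT g <-> forall i, measurable_fun setT (fun t => g t ord0 i).
Proof.
split; last exact: measurable_fun_rV.
by move=> mg i; apply: (measurableT_comp (measurable_coord i)).
Qed.

Lemma measurable_rV_add dT (T : measurableType dT) (f g : T -> V) :
  measurable_fun setT f -> measurable_fun setT g ->
  measurable_fun setT (fun t => f t + g t).
Proof.
move=> /measurable_rV_comp mf /measurable_rV_comp mg; apply/measurable_rV_comp => i.
by under eq_fun do rewrite mxE; apply: measurable_funD.
Qed.

Lemma measurable_rV_scale dT (T : measurableType dT) (a : T -> R) (g : T -> V) :
  measurable_fun setT a -> measurable_fun setT g ->
  measurable_fun setT (fun t => a t *: g t).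
Proof.
move=> ma /measurable_rV_comp mg; apply/measurable_rV_comp => i.
by under eq_fun do rewrite mxE; apply: measurable_funM.
Qed.

Lemma measurable_rV_opp dT (T : measurableType dT) (g : T -> V) :
  measurable_fun setT g -> measurable_fun setT (fun t => - g t).
Proof.
move=> /measurable_rV_comp mg; apply/measurable_rV_comp => i.
by under eq_fun do rewrite mxE; apply: measurableT_comp.
Qed.

Lemma measurable_dotv dT (T : measurableType dT) (f g : T -> V) :
  measurable_fun setT f -> measurable_fun setT g ->
  measurable_fun setT (fun t => dotv (f t) (g t)).
Proof.
move=> /measurable_rV_comp mf /measurable_rV_comp mg; rewrite /dotv.
by apply: measurable_sum => i; apply: measurable_funM.
Qed.

(** A function that is Lipschitz in its first argument is the infimum of the
    cones with apexes at the points of a countable dense set, hence jointly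
    measurable. *)
Lemma measurable_lipschitz_pair dX (Xi : measurableType dX)
    (F : V -> Xi -> R) (L : Xi -> R) :
  (forall x, measurable_fun setT (F x)) -> measurable_fun setT L ->
  (forall xi, elipschitz (L xi) (F ^~ xi)) ->
  measurable_fun setT (fun p : V * Xi => F p.1 p.2).
Proof.
move=> mF mL FL _; apply: (measurability _ (RGenInftyO.measurableE R)) => //.
move=> /= _ [_ [a ->] <-]; rewrite setTI.
rewrite (_ : _ @^-1` _ = \bigcup_n [set p : V * Xi |
    F (rational_row n) p.2 + L p.2 * enorm (p.1 - rational_row n) < a]).
  apply: bigcup_measurable => n _.
  rewrite (_ : mkset _ = (fun p : V * Xi =>
    F (rational_row n) p.2 + L p.2 * enorm (p.1 - rational_row n)) @^-1` `]-oo, a[%classic).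
    rewrite -[X in measurable X]setTI.
    apply: (_ : measurable_fun setT _) => //.
    apply: measurable_funD; first by apply: measurableT_comp => //; exact: mF.
    apply: measurable_funM; first exact: measurableT_comp.
    apply: (measurableT_comp measurable_enorm).
    by apply: measurable_rV_add => //; exact: measurable_cst.
  by apply/seteqP; split => p /=; rewrite in_itv.
apply/seteqP; split => -[x xi] /=; rewrite in_itv/=.
  have L0 : 0 < 2 * `|L xi| + 1 by rewrite ltr_wpDl// mulr_ge0.
  move=> Fa; have [|n qn] := @rational_row_dense x ((a - F x xi) / (2 * `|L xi| + 1)).
    by rewrite divr_gt0 ?subr_gt0.
  exists n => //=.
  have := FL xi (rational_row n) x; rewrite /= ler_norml => /andP[_].
  move: qn; rewrite ltr_pdivlMr//.
  rewrite (enormB x); set D := enorm _ => qn h1.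
  have : L xi * D <= `|L xi| * D by rewrite ler_wpM2r ?enorm_ge0// ler_norm.
  have : 0 <= D by exact: enorm_ge0.
  lra.
move=> [n _ /=]; apply: le_lt_trans.
by have := FL xi x (rational_row n); rewrite /= ler_norml => /andP[_]; lra.
Qed.

Lemma measurable_elipschitz (k : R) (h : V -> R) :
  elipschitz k h -> measurable_fun setT h.
Proof.
move=> hk; have := @measurable_lipschitz_pair _ unit (fun x _ => h x) (fun=> k)
  (fun x => measurable_cst _) (measurable_cst _) (fun=> hk).
move=> mh; have : measurable_fun setT (fun x : V => (x, tt)).
  by apply: measurable_fun_pair => //; exact: measurable_cst.
by move=> /(measurableT_comp mh).
Qed.

Lemma measurable_eball (x : V) r : measurable (eball x r).
Proof.
rewrite (_ : eball x r = (fun y => enorm (y - x)) @^-1` `]-oo, r]%classic); last first.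
  by apply/seteqP; split => y /=; rewrite in_itv.
rewrite -[X in measurable X]setTI; apply: (_ : measurable_fun setT _) => //.
apply: (measurableT_comp measurable_enorm).
by apply: measurable_rV_add => //; exact: measurable_cst.
Qed.

End measurability.

(** * Symmetries of Lebesgue measure and the volume of balls *)
Section lebesgue_symmetries.
Context {R : realType} {d : nat}.
Local Notation V := 'rV[R]_d.
Local Notation m := (@lebesgue_rV R d).
Implicit Types f : V -> \bar R.

Lemma integral_affine (s : {perm 'I_d}) (a b : 'I_d -> R) (phi : V -> V) f :
  (forall x, phi x = \row_i (a i * x ord0 (s i) + b i)) ->
  (forall i, a i != 0) -> measurable_fun setT f ->
  (\int[m]_x f (phi x) = (\prod_i `|a i|^-1)%:E * \int[m]_x f x)%E.
Proof.
move=> phiE a0 mf; apply: integral_scaling_map => //.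
- apply/measurable_rV_comp => i.
  under eq_fun do rewrite phiE mxE; apply: measurable_funD => //.
  by apply: (measurableT_comp (mulrl_measurable (a i))); exact: measurable_coord.
- by apply: prodr_gt0 => i _; rewrite invr_gt0 normr_gt0.
- move=> A mA; rewrite -(@lebesgue_rV_affine _ _ s a b)//.
  by congr (m (_ @^-1` A)); apply/funext.
Qed.

Lemma integral_translation (b : V) f : measurable_fun setT f ->
  (\int[m]_x f ((x : V) + b)%R = \int[m]_x f x)%E.
Proof.
move=> mf; rewrite (@integral_affine 1%g (fun=> 1) (fun i => b ord0 i) (fun x => x + b))//.
  by rewrite big1 ?mul1e// => i _; rewrite normr1 invr1.
by move=> x; apply/rowP => i; rewrite !mxE perm1 mul1r.
Qed.

Lemma integral_dilation (r : R) f : r != 0 -> measurable_fun setT f ->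
  (\int[m]_x f (r *: (x : V))%R = ((`|r| ^+ d)^-1)%:E * \int[m]_x f x)%E.
Proof.
move=> r0 mf; rewrite (@integral_affine 1%g (fun=> r) (fun i => 0) (fun x => r *: x))//.
  by rewrite prodr_const card_ord exprVn.
by move=> x; apply/rowP => i; rewrite !mxE perm1 addr0.
Qed.

Lemma integral_reflection f : measurable_fun setT f ->
  (\int[m]_x f (- (x : V))%R = \int[m]_x f x)%E.
Proof.
move=> mf; have := @integral_dilation (-1) f; rewrite oppr_eq0 oner_eq0 => /(_ isT mf).
rewrite normrN1 expr1n invr1 mul1e => <-.
by apply: eq_integral => x _; rewrite scaleN1r.
Qed.

Definition reflect_coord (i : 'I_d) (x : V) : V :=
  \row_j (if j == i then - x ord0 j else x ord0 j).

Lemma integral_reflect_coord i f : measurable_fun setT f ->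
  (\int[m]_x f (reflect_coord i x) = \int[m]_x f x)%E.
Proof.
move=> mf; rewrite (@integral_affine 1%g (fun j => if j == i then -1 else 1) (fun=> 0) (reflect_coord i))//.
- by rewrite big1 ?mul1e// => j _; case: ifP; rewrite ?normrN1 ?normr1 invr1.
- move=> x; apply/rowP => j; rewrite !mxE perm1 addr0.
  by case: ifP; rewrite ?mulN1r ?mul1r.
- by move=> j; case: ifP; rewrite ?oppr_eq0 oner_eq0.
Qed.

Definition swap_coord (i j : 'I_d) (x : V) : V := \row_k x ord0 (tperm i j k).

Lemma integral_swap_coord i j f : measurable_fun setT f ->
  (\int[m]_x f (swap_coord i j x) = \int[m]_x f x)%E.
Proof.
move=> mf; rewrite (@integral_affine (tperm i j) (fun=> 1) (fun=> 0) (swap_coord i j))//.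
  by rewrite big1 ?mul1e// => k _; rewrite normr1 invr1.
by move=> x; apply/rowP => k; rewrite !mxE mul1r addr0.
Qed.

Lemma lebesgue_eball_lty (r : R) : (m (eball (0 : V) r) < +oo)%E.
Proof.
apply: (@le_lt_trans _ _ (m (@cube R d (Num.truncn r).+1))); last exact: lebesgue_cube_lty.
apply: le_measure; rewrite ?inE.
- exact: measurable_eball.
- by apply: measurable_box => i; exact: measurable_itv.
move=> x; rewrite /eball/= subr0 => xr i /=; rewrite in_itv/= -ler_norml.
rewrite (le_trans (coord_le_enorm _ _))// (le_trans xr)// ltW//.
by rewrite truncnS_gt.
Qed.

Lemma ball_volumeE : m (@unit_ball R d) = (@ball_volume R d)%:E.
Proof.
by rewrite /ball_volume fineK// ge0_fin_numE// lebesgue_eball_lty.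
Qed.

Lemma ball_volume_gt0 : 0 < @ball_volume R d.
Proof.
rewrite -lte_fin -ball_volumeE.
pose A : 'I_d -> set (measurableTypeR R) := fun=> `[0, (d%:R : R)^-1]%classic.
apply: (@lt_le_trans _ _ (m (box A))); last first.
  apply: le_measure; rewrite ?inE.
  - by apply: measurable_box => i; exact: measurable_itv.
  - exact: measurable_eball.
  move=> x xA; rewrite /unit_ball /eball/= subr0 (le_trans (enorm_le_sum _))//.
  apply: (@le_trans _ _ (\sum_(i < d) d%:R^-1)).
    apply: ler_sum => i _; have := xA i; rewrite /A/= in_itv/= => /andP[x0 x1].
    by rewrite ger0_norm.
  rewrite sumr_const card_ord -[X in X <= _]mulr_natl.
  by have [->|d0] := eqVneq d 0%N; [rewrite mul0r|rewrite divff// pnatr_eq0].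
rewrite lebesgue_box; last by move=> i; exact: measurable_itv.
rewrite (eq_bigr (fun=> (d%:R^-1)%:E)) => [|i _]; last first.
  have d0 : (0 < d)%N by case: i => -[|k] /=; case: (d).
  by rewrite /A lebesgue_measure_itv/= lte_fin invr_gt0 ltr0n d0 -EFinB subr0.
rewrite prodEFin lte_fin; apply: prodr_gt0 => i _.
by rewrite invr_gt0 ltr0n; case: i => -[|k] /=; case: (d).
Qed.

End lebesgue_symmetries.

Section ball_integrals.
Context {R : realType} {d : nat}.
Local Notation V := 'rV[R]_d.
Local Notation m := (@lebesgue_rV R d).
Local Notation vol := (@ball_volume R d).

Definition ball_indic (r : R) (u : V) : R := \1_(eball 0 r) u.

Lemma ball_indicE r (u : V) : ball_indic r u = (enorm u <= r)%R%:R.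
Proof.
rewrite /ball_indic indicE; congr (_%:R : R); congr nat_of_bool.
by apply/idP/idP => [/set_mem|h]; [|apply/mem_set]; rewrite /eball/= subr0.
Qed.

Lemma measurable_ball_indic r : measurable_fun setT (ball_indic r).
Proof. by apply: measurable_indic; exact: measurable_eball. Qed.

Lemma ball_indic_dilation (a r : R) (u : V) : 0 < a ->
  ball_indic (a * r) (a *: u) = ball_indic r u.
Proof. by move=> a0; rewrite !ball_indicE enormZ gtr0_norm// ler_pM2l. Qed.

Lemma integral_ball_indic r : (\int[m]_u (ball_indic r u)%:E = m (eball 0 r))%E.
Proof. by rewrite integral_indic ?setIT//; exact: measurable_eball. Qed.

Lemma lebesgue_eball r : 0 < r -> m (eball (0 : V) r) = (r ^+ d * vol)%:E.
Proof.
move=> r0; rewrite EFinM -ball_volumeE /unit_ball -!integral_ball_indic.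
have mB : measurable_fun setT (EFin \o ball_indic r).
  by apply/measurable_EFinP; exact: measurable_ball_indic.
have := @integral_dilation R d r (EFin \o ball_indic r) (lt0r_neq0 r0) mB.
rewrite /= gtr0_norm//.
under eq_integral do rewrite -[r in ball_indic r _]mulr1 ball_indic_dilation//.
by move=> ->; rewrite muleA -EFinM divff ?mul1e// expf_neq0// gt_eqF.
Qed.

(** Every integrand over [R^d] below is of this form, which is stable under
    multiplication by Lipschitz functions, unlike integrability. *)
Definition bounded_support (h : V -> R) :=
  measurable_fun setT h /\ exists M r, forall u, `|h u| <= M * ball_indic r u.

Lemma bounded_supportP (h : V -> R) (M r : R) : measurable_fun setT h ->
  (forall u, enorm u <= r -> `|h u| <= M) -> (forall u, r < enorm u -> h u = 0) ->
  bounded_support h.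
Proof.
move=> mh hM h0; split=> //; exists M, r => u; rewrite ball_indicE.
have [ur|ur] := leP (enorm u) r; first by rewrite mulr1 hM.
by rewrite (h0 u ur) normr0 mulr0.
Qed.

Lemma bounded_support_integrable (h : V -> R) : bounded_support h ->
  m.-integrable setT (EFin \o h).
Proof.
move=> [mh [M [r hM]]].
have iB : m.-integrable setT (EFin \o (fun u => M * ball_indic r u)).
  have : m.-integrable setT (EFin \o ball_indic r).
    apply/integrableP; split; first by apply/measurable_EFinP; exact: measurable_ball_indic.
    rewrite (eq_integral (fun u => (ball_indic r u)%:E)) => [|u _].
      by rewrite integral_ball_indic lebesgue_eball_lty.
    by rewrite /= ger0_norm// ball_indicE.
  by move=> /(integrableZl measurableT M); apply: eq_integrable.
apply: le_integrable iB => //; first exact/measurable_EFinP.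
by move=> u _ /=; rewrite lee_fin (le_trans (hM u))// ler_norm.
Qed.

Lemma bounded_supportD (h1 h2 : V -> R) : bounded_support h1 -> bounded_support h2 ->
  bounded_support (fun u => h1 u + h2 u).
Proof.
move=> [mh1 [M1 [r1 hM1]]] [mh2 [M2 [r2 hM2]]].
split; first exact: measurable_funD.
exists (`|M1| + `|M2|), (Num.max r1 r2) => u; rewrite (le_trans (ler_normD _ _))//.
rewrite mulrDl lerD//.
  rewrite (le_trans (hM1 u))// !ball_indicE le_max.
  by case: (leP (enorm u) r1) => _ /=; rewrite ?mulr0 ?mulr_ge0// !mulr1 ler_norm.
rewrite (le_trans (hM2 u))// !ball_indicE le_max orbC.
by case: (leP (enorm u) r2) => _ /=; rewrite ?mulr0 ?mulr_ge0// !mulr1 ler_norm.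
Qed.

Lemma bounded_supportM (f h : V -> R) : measurable_fun setT f ->
  (forall r, exists M : R, forall u, enorm u <= r -> `|f u| <= M) ->
  bounded_support h -> bounded_support (fun u => f u * h u).
Proof.
move=> mf fb [mh [M [r hM]]]; split; first exact: measurable_funM.
have [M' fM'] := fb r; exists (M' * M), r => u.
have := hM u; rewrite !ball_indicE normrM; have [ur|_] := leP (enorm u) r.
  by rewrite !mulr1 => hu; apply: ler_pM => //; exact: fM'.
by rewrite !mulr0 normr_le0 => /eqP ->; rewrite normr0 mulr0.
Qed.

Lemma bounded_supportZ a (h : V -> R) : bounded_support h -> bounded_support (fun u => a * h u).
Proof.
by apply: (@bounded_supportM (fun=> a)) => // r; exists `|a|.
Qed.

Lemma bounded_supportB (h1 h2 : V -> R) : bounded_support h1 -> bounded_support h2 ->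
  bounded_support (fun u => h1 u - h2 u).
Proof.
move=> b1 /(@bounded_supportZ (-1)) b2; under eq_fun do rewrite -mulN1r.
exact: bounded_supportD.
Qed.

Lemma bounded_support_ball_indic r : bounded_support (ball_indic r).
Proof.
split; first exact: measurable_ball_indic.
by exists 1, r => u; rewrite mul1r ger0_norm// ball_indicE.
Qed.

Lemma elipschitz_locally_bounded k (g : V -> R) : elipschitz k g ->
  forall r, exists M : R, forall u, enorm u <= r -> `|g u| <= M.
Proof.
move=> gk r; exists (`|g 0| + `|k| * r) => u ur.
rewrite -[g u](subrK (g 0)) addrC (le_trans (ler_normD _ _))// lerD2l.
rewrite (le_trans (gk _ _))// subr0 (@le_trans _ _ (`|k| * enorm u))//.
  by rewrite ler_wpM2r ?enorm_ge0// ler_norm.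
by rewrite ler_wpM2l.
Qed.

Lemma Rintegral_ball_indic r : 0 < r -> \int[m]_u ball_indic r u = r ^+ d * vol.
Proof. by move=> r0; rewrite /Rintegral integral_ball_indic lebesgue_eball. Qed.

Lemma Rintegral_ball (f : V -> R) r :
  \int[m]_(u in eball 0 r) f u = \int[m]_u (f u * ball_indic r u).
Proof.
rewrite Rintegral_mkcond; apply: eq_Rintegral => u _.
by rewrite patchE /ball_indic indicE; case: ifP; rewrite ?mulr1 ?mulr0.
Qed.

Lemma Rintegral_translation (b : V) (f : V -> R) : measurable_fun setT f ->
  \int[m]_u f (u + b) = \int[m]_u f u.
Proof.
move=> mf; rewrite /Rintegral -(@integral_translation _ _ b (EFin \o f))//.
exact/measurable_EFinP.
Qed.

Lemma Rintegral_reflection (f : V -> R) : measurable_fun setT f ->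
  \int[m]_u f (- u) = \int[m]_u f u.
Proof.
move=> mf; rewrite /Rintegral -(@integral_reflection _ _ (EFin \o f))//.
exact/measurable_EFinP.
Qed.

Lemma Rintegral_ball_homogeneous (f : V -> R) r : 0 < r -> measurable_fun setT f ->
  (forall u, f (r *: u) = f u) ->
  \int[m]_u (f u * ball_indic r u) = r ^+ d * \int[m]_u (f u * ball_indic 1 u).
Proof.
move=> r0 mf fr.
have mB : measurable_fun setT (fun u => (f u * ball_indic r u)%:E).
  by apply/measurable_EFinP; apply: measurable_funM => //; exact: measurable_ball_indic.
have := @integral_dilation R d r _ (lt0r_neq0 r0) mB.
under eq_integral do rewrite fr -[r in ball_indic r _]mulr1 ball_indic_dilation//.
rewrite /Rintegral => ->; rewrite gtr0_norm//.
have rd : 0 < r ^+ d by rewrite exprn_gt0.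
case: (\int[m]_x _)%E => [a| |] /=.
- by rewrite mulrA divff ?mul1r// gt_eqF.
- by rewrite gt0_muley ?lte_fin ?invr_gt0//= mulr0.
- by rewrite gt0_muleNy ?lte_fin ?invr_gt0//= mulr0.
Qed.

Lemma bernoulli_le (s : R) n : 0 <= s <= 1 -> 1 - (1 - s) ^+ n <= n%:R * s.
Proof.
move=> /andP[s0 s1]; elim: n => [|n ih]; first by rewrite expr0 subrr mul0r.
have p0 : 0 <= (1 - s) ^+ n by rewrite exprn_ge0// subr_ge0.
have p1 : (1 - s) ^+ n <= 1 by rewrite exprn_ile1 ?subr_ge0// lerBlDr lerDl.
rewrite exprS -natr1 mulrDl mul1r.
have : s * (1 - s) ^+ n <= s by exact: ler_piMr.
lra.
Qed.

Lemma lebesgue_sphere0 r : (0 < d)%N -> 0 < r ->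
  m [set u : V | enorm u = r] = 0%E.
Proof.
move=> d0 r0.
have mS : measurable [set u : V | enorm u = r].
  rewrite (_ : [set u | _] = @enorm R d @^-1` [set r])//.
  by rewrite -[X in measurable X]setTI; apply: measurable_enorm.
have Soo : (m [set u : V | enorm u = r] < +oo)%E.
  apply: le_lt_trans (lebesgue_eball_lty r); apply: le_measure; rewrite ?inE//.
    exact: measurable_eball.
  by move=> u /= ur; rewrite /eball/= subr0 ur.
have Sfin : m [set u : V | enorm u = r] \is a fin_num by rewrite ge0_fin_numE.
apply/eqP; rewrite -(fineK Sfin) eqe eq_le fine_ge0// andbT.
apply: (@le_linear_perturbation _ _ _ (r ^+ d * vol * d%:R)) => s /andP[s0 s1].
rewrite add0r -lee_fin fineK//.
have rs0 : 0 < r * (1 - s) by rewrite mulr_gt0// subr_gt0.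
apply: (@le_trans _ _ (m (eball (0 : V) r `\` eball 0 (r * (1 - s))))).
  apply: le_measure; rewrite ?inE//.
    by apply: measurableD; exact: measurable_eball.
  move=> u /= ur; split; rewrite /eball/= subr0 ur//; apply/negP.
  by rewrite -ltNge gtr_pMr// ltrBlDr ltrDl.
rewrite measureD//; [|exact: measurable_eball|exact: measurable_eball|exact: lebesgue_eball_lty].
rewrite setIidr; last first.
  move=> u; rewrite /eball/= subr0 => /le_trans; apply.
  by rewrite ger_pMr// lerBlDr lerDl ltW.
rewrite /= (lebesgue_eball r0) (lebesgue_eball rs0) -EFinB lee_fin exprMn.
have := @bernoulli_le s d; rewrite ltW// ltW// => /(_ isT) h.
have rV : 0 <= r ^+ d * vol by rewrite mulr_ge0 ?exprn_ge0// ?ltW// ball_volume_gt0.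
have := ler_wpM2l rV h; lra.
Qed.

Definition dir (u : V) : V := (enorm u)^-1 *: u.

Lemma dir_dilation r u : 0 < r -> dir (r *: u) = dir u.
Proof.
move=> r0; rewrite /dir enormZ gtr0_norm// scalerA invfM -mulrA mulrCA.
by rewrite mulVf ?mulr1// gt_eqF.
Qed.

Lemma dirN u : dir (- u) = - dir u.
Proof. by rewrite /dir enormN scalerN. Qed.

Lemma enorm_dir_le u : enorm (dir u) <= 1.
Proof.
have [->|u0] := eqVneq u 0; first by rewrite /dir scaler0 enorm0 ler01.
by rewrite enorm_unit.
Qed.

Lemma measurable_dir : measurable_fun setT dir.
Proof.
apply: measurable_rV_scale => //.
have -> : (fun u : V => (enorm u)^-1) = (fun u => enorm u `^ (-1)).
  by apply/funext => u; rewrite powR_inv1 ?enorm_ge0.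
exact: (measurableT_comp (measurable_powR (-1)) measurable_enorm).
Qed.

End ball_integrals.

(** * The divergence theorem on the unit ball *)
Section divergence.
Context {R : realType} {d : nat}.
Local Notation V := 'rV[R]_d.
Local Notation m := (@lebesgue_rV R d).
Local Notation vol := (@ball_volume R d).
Variables (g : V -> R) (K : R) (v : V).
Hypotheses (d_gt0 : (0 < d)%N) (gK : elipschitz K g).

Let K_ge0 : 0 <= K. Proof. exact: elipschitz_ge0 gK. Qed.

Definition clamp (a : R) := Num.max 0 (Num.min 1 a).

Lemma clamp_lipschitz a b : `|clamp a - clamp b| <= `|a - b|.
Proof.
have h1 := ler_norm (a - b); have h2 := ler_norm (b - a); rewrite distrC in h2.
have h3 := normr_ge0 (a - b).
rewrite ler_norml /clamp !maxEle !minEle.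
by do 4 case: ifPn; rewrite -?ltNge => *; apply/andP; split; lra.
Qed.

(** A Lipschitz substitute for the indicator of the unit ball, which falls from 1
    to 0 on the shell [1 - e <= |u| <= 1]. *)
Definition ramp e (u : V) : R := clamp ((1 - enorm u) / e).

Lemma ramp_ge0 e u : 0 <= ramp e u.
Proof. by rewrite /ramp /clamp le_max lexx. Qed.

Lemma ramp_le1 e u : ramp e u <= 1.
Proof. by rewrite /ramp /clamp ge_max ler01 ge_min lexx. Qed.

Lemma ramp_eq1 e u : 0 < e -> enorm u <= 1 - e -> ramp e u = 1.
Proof.
move=> e0 ue; rewrite /ramp /clamp min_l ?max_r// ler_pdivlMr//; lra.
Qed.

Lemma ramp_eq0 e u : 0 < e -> 1 <= enorm u -> ramp e u = 0.
Proof.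
move=> e0 ue; rewrite /ramp /clamp max_l// ge_min; apply/orP; right.
by rewrite pmulr_lle0 ?invr_gt0// subr_le0.
Qed.

Lemma ramp_mid e u : 0 < e -> 1 - e <= enorm u <= 1 ->
  ramp e u = (1 - enorm u) / e.
Proof.
move=> e0 /andP[u1 u2]; rewrite /ramp /clamp min_r ?max_r//.
  by rewrite divr_ge0 ?subr_ge0// ltW.
by rewrite ler_pdivrMr//; lra.
Qed.

Lemma ramp_lipschitz e : 0 < e -> elipschitz e^-1 (ramp e).
Proof.
move=> e0 u w; rewrite (le_trans (clamp_lipschitz _ _))//.
rewrite -mulrBl normrM [`|e^-1|]gtr0_norm ?invr_gt0// mulrC ler_pM2l ?invr_gt0//.
rewrite (_ : 1 - enorm u - (1 - enorm w) = enorm w - enorm u); last by ring.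
by rewrite enormB enorm_dist.
Qed.

Definition shell e (u : V) := ball_indic 1 u - ball_indic (1 - e) u.

Lemma shellE e u : 0 < e -> shell e u = (1 - e < enorm u <= 1)%R%:R.
Proof.
move=> e0; rewrite /shell !ball_indicE ltNge.
have [u1|u1] := leP (enorm u) (1 - e) => /=; last by rewrite subr0.
by rewrite (_ : enorm u <= 1) ?subrr//; lra.
Qed.

(** The derivative of [- ramp e] in direction [v]. *)
Definition shell_flux e (u : V) := e^-1 * dotv (dir u) v * shell e u.

Lemma bounded_support_shell e : bounded_support (shell e).
Proof. by apply: bounded_supportB; exact: bounded_support_ball_indic. Qed.

Lemma measurable_dir_dotv : measurable_fun setT (fun u : V => dotv (dir u) v).
Proof. by apply: measurable_dotv => //; exact: measurable_dir. Qed.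

Lemma dir_dotv_le u : `|dotv (dir u) v| <= enorm v.
Proof.
by rewrite (le_trans (normr_dotv_le _ _))// ler_piMl ?enorm_ge0// enorm_dir_le.
Qed.

Lemma bounded_support_shell_flux e : bounded_support (shell_flux e).
Proof.
apply: bounded_supportM; last exact: bounded_support_shell.
  by apply: measurable_funM => //; exact: measurable_dir_dotv.
move=> r; exists (`|e^-1| * enorm v) => u _.
by rewrite normrM ler_wpM2l// dir_dotv_le.
Qed.

Definition ramp_quotient e t (u : V) := (ramp e (u - t *: v) - ramp e u) / t.

Lemma enorm_derivative u t : u != 0 -> 0 < t ->
  `|(enorm u - enorm (u - t *: v)) / t - dotv (dir u) v| <=
  t * (enorm v ^+ 2 / enorm u).
Proof.
move=> u0 t0; have nu : 0 < enorm u by rewrite enorm_gt0.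
set a := enorm u; set b := enorm (u - t *: v).
have ab : `|a - b| <= t * enorm v.
  by rewrite (le_trans (enorm_dist _ _))// opprB addrC subrK enormZ gtr0_norm.
have sq : (a - b) * (a + b) = t * (2 * dotv u v - t * enorm v ^+ 2).
  rewrite -subr_sqr /a /b !enorm_sq dotvBl !dotvBr !dotvZl !dotvZr (dotvC v u); ring.
set A := (a - b) / t.
have At : a - b = A * t by rewrite divfK// gt_eqF.
have eq1 : A * (a + b) = 2 * dotv u v - t * enorm v ^+ 2.
  by apply: (@mulfI _ t); [rewrite gt_eqF|rewrite -sq At; ring].
have -> : A - dotv (dir u) v = (A * (A * t) - t * enorm v ^+ 2) / (2 * a).
  rewrite /dir dotvZl -/a.
  have -> : dotv u v = (A * (a + b) + t * enorm v ^+ 2) / 2 by rewrite eq1; lra.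
  have -> : b = a - A * t by rewrite -At; ring.
  by field; rewrite gt_eqF.
have AA : `|A| <= enorm v by rewrite /A normrM normfV (gtr0_norm t0) ler_pdivrMr// mulrC.
rewrite normrM (gtr0_norm (_ : 0 < (2 * a)^-1)) ?invr_gt0 ?mulr_gt0//.
rewrite ler_pdivrMr ?mulr_gt0//.
have -> : t * (enorm v ^+ 2 / a) * (2 * a) = t * enorm v ^+ 2 + t * enorm v ^+ 2.
  by field; rewrite gt_eqF.
rewrite (le_trans (ler_normB _ _))// lerD//.
  rewrite mulrA -expr2 normrM (gtr0_norm t0) mulrC ler_pM2l// normrX.
  by rewrite lerXn2r ?nnegrE ?enorm_ge0.
by rewrite ger0_norm// mulr_ge0 ?sqr_ge0// ltW.
Qed.

Lemma near_natSinv_lt (eta : R) : 0 < eta -> \forall n \near \oo, n.+1%:R^-1 < eta.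
Proof. by move=> eta0; exact: (near_infty_natSinv_lt (PosNum eta0)). Qed.

Lemma ramp_quotient_near e u : 0 < e < 1 -> enorm u != 1 -> enorm u != 1 - e ->
  exists2 eta, 0 < eta & exists C, forall t, 0 < t < eta ->
    `|ramp_quotient e t u - shell_flux e u| <= t * C.
Proof.
move=> /andP[e0 e1] u1 u1e.
have v1 : 0 < enorm v + 1 by rewrite ltr_wpDl// enorm_ge0.
have small a t : 0 < t < a / (enorm v + 1) -> `|enorm u - enorm (u - t *: v)| < a.
  move=> /andP[t0]; rewrite ltr_pdivlMr// => ta; apply: le_lt_trans ta.
  rewrite (le_trans (enorm_dist _ _))// opprB addrC subrK enormZ gtr0_norm//.
  by rewrite ler_pM2l// lerDl.
rewrite /ramp_quotient /shell_flux shellE//.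
have [ult|ugt] := ltP (enorm u) (1 - e).
  exists ((1 - e - enorm u) / (enorm v + 1)); first by rewrite divr_gt0// subr_gt0.
  exists 0 => t /small; rewrite ltr_norml => /andP[h1 h2].
  rewrite !ramp_eq1//; [|lra|lra].
  by rewrite subrr mul0r sub0r mulr0 (_ : (_ < _) = false) ?mulr0 ?oppr0 ?normr0//; apply/negbTE; rewrite -leNgt ltW.
have {}ugt : 1 - e < enorm u by rewrite lt_neqAle eq_sym u1e.
have [u2|u2] := ltP 1 (enorm u).
  exists ((enorm u - 1) / (enorm v + 1)); first by rewrite divr_gt0// subr_gt0.
  exists 0 => t /small; rewrite ltr_norml => /andP[h1 h2].
  rewrite !ramp_eq0//; [|lra|lra].
  by rewrite subrr mul0r sub0r mulr0 andbF mulr0 oppr0 normr0.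
have {}u2 : enorm u < 1 by rewrite lt_neqAle u1.
pose eta := Num.min (1 - enorm u) (enorm u - (1 - e)).
have eta0 : 0 < eta by rewrite lt_min !subr_gt0 u2.
exists (eta / (enorm v + 1)); first by rewrite divr_gt0.
exists (e^-1 * (enorm v ^+ 2 / enorm u)) => t te.
have := small _ _ te; rewrite lt_min ltr_norml ltr_norml => /andP[/andP[h1 h2] /andP[h3 h4]].
have t0 : 0 < t by case/andP: te.
rewrite !ramp_mid//; [|apply/andP; split; lra|apply/andP; split; lra].
rewrite ugt mulr1.
have -> : ((1 - enorm (u - t *: v)) / e - (1 - enorm u) / e) / t - e^-1 * dotv (dir u) v
   = e^-1 * ((enorm u - enorm (u - t *: v)) / t - dotv (dir u) v).
  by field; rewrite !gt_eqF.
rewrite normrM (gtr0_norm (_ : 0 < e^-1)) ?invr_gt0// [leRHS]mulrCA ler_pM2l ?invr_gt0//.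
apply: enorm_derivative => //; rewrite -enorm_gt0; lra.
Qed.

Lemma ramp_quotient_bound e t u : 0 < e -> 0 < t <= 1 ->
  `|ramp_quotient e t u| <= enorm v / e * ball_indic (1 + enorm v) u.
Proof.
move=> e0 /andP[t0 t1]; rewrite ball_indicE /ramp_quotient.
have [uv|uv] := leP (enorm u) (1 + enorm v).
  rewrite mulr1 normrM normfV (gtr0_norm t0) ler_pdivrMr//.
  rewrite (le_trans (ramp_lipschitz e0 _ _))// addrC addKr enormN enormZ gtr0_norm//.
  by rewrite le_eqVlt; apply/orP; left; apply/eqP; ring.
have nv := enorm_ge0 v.
rewrite !ramp_eq0 ?subrr ?mul0r ?mulr0 ?normr0//; first lra.
have : enorm u <= enorm (u - t *: v) + enorm (t *: v).
  by rewrite (le_trans _ (enormD _ _))// subrK.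
rewrite enormZ gtr0_norm//.
have : t * enorm v <= enorm v by rewrite ler_piMl.
lra.
Qed.

Lemma measurable_ramp e : 0 < e -> measurable_fun setT (ramp e).
Proof. by move=> /ramp_lipschitz/measurable_elipschitz. Qed.

Let measurable_g : measurable_fun setT g.
Proof. exact: measurable_elipschitz gK. Qed.

Lemma elipschitz_shift t : elipschitz K (fun u => g (u + t *: v)).
Proof.
move=> x y; rewrite (le_trans (gK _ _))//.
by rewrite (_ : x + _ - _ = x - y) //; rewrite opprD addrACA subrr addr0.
Qed.

Lemma measurable_shift (h : V -> R) (b : V) : measurable_fun setT h ->
  measurable_fun setT (fun u : V => h (u + b)).
Proof.
move=> mh; apply: (measurableT_comp mh).
by apply: measurable_rV_add => //; exact: measurable_cst.
Qed.

Lemma measurable_ramp_quotient e t : 0 < e ->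
  measurable_fun setT (ramp_quotient e t).
Proof.
move=> e0; apply: measurable_funM => //; apply: measurable_funB.
  by apply: (measurable_shift (h := ramp e)); exact: measurable_ramp.
exact: measurable_ramp.
Qed.

(** Dominated convergence; the quotients converge off the two spheres that bound
    the shell, which are null sets. *)
Lemma cvg_ramp_quotient e : 0 < e < 1 ->
  \int[m]_u (g u * ramp_quotient e n.+1%:R^-1 u) @[n --> \oo] -->
  \int[m]_u (g u * shell_flux e u).
Proof.
move=> e01; have /andP[e0 e1] := e01.
have bs : bounded_support (fun u => g u * shell_flux e u).
  apply: bounded_supportM; [exact: measurable_g| exact: elipschitz_locally_bounded gK|].
  exact: bounded_support_shell_flux.
have [M gM] := elipschitz_locally_bounded gK (1 + enorm v).
have b2 : bounded_support (fun u : V => (`|M| * (enorm v / e)) * ball_indic (1 + enorm v) u).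
  exact: (bounded_supportZ _ (bounded_support_ball_indic _)).
have n1 n : 0 < (n.+1%:R : R)^-1 <= 1.
  by rewrite invr_gt0 ltr0n/= invf_le1 ?ltr0n// ler1n.
have [|||||_ _ H] := @dominated_convergence _ _ _ m setT measurableT
  (fun n u => (g u * ramp_quotient e n.+1%:R^-1 u)%:E)
  (fun u => (g u * shell_flux e u)%:E)
  (fun u => ((`|M| * (enorm v / e)) * ball_indic (1 + enorm v) u)%:E).
- move=> n; apply/measurable_EFinP; apply: measurable_funM; first exact: measurable_g.
  exact: measurable_ramp_quotient.
- by apply/measurable_EFinP; case: bs.
- exists ([set u | enorm u = 1] `|` [set u | enorm u = 1 - e]).
  have mS r : measurable [set u : V | enorm u = r].
    rewrite (_ : [set u | _] = @enorm R d @^-1` [set r])//.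
    by rewrite -[X in measurable X]setTI; apply: measurable_enorm.
  split.
  + by apply: measurableU; exact: mS.
  + apply/eqP; rewrite eq_le measure_ge0 andbT.
    rewrite (le_trans (measureU2 _ (mS _) (mS _)))//=.
    by rewrite !lebesgue_sphere0 ?adde0// subr_gt0.
  + move=> u /= nu; apply: contrapT => /not_orP[u1 u1e]; apply: nu => _.
    apply/fine_cvgP; split; first by near=> n.
    apply: (@cvgMl_tmp).
    have [||eta eta0 [C etaC]] := @ramp_quotient_near e u e01; [exact/eqP|exact/eqP|].
    apply/cvgrPdist_lt => ep ep0.
    have C1 : 0 < `|C| + 1 by rewrite ltr_wpDl.
    near=> n.
    have n0 : 0 < n.+1%:R^-1 :> R by rewrite invr_gt0 ltr0n.
    rewrite distrC; apply: le_lt_trans (etaC _ _) _.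
      by rewrite n0/=; near: n; exact: near_natSinv_lt.
    apply: (@le_lt_trans _ _ (n.+1%:R^-1 * (`|C| + 1))).
      by rewrite ler_pM2l// (le_trans (ler_norm _))// lerDl.
    rewrite -ltr_pdivlMr//; near: n; apply: near_natSinv_lt.
    by rewrite divr_gt0.
- exact: bounded_support_integrable b2.
- apply: aeW => u n _; rewrite /= lee_fin normrM.
  have [uv|uv] := leP (enorm u) (1 + enorm v); last first.
    have := @ramp_quotient_bound e n.+1%:R^-1 u e0 (n1 n).
    by rewrite ball_indicE (lt_geF uv)/= !mulr0 normr_le0 => /eqP ->; rewrite normr0 mulr0.
  rewrite -mulrA; apply: ler_pM => //.
    by rewrite (le_trans (gM _ uv))// ler_norm.
  exact: ramp_quotient_bound.
apply: (@fine_cvg _ _ _ _ (fun n => \int[m]_u (g u * ramp_quotient e n.+1%:R^-1 u)%:E)%E).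
rewrite fineK; first exact: H.
exact: integrable_fin_num (bounded_support_integrable bs).
Unshelve. all: end_near. Qed.

Let G t := \int[m]_u (g (u + t *: v) * ball_indic 1 u).

Let bounded_support_lip h k : elipschitz k (h : V -> R) -> forall w, bounded_support w ->
  bounded_support (fun u => h u * w u).
Proof.
move=> hk w bw; apply: bounded_supportM => //.
  exact: measurable_elipschitz hk.
exact: elipschitz_locally_bounded hk.
Qed.

Lemma Rintegral_bounded_supportB (h1 h2 : V -> R) : bounded_support h1 -> bounded_support h2 ->
  \int[m]_u (h1 u - h2 u) = \int[m]_u h1 u - \int[m]_u h2 u.
Proof.
by move=> b1 b2; rewrite RintegralB//; exact: bounded_support_integrable.
Qed.

Lemma bounded_support_ramp e : 0 < e -> bounded_support (ramp e).
Proof.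
move=> e0; apply: (@bounded_supportP _ _ _ 1 1); first exact: measurable_ramp.
  by move=> u _; rewrite ger0_norm ?ramp_ge0 ?ramp_le1.
by move=> u u1; rewrite ramp_eq0// ltW.
Qed.

(** Translation invariance moves the difference quotient from [g] to [ramp e],
    whose derivative is explicit. *)
Lemma ramp_translation_integral e t : 0 < e ->
  \int[m]_u (g (u + t *: v) * ramp e u) = \int[m]_u (g u * ramp e (u - t *: v)).
Proof.
move=> e0; rewrite -[RHS](@Rintegral_translation _ _ (t *: v)).
  by apply: eq_Rintegral => u _; rewrite addrK.
by apply: measurable_funM; [exact: measurable_g|apply: (measurable_shift (h := ramp e)); exact: measurable_ramp].
Qed.

Lemma bounded_support_ramp_shift e t : 0 < e ->
  bounded_support (fun u => ramp e (u - t *: v)).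
Proof.
move=> e0; apply: (@bounded_supportP _ _ _ 1 (1 + enorm (t *: v))).
- by apply: (measurable_shift (h := ramp e)); exact: measurable_ramp.
- by move=> u _; rewrite ger0_norm ?ramp_ge0 ?ramp_le1.
- move=> u u1; rewrite ramp_eq0//.
  have : enorm u <= enorm (u - t *: v) + enorm (t *: v).
    by rewrite (le_trans _ (enormD _ _))// subrK.
  lra.
Qed.

Lemma Rintegral_shell e : 0 < e < 1 ->
  \int[m]_u shell e u = vol * (1 - (1 - e) ^+ d).
Proof.
move=> /andP[e0 e1]; rewrite RintegralB//.
- by rewrite !Rintegral_ball_indic ?subr_gt0// expr1n mul1r; ring.
- exact: bounded_support_integrable (bounded_support_ball_indic 1).
- exact: bounded_support_integrable (bounded_support_ball_indic (1 - e)).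
Qed.

(** The shift by [t v] changes [g] by at most [K t |v|], and the ramp differs
    from the indicator of the ball only on the shell. *)
Lemma quotient_ramp_error e t : 0 < e < 1 -> 0 < t ->
  `|(G t - G 0) / t - \int[m]_u (g u * ramp_quotient e t u)| <=
  K * enorm v * (vol * (1 - (1 - e) ^+ d)).
Proof.
move=> e01 t0; have /andP[e0 e1] := e01.
have bB := @bounded_support_ball_indic R d 1.
have bR := bounded_support_ramp e0.
have gt := elipschitz_shift t.
have b1 := bounded_support_lip gt bB; have b2 := bounded_support_lip gK bB.
have b3 := bounded_support_lip gt bR; have b4 := bounded_support_lip gK bR.
have b5 := bounded_support_lip gK (bounded_support_ramp_shift t e0).
have G0E : G 0 = \int[m]_u (g u * ball_indic 1 u).
  by apply: eq_Rintegral => u _; rewrite scale0r addr0.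
have qE : t * \int[m]_u (g u * ramp_quotient e t u) =
    \int[m]_u (g (u + t *: v) * ramp e u) - \int[m]_u (g u * ramp e u).
  rewrite ramp_translation_integral// -Rintegral_bounded_supportB// -RintegralZl//; last first.
    have -> : EFin \o (fun u => g u * ramp_quotient e t u) =
        EFin \o (fun u => t^-1 * (g u * ramp e (u - t *: v) - g u * ramp e u)).
      by apply/funext => u /=; congr EFin; rewrite /ramp_quotient; field; rewrite gt_eqF.
    by apply: bounded_support_integrable; apply/bounded_supportZ/bounded_supportB.
  by apply: eq_Rintegral => u _; rewrite /ramp_quotient; field; rewrite gt_eqF.
have -> : (G t - G 0) / t - \int[m]_u (g u * ramp_quotient e t u) =
    t^-1 * \int[m]_u (g (u + t *: v) * ball_indic 1 u - g u * ball_indic 1 u -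
      (g (u + t *: v) * ramp e u - g u * ramp e u)).
  rewrite !Rintegral_bounded_supportB//; try exact: bounded_supportB.
  rewrite -qE -G0E /G; field; rewrite gt_eqF//.
rewrite normrM (gtr0_norm (_ : 0 < t^-1)) ?invr_gt0// mulrC ler_pdivrMr//.
rewrite -(Rintegral_shell e01).
rewrite (le_trans (le_normr_Rintegral _ _))//.
  by apply: bounded_support_integrable; apply: bounded_supportB; exact: bounded_supportB.
rewrite mulrAC -RintegralZl//; last first.
  by apply: bounded_support_integrable; exact: bounded_support_shell.
apply: le_Rintegral => //.
- apply: integrable_norm; apply: bounded_support_integrable.
  by apply: bounded_supportB; exact: bounded_supportB.
- by apply: bounded_support_integrable; apply: bounded_supportZ; exact: bounded_support_shell.
move=> u _.
have -> : g (u + t *: v) * ball_indic 1 u - g u * ball_indic 1 u -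
      (g (u + t *: v) * ramp e u - g u * ramp e u) =
  (g (u + t *: v) - g u) * (ball_indic 1 u - ramp e u) by ring.
have h1 : 0 <= ball_indic 1 u - ramp e u <= shell e u.
  rewrite /shell !ball_indicE; have [u1|u1] := leP (enorm u) 1; last first.
    by rewrite ramp_eq0 ?(ltW u1)// subrr lexx/= (lt_geF (_ : 1 - e < enorm u)) ?subrr//; lra.
  rewrite subr_ge0 ramp_le1/= lerD2l lerN2.
  by have [u2|u2] := leP (enorm u) (1 - e); [rewrite ramp_eq1|rewrite ramp_ge0].
case/andP: h1 => h1 h2; rewrite normrM (ger0_norm h1).
apply: ler_pM => //; rewrite (le_trans (gK _ _))//.
by rewrite addrC addKr enormZ gtr0_norm// mulrAC mulrA.
Qed.

(** On the shell, [u] and [dir u] are at distance at most [e]. *)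
Lemma shell_flux_error e : 0 < e < 1 ->
  `|\int[m]_u (g u * shell_flux e u) - \int[m]_u (g (dir u) * shell_flux e u)| <=
  K * enorm v * (vol * (1 - (1 - e) ^+ d)).
Proof.
move=> e01; have /andP[e0 e1] := e01.
have bS := bounded_support_shell_flux e.
have b1 := bounded_support_lip gK bS.
have b2 : bounded_support (fun u => g (dir u) * shell_flux e u).
  apply: bounded_supportM => //.
    exact: (measurableT_comp measurable_g measurable_dir).
  have [M gM] := elipschitz_locally_bounded gK 1.
  by move=> r; exists M => u _; apply: gM; exact: enorm_dir_le.
rewrite -Rintegral_bounded_supportB// -(Rintegral_shell e01).
rewrite (le_trans (le_normr_Rintegral _ _))//.
  by apply: bounded_support_integrable; exact: bounded_supportB.
rewrite -RintegralZl//; last first.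
  by apply: bounded_support_integrable; exact: bounded_support_shell.
apply: le_Rintegral => //.
- by apply: integrable_norm; apply: bounded_support_integrable; exact: bounded_supportB.
- by apply: bounded_support_integrable; apply: bounded_supportZ; exact: bounded_support_shell.
move=> u _; rewrite -mulrBl /shell_flux normrM [`|_ * shell e u|]normrM shellE//.
have [/andP[u1 u2]|_] := boolP (1 - e < enorm u <= 1); last first.
  by rewrite normr0 !mulr0.
rewrite normr1 !mulr1 normrM (gtr0_norm (_ : 0 < e^-1)) ?invr_gt0//.
have h1 : `|g u - g (dir u)| <= K * e.
  rewrite (le_trans (gK _ _))// ler_wpM2l//.
  have u0 : u != 0 by rewrite -enorm_gt0; lra.
  have -> : u - dir u = (enorm u - 1) *: dir u.
    by rewrite /dir scalerA mulrBl mul1r divff ?enorm_eq0// scalerBl scale1r.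
  rewrite enormZ enorm_unit// mulr1 ler_norml; apply/andP; split; lra.
have h2 := dir_dotv_le u.
rewrite mulrA; apply: ler_pM => //; first by rewrite mulr_ge0// invr_ge0 ltW.
by rewrite ler_pdivrMr.
Qed.

Let J := \int[m]_u (g (dir u) * dotv (dir u) v * ball_indic 1 u).

(** The integrand is 0-homogeneous, so that the integral over the ball of radius
    [1 - e] is [(1 - e)^d] times the one over the unit ball. *)
Lemma shell_flux_homogeneous e : 0 < e < 1 ->
  \int[m]_u (g (dir u) * shell_flux e u) = (1 - (1 - e) ^+ d) / e * J.
Proof.
move=> /andP[e0 e1].
have mH : measurable_fun setT (fun u : V => g (dir u) * dotv (dir u) v).
  apply: measurable_funM; last exact: measurable_dir_dotv.
  exact: (measurableT_comp measurable_g measurable_dir).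
have bH r : bounded_support (fun u : V => g (dir u) * dotv (dir u) v * ball_indic r u).
  apply: bounded_supportM => //; last exact: bounded_support_ball_indic.
  have [M gM] := elipschitz_locally_bounded gK 1.
  move=> r'; exists (M * enorm v) => u _; rewrite normrM; apply: ler_pM => //.
    by apply: gM; exact: enorm_dir_le.
  exact: dir_dotv_le.
transitivity (\int[m]_u (e^-1 * (g (dir u) * dotv (dir u) v * ball_indic 1 u -
     g (dir u) * dotv (dir u) v * ball_indic (1 - e) u))).
  by apply: eq_Rintegral => u _; rewrite /shell_flux /shell; ring.
rewrite RintegralZl//; last first.
  by apply: bounded_support_integrable; exact: bounded_supportB.
rewrite Rintegral_bounded_supportB// (@Rintegral_ball_homogeneous _ _ _ (1 - e)) ?subr_gt0//.
  by rewrite -/J; field; rewrite gt_eqF.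
by move=> u; rewrite dir_dilation// subr_gt0.
Qed.

Lemma bernoulli_ge (s : R) n : 0 <= s <= 1 ->
  n%:R * s - n%:R ^+ 2 * s ^+ 2 <= 1 - (1 - s) ^+ n.
Proof.
move=> /andP[s0 s1]; elim: n => [|n ih].
  by rewrite expr0 expr0n/= !mul0r !subrr.
rewrite [(1 - s) ^+ _.+1]exprS -natr1.
have h : (1 - s) * (1 - s) ^+ n <= (1 - s) * (1 - n%:R * s + n%:R ^+ 2 * s ^+ 2).
  by apply: ler_wpM2l; lra.
have n0 : 0 <= n%:R :> R by [].
have h2 : 0 <= n%:R ^+ 2 * s ^+ 3 by rewrite mulr_ge0// ?exprn_ge0.
have h3 : 0 <= n%:R * s ^+ 2 by rewrite mulr_ge0// exprn_ge0.
have h4 : 0 <= s ^+ 2 by rewrite exprn_ge0.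
lra.
Qed.

(** The derivative of [t |-> \int_B g (u + t v) du] is the flux of [g] through
    the sphere, the surface integral being written as [d] times an integral of
    a 0-homogeneous function over the ball. The indicator of the ball is
    replaced by a ramp of width [e], whose difference quotients converge to the
    flux density of the shell of width [e]; on the shell [g] is close to its
    value on the sphere, and the integral over the shell is computed by
    homogeneity. *)
Lemma divergence_ball (D : R) :
  (G n.+1%:R^-1 - G 0) / n.+1%:R^-1 @[n --> \oo] --> D -> D = d%:R * J.
Proof.
move=> GD.
have err e : 0 < e < 1 -> `|D - (1 - (1 - e) ^+ d) / e * J| <=
    2 * (K * enorm v * (vol * (1 - (1 - e) ^+ d))).
  move=> e01.
  have h1 : `|D - \int[m]_u (g u * shell_flux e u)| <= K * enorm v * (vol * (1 - (1 - e) ^+ d)).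
    have H : `|(G n.+1%:R^-1 - G 0) / n.+1%:R^-1 -
        \int[m]_u (g u * ramp_quotient e n.+1%:R^-1 u)| @[n --> \oo] -->
        `|D - \int[m]_u (g u * shell_flux e u)|.
      by apply: cvg_norm; apply: cvgB; [exact: GD|exact: cvg_ramp_quotient].
    apply: (cvgr_to_le H); apply: nearW => n.
    by apply: quotient_ramp_error => //; rewrite invr_gt0 ltr0n.
  have := shell_flux_error e01; rewrite (shell_flux_homogeneous e01) => h2.
  have := ler_distD (\int[m]_u (g u * shell_flux e u)) D ((1 - (1 - e) ^+ d) / e * J).
  lra.
have V0 := ltW (@ball_volume_gt0 R d).
have KV : 0 <= K * enorm v * vol by rewrite !mulr_ge0// enorm_ge0.
suff : `|D - d%:R * J| <= 0 by rewrite normr_le0 subr_eq0 => /eqP.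
apply: (@le_linear_perturbation _ _ _
  (2 * (K * enorm v * vol * d%:R) + d%:R ^+ 2 * `|J|)) => e e01.
have /andP[e0 e1] := e01; have e01' : 0 <= e <= 1 by rewrite !ltW.
have hb := bernoulli_le d e01'; have hg := bernoulli_ge d e01'.
have h1 : K * enorm v * (vol * (1 - (1 - e) ^+ d)) <= K * enorm v * vol * (d%:R * e).
  by rewrite mulrA ler_wpM2l.
have h2 : `|(1 - (1 - e) ^+ d) / e * J - d%:R * J| <= d%:R ^+ 2 * e * `|J|.
  rewrite -mulrBl normrM ler_wpM2r//.
  rewrite (_ : _ - d%:R = ((1 - (1 - e) ^+ d) - d%:R * e) / e); last first.
    by field; rewrite gt_eqF.
  rewrite normrM (gtr0_norm (_ : 0 < e^-1)) ?invr_gt0// ler_pdivrMr//.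
  rewrite ler_norml; apply/andP; split; first by lra.
  have : 0 <= d%:R ^+ 2 * e * e by rewrite !mulr_ge0// ?exprn_ge0// ltW.
  lra.
have := err e e01; have := ler_distD ((1 - (1 - e) ^+ d) / e * J) D (d%:R * J).
lra.
Qed.

End divergence.

(** * Gradients and the descent inequality *)
Section gradients.
Context {R : realType} {d : nat}.
Local Notation V := 'rV[R]_d.
Implicit Types (x v : V).

Lemma gradient_derive (f : V -> R) x v : differentiable f x ->
  'D_v f x = dotv (gradient f x) v.
Proof.
move=> df; rewrite deriveE// [in LHS](row_sum_delta v) linear_sum /dotv.
apply: eq_bigr => i _; rewrite linearZ/= /gradient mxE deriveE//.
by rewrite mulrC.
Qed.

Lemma cvg_natSinv_dnbhs : (fun n => n.+1%:R^-1 : R) @ \oo --> (0 : R)^'.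
Proof.
move=> A [e /= e0 eA].
suff : \forall n \near \oo, A (n.+1%:R^-1) by [].
near=> n; apply: eA => /=; last by rewrite invr_eq0 pnatr_eq0.
rewrite sub0r normrN gtr0_norm ?invr_gt0 ?ltr0n//.
by near: n; exact: near_natSinv_lt.
Unshelve. all: end_near. Qed.

Lemma gradient_cvg (f : V -> R) x v : differentiable f x ->
  (f (x + n.+1%:R^-1 *: v) - f x) / n.+1%:R^-1 @[n --> \oo] --> dotv (gradient f x) v.
Proof.
move=> df; rewrite -gradient_derive//.
have H : (fun h : R => h^-1 *: ((f \o shift x) (h *: v) - f x)) @ 0^' --> 'D_v f x.
  exact: diff_derivable df.
have := cvg_comp _ _ cvg_natSinv_dnbhs H.
apply: cvg_trans; apply: near_eq_cvg; apply: nearW => n /=.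
by rewrite [RHS]mulrC [x + _]addrC.
Qed.

Lemma gradient_le (f : V -> R) (K : R) x : elipschitz K f -> 0 <= K ->
  differentiable f x -> enorm (gradient f x) <= K.
Proof.
move=> fK K0 df; set g := gradient f x.
have : dotv g g <= K * enorm g.
  apply: (cvgr_to_le (gradient_cvg (v := g) df)); apply: nearW => n.
  have n0 : 0 < n.+1%:R^-1 :> R by rewrite invr_gt0 ltr0n.
  rewrite ler_pdivrMr// (le_trans (ler_norm _))// (le_trans (fK _ _))//.
  by rewrite addrC addKr enormZ gtr0_norm// mulrCA mulrC.
rewrite -enorm_sq expr2.
have [->|g0] := eqVneq g 0; first by rewrite enorm0.
by rewrite ler_pM2r// enorm_gt0.
Qed.

Lemma derivable_line (f : V -> R) x v (t : R) : (forall y, differentiable f y) ->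
  is_derive t 1 (fun s : R => f (x + s *: v)) (dotv (gradient f (x + t *: v)) v).
Proof.
move=> df; have D := @diff_derivable _ _ _ _ _ v (df (x + t *: v)).
have E : (fun h : R => h^-1 *: (((fun s => f (x + s *: v)) \o shift t) (h *: 1) - f (x + t *: v))) =
    (fun h : R => h^-1 *: ((f \o shift (x + t *: v)) (h *: v) - f (x + t *: v))).
  apply/funext => h /=; congr (_ *: (f _ - _)).
  by rewrite [h *: 1]mulr1 scalerDl addrCA.
split; first by rewrite /derivable E.
by rewrite /derive E -gradient_derive.
Qed.

Lemma gradient_mvt (f : V -> R) x v : (forall y, differentiable f y) ->
  exists2 t, 0 < t < 1 & f (x + v) - f x = dotv (gradient f (x + t *: v)) v.
Proof.
move=> df.
have D (t : R) : is_derive t 1 (fun s : R => f (x + s *: v)) (dotv (gradient f (x + t *: v)) v).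
  exact: derivable_line.
have [|t] := @MVT R (fun s => f (x + s *: v)) (fun t => dotv (gradient f (x + t *: v)) v)
  0 1 ltr01 (fun t _ => D t).
  by apply: derivable_within_continuous => t _; have [] := D t.
by rewrite in_itv/= scale1r scale0r addr0 subr0 mulr1 => t01 E; exists t.
Qed.

Lemma descent (f : V -> R) (M : R) x v : (forall y, differentiable f y) ->
  (forall y z, enorm (gradient f y - gradient f z) <= M * enorm (y - z)) ->
  `|f (x + v) - f x - dotv (gradient f x) v| <= M * enorm v ^+ 2.
Proof.
move=> df fM; have [t /andP[t0 t1] ->] := gradient_mvt x v df.
rewrite -dotvBl (le_trans (normr_dotv_le _ _))// expr2 mulrA ler_wpM2r ?enorm_ge0//.
rewrite (le_trans (fM _ _))// addrC addKr enormZ gtr0_norm//.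
have M0 : 0 <= M * enorm v.
  by have := fM v 0; rewrite subr0; apply: le_trans; exact: enorm_ge0.
by rewrite mulrCA ler_piMl// ltW.
Qed.

Lemma gradient_coord_lipschitz (f : V -> R) (M : R) (i : 'I_d) :
  (forall y z, enorm (gradient f y - gradient f z) <= M * enorm (y - z)) ->
  elipschitz M (fun x => gradient f x ord0 i).
Proof.
move=> fM y z; apply: le_trans (fM y z).
by rewrite (_ : _ - _ = (gradient f y - gradient f z) ord0 i) ?coord_le_enorm// !mxE.
Qed.

End gradients.

(** * Smoothing over a ball *)
Section smoothing_facts.
Context {R : realType} {d : nat}.
Local Notation V := 'rV[R]_d.
Local Notation m := (@lebesgue_rV R d).
Local Notation vol := (@ball_volume R d).
Variables (h : V -> R) (K delta : R).
Hypotheses (d_gt0 : (0 < d)%N) (hK : elipschitz K h) (delta_gt0 : 0 < delta).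
Implicit Types (x v : V).

Let K_ge0 : 0 <= K. Proof. exact: elipschitz_ge0 hK. Qed.

Let vol_gt0 : 0 < vol. Proof. exact: ball_volume_gt0. Qed.

Let lipschitz_rescaled x : elipschitz (delta * K) (fun u => h (x + delta *: u)).
Proof.
move=> u w; rewrite (le_trans (hK _ _))//.
have -> : x + delta *: u - (x + delta *: w) = delta *: (u - w).
  by rewrite opprD addrACA subrr add0r scalerBr.
by rewrite enormZ gtr0_norm// mulrA [K * _]mulrC.
Qed.

Let bounded_support_ball x :
  bounded_support (fun u => h (x + delta *: u) * ball_indic 1 u).
Proof.
apply: bounded_supportM; last exact: bounded_support_ball_indic.
  exact: measurable_elipschitz (lipschitz_rescaled x).
exact: elipschitz_locally_bounded (lipschitz_rescaled x).
Qed.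

Lemma smoothingE x :
  smoothing h delta x = vol^-1 * \int[m]_u (h (x + delta *: u) * ball_indic 1 u).
Proof. by rewrite /smoothing /unit_ball Rintegral_ball. Qed.

Lemma smoothing_cst (a : R) :
  vol^-1 * \int[m]_u (a * @ball_indic R d 1 u) = a.
Proof.
rewrite RintegralZl//; last first.
  exact: bounded_support_integrable (bounded_support_ball_indic 1).
by rewrite Rintegral_ball_indic// expr1n mul1r mulrCA mulVf ?mulr1// gt_eqF.
Qed.

Lemma smoothing_le x y (a : R) :
  (forall u, enorm u <= 1 -> h (x + delta *: u) <= h (y + delta *: u) + a) ->
  smoothing h delta x <= smoothing h delta y + a.
Proof.
move=> hxy; rewrite !smoothingE -[X in _ <= _ + X]smoothing_cst -mulrDr.
rewrite ler_pM2l ?invr_gt0// -RintegralD//.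
- apply: le_Rintegral => //.
  + exact: bounded_support_integrable.
  + apply: bounded_support_integrable; apply: bounded_supportD => //.
    exact: (bounded_supportZ _ (bounded_support_ball_indic 1)).
  move=> u _; rewrite -mulrDl ball_indicE; have [u1|_] := leP (enorm u) 1.
    by rewrite !mulr1 hxy.
  by rewrite !mulr0.
- exact: bounded_support_integrable.
- apply: bounded_support_integrable.
  exact: (bounded_supportZ _ (bounded_support_ball_indic 1)).
Qed.

Lemma smoothing_lipschitz : elipschitz K (smoothing h delta).
Proof.
have H x y : smoothing h delta x <= smoothing h delta y + K * enorm (x - y).
  apply: smoothing_le => u _; rewrite -lerBlDl (le_trans (ler_norm _))//.
  rewrite (le_trans (hK _ _))// (_ : x + _ - _ = x - y)//.
  by rewrite opprD addrACA subrr addr0.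
move=> x y; rewrite ler_norml lerBlDl H andbT.
by rewrite lerNl opprB lerBlDl enormB H.
Qed.

Lemma smoothing_close x : `|smoothing h delta x - h x| <= K * delta.
Proof.
rewrite -[X in _ - X]smoothing_cst smoothingE -mulrBr normrM.
rewrite gtr0_norm ?invr_gt0// mulrC ler_pdivrMr//.
have bc : bounded_support (fun u => h x * @ball_indic R d 1 u).
  exact: (bounded_supportZ _ (bounded_support_ball_indic 1)).
have bc' : bounded_support (fun u => K * delta * @ball_indic R d 1 u).
  exact: (bounded_supportZ _ (bounded_support_ball_indic 1)).
have -> : K * delta * vol = \int[m]_u (K * delta * @ball_indic R d 1 u).
  by rewrite -[K * delta in LHS]smoothing_cst mulrC mulrA mulfV ?mul1r// gt_eqF.
rewrite -Rintegral_bounded_supportB// (le_trans (le_normr_Rintegral _ _))//.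
  by apply: bounded_support_integrable; exact: bounded_supportB.
apply: le_Rintegral => //.
- by apply: integrable_norm; apply: bounded_support_integrable; exact: bounded_supportB.
- exact: bounded_support_integrable.
move=> u _; rewrite -mulrBl normrM ball_indicE; have [u1|_] := leP (enorm u) 1.
  rewrite normr1 !mulr1 (le_trans (hK _ _))// addrC addKr enormZ gtr0_norm// ler_wpM2l//.
  by rewrite ler_piMr// ltW.
by rewrite normr0 !mulr0.
Qed.

Lemma smoothing_ge (a : R) : (forall x, a <= h x) -> forall x, a <= smoothing h delta x.
Proof.
move=> ah x; rewrite smoothingE -[leLHS]smoothing_cst ler_pM2l ?invr_gt0//.
apply: le_Rintegral => //.
- apply: bounded_support_integrable.
  exact: (bounded_supportZ _ (bounded_support_ball_indic 1)).
- exact: bounded_support_integrable.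
by move=> u _; rewrite ler_wpM2r// ball_indicE.
Qed.

Lemma smoothing_gradientE x v : differentiable (smoothing h delta) x ->
  dotv (gradient (smoothing h delta) x) v = d%:R / delta *
    (vol^-1 * \int[m]_u (h (x + delta *: dir u) * dotv (dir u) v * ball_indic 1 u)).
Proof.
move=> df; have := gradient_cvg (v := delta *: v) df; rewrite dotvZr => H.
set D := dotv _ v in H *.
have := @divergence_ball R d (fun u => h (x + delta *: u)) (delta * K) v d_gt0
  (lipschitz_rescaled x) (vol * (delta * D)).
have H2 : ((\int[m]_u (h (x + delta *: (u + n.+1%:R^-1 *: v)) * ball_indic 1 u)) -
           (\int[m]_u (h (x + delta *: (u + 0 *: v)) * ball_indic 1 u))) / n.+1%:R^-1
     @[n --> \oo] --> vol * (delta * D).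
  have : vol * ((smoothing h delta (x + n.+1%:R^-1 *: (delta *: v)) -
      smoothing h delta x) / n.+1%:R^-1) @[n --> \oo] --> vol * (delta * D).
    exact: cvgMl_tmp H.
  apply: cvg_trans; apply: near_eq_cvg; apply: nearW => n /=.
  rewrite !smoothingE mulrA -mulrBr mulrA mulfV ?gt_eqF// mul1r; congr ((_ - _) / _).
    apply: eq_Rintegral => u _; congr (h _ * _).
    by apply/rowP => i; rewrite !mxE; ring.
  by apply: eq_Rintegral => u _; rewrite scale0r addr0.
move=> /(_ H2) E.
have -> : D = (vol * delta)^-1 * (vol * (delta * D)).
  by field; rewrite !gt_eqF.
by rewrite E; field; rewrite !gt_eqF.
Qed.

(** The gradient of the smoothed function is an average of gradients over the
    ball of radius [delta]. In terms of support functions: for small [t] the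
    difference quotients in direction [v] are at most the largest Clarke
    derivative over the ball, and averaging preserves this. *)
Lemma smoothing_gradient_goldstein x : differentiable (smoothing h delta) x ->
  goldstein_subdiff delta h x (gradient (smoothing h delta) x).
Proof.
move=> df; apply: (goldstein_subdiff_mem d_gt0 hK) => [|v a hav]; first exact: ltW.
apply/ler_addgt0Pr => e e0.
have [eta /= eta0 etaP] := clarke_dd_uniform e0 hav.
apply: (cvgr_to_le (gradient_cvg (v := v) df)); near=> n.
have n0 : 0 < n.+1%:R^-1 :> R by rewrite invr_gt0 ltr0n.
rewrite ler_pdivrMr// lerBlDl mulrC; apply: smoothing_le => u u1.
rewrite -lerBlDl addrAC; apply: etaP => //=.
  rewrite sub0r normrN gtr0_norm//.
  by near: n; exact: near_natSinv_lt.
by rewrite /eball/= addrAC subrr add0r enormZ gtr0_norm// ler_piMr// ltW.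
Unshelve. all: end_near. Qed.

End smoothing_facts.

(** * Rotations of pairs of vectors *)
Section pair_rotations.
Context {R : realType} {d : nat}.
Local Notation V := 'rV[R]_d.
Local Notation m := (@lebesgue_rV R d).
Local Notation mm := (m \x m)%E.

Lemma measurable_rV_lin (a b : R) :
  measurable_fun setT (fun z : V * V => a *: z.1 + b *: z.2).
Proof.
apply: measurable_rV_add; apply: measurable_rV_scale => //; exact: measurable_cst.
Qed.

Lemma measurable_pair_lin (a b a' b' : R) :
  measurable_fun setT (fun z : V * V => (a *: z.1 + b *: z.2, a' *: z.1 + b' *: z.2)).
Proof. by apply: measurable_fun_pair; exact: measurable_rV_lin. Qed.

Definition pair_rot (c s : R) (z : V * V) : V * V :=
  (c *: z.1 + s *: z.2, - s *: z.1 + c *: z.2).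

Implicit Type f : V * V -> \bar R.

Lemma integral_pair1 f : measurable_fun setT f -> (forall z, 0 <= f z)%E ->
  (\int[mm]_z f z = \int[m]_x \int[m]_y f (x, y))%E.
Proof. by move=> mf f0; exact: fubini_tonelli1. Qed.

Lemma integral_pair2 f : measurable_fun setT f -> (forall z, 0 <= f z)%E ->
  (\int[mm]_z f z = \int[m]_y \int[m]_x f (x, y))%E.
Proof. by move=> mf f0; exact: fubini_tonelli2. Qed.

Lemma integral_shear1 (a : R) f : measurable_fun setT f -> (forall z, 0 <= f z)%E ->
  (\int[mm]_z f (z.1 + a *: z.2, z.2)%R = \int[mm]_z f z)%E.
Proof.
move=> mf f0.
have mS : measurable_fun setT (fun z : V * V => (z.1 + a *: z.2, z.2)).
  have := measurable_pair_lin 1 a 0 1; congr measurable_fun; apply/funext => z.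
  by rewrite !scale1r scale0r add0r.
apply: etrans; first by apply: (@integral_pair2 (fun z => f (z.1 + a *: z.2, z.2))) => //; exact: measurableT_comp.
rewrite integral_pair2//; apply: eq_integral => y _ /=.
apply: (@integral_translation R d (a *: y) (fun x => f (x, y))).
exact: measurableT_comp.
Qed.

Lemma integral_shear2 (b : R) f : measurable_fun setT f -> (forall z, 0 <= f z)%E ->
  (\int[mm]_z f (z.1, z.2 + b *: z.1)%R = \int[mm]_z f z)%E.
Proof.
move=> mf f0.
have mS : measurable_fun setT (fun z : V * V => (z.1, z.2 + b *: z.1)).
  have := measurable_pair_lin 1 0 b 1; congr measurable_fun; apply/funext => z.
  by rewrite !scale1r scale0r addr0 addrC.
apply: etrans; first by apply: (@integral_pair1 (fun z => f (z.1, z.2 + b *: z.1))) => //; exact: measurableT_comp.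
rewrite integral_pair1//; apply: eq_integral => x _ /=.
apply: (@integral_translation R d (b *: x) (fun y => f (x, y))).
exact: measurableT_comp.
Qed.

(** A rotation is a product of three shears, and shears preserve the product
    measure by translation invariance of its factors. *)
Lemma integral_rot (c s : R) f : c ^+ 2 + s ^+ 2 = 1 -> s != 0 ->
  measurable_fun setT f -> (forall z, 0 <= f z)%E ->
  (\int[mm]_z f (pair_rot c s z) = \int[mm]_z f z)%E.
Proof.
move=> cs s0 mf f0; pose a := (1 - c) / s.
have ac : 1 - a * s = c by rewrite /a divfK// subKr.
have mS1 : measurable_fun setT (fun z : V * V => (z.1 + a *: z.2, z.2)).
  have := measurable_pair_lin 1 a 0 1; congr measurable_fun; apply/funext => z.
  by rewrite !scale1r scale0r add0r.
have mS2 : measurable_fun setT (fun z : V * V => (z.1, z.2 + (- s) *: z.1)).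
  have := measurable_pair_lin 1 0 (- s) 1; congr measurable_fun; apply/funext => z.
  by rewrite !scale1r scale0r addr0 addrC.
rewrite -[RHS](@integral_shear1 a)//.
rewrite -[RHS](@integral_shear2 (- s) (fun z => f (z.1 + a *: z.2, z.2)))//; last exact: measurableT_comp.
rewrite -[RHS](@integral_shear1 a (fun z => f (z.1 + a *: (z.2 + (- s) *: z.1), z.2 + (- s) *: z.1)))//; last first.
  by apply: measurableT_comp => //; exact: (measurableT_comp mS1 mS2).
apply: eq_integral => -[x y] _; rewrite /pair_rot/=; congr f; congr pair; apply/rowP => i; rewrite !mxE.
  have E : s = a + a * c.
    apply: (mulIf s0); rewrite (_ : (a + a * c) * s = (a * s) * (1 + c)); last by ring.
    rewrite /a divfK// (_ : s * s = s ^+ 2)//.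
    by rewrite (_ : s ^+ 2 = 1 - c ^+ 2); [ring|rewrite -cs; ring].
  transitivity ((1 - a * s) * x ord0 i + (a + a * (1 - a * s)) * y ord0 i).
    by rewrite ac -E.
  by ring.
by rewrite -[X in _ + X * _]ac; ring.
Qed.

End pair_rotations.

(** * Second moments of a symmetric weight *)

Lemma integrable_bigsum dT (T : measurableType dT) (R : realType)
    (mu : {measure set T -> \bar R}) (I : Type) (r : seq I) (h : I -> T -> R) :
  (forall i, mu.-integrable setT (EFin \o h i)) ->
  mu.-integrable setT (EFin \o (fun u => \sum_(i <- r) h i u)).
Proof.
move=> ih; have -> : EFin \o (fun u => \sum_(i <- r) h i u) =
    (fun u => \sum_(i <- r) (h i u)%:E)%E by apply/funext => u /=; rewrite sumEFin.
by apply: integrable_sum => // i _; exact: ih.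
Qed.

Lemma Rintegral_bigsum dT (T : measurableType dT) (R : realType)
    (mu : {measure set T -> \bar R}) (I : Type) (r : seq I) (h : I -> T -> R) :
  (forall i, mu.-integrable setT (EFin \o h i)) ->
  \int[mu]_u (\sum_(i <- r) h i u) = \sum_(i <- r) \int[mu]_u h i u.
Proof.
move=> ih; elim: r => [|i r IH].
  rewrite big_nil /Rintegral; under eq_integral do rewrite big_nil.
  by rewrite integral0.
rewrite big_cons -IH -RintegralD//; last exact: integrable_bigsum.
by apply: eq_Rintegral => u _; rewrite big_cons.
Qed.

Section second_moments.
Context {R : realType} {d : nat}.
Local Notation V := 'rV[R]_d.
Local Notation m := (@lebesgue_rV R d).

Lemma bounded_support_sum (I : Type) (r : seq I) (h : I -> V -> R) :
  (forall i, bounded_support (h i)) -> bounded_support (fun u => \sum_(i <- r) h i u).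
Proof.
move=> bh; elim: r => [|i r ih].
  under eq_fun do rewrite big_nil; split; first exact: measurable_cst.
  by exists 0, 0 => u; rewrite normr0 mul0r.
by under eq_fun do rewrite big_cons; apply: bounded_supportD.
Qed.

Lemma enorm_reflect_coord i (y : V) : enorm (reflect_coord i y) = enorm y.
Proof.
rewrite /enorm /dotv; congr Num.sqrt; apply: eq_bigr => j _; rewrite mxE.
by case: ifP => // _; rewrite mulrNN.
Qed.

Lemma enorm_swap_coord i j (y : V) : enorm (swap_coord i j y) = enorm y.
Proof.
rewrite /enorm /dotv; congr Num.sqrt; rewrite [RHS](reindex_inj (@perm_inj _ (tperm i j)))/=.
by apply: eq_bigr => k _; rewrite mxE.
Qed.

Variable w : V -> R.
Hypotheses (bw : bounded_support w)
  (w_reflect : forall i y, w (reflect_coord i y) = w y)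
  (w_swap : forall i j y, w (swap_coord i j y) = w y).

Let bounded_support_moment (i j : 'I_d) :
  bounded_support (fun y : V => y ord0 i * y ord0 j * w y).
Proof.
apply: bounded_supportM => //.
  by apply: measurable_funM; exact: measurable_coord.
move=> r; exists (r * r) => u ur; rewrite normrM.
by apply: ler_pM => //; rewrite (le_trans (coord_le_enorm _ _)).
Qed.

Let measurable_moment i j := (bounded_support_moment i j).1.

Let moment i j := \int[m]_y (y ord0 i * y ord0 j * w y).

Let moment_neq i j : i != j -> moment i j = 0.
Proof.
move=> ij; suff : moment i j = - moment i j by move=> h; lra.
rewrite -mulN1r -RintegralZl//; last exact: bounded_support_integrable.
rewrite /moment /Rintegral -(@integral_reflect_coord _ _ i (EFin \o _)); last first.
  exact/measurable_EFinP.
congr fine; apply: eq_integral => y _ /=.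
by rewrite w_reflect !mxE eqxx eq_sym (negbTE ij) mulN1r !mulNr.
Qed.

Let moment_eq i j : moment i i = moment j j.
Proof.
rewrite /moment /Rintegral -(@integral_swap_coord _ _ i j (EFin \o _)); last first.
  exact/measurable_EFinP.
by congr fine; apply: eq_integral => y _ /=; rewrite w_swap !mxE tpermL.
Qed.

(** Reflections kill the mixed moments and transpositions equate the others. *)
Lemma symmetric_second_moment (a : V) :
  d%:R * \int[m]_y (dotv a y ^+ 2 * w y) =
  enorm a ^+ 2 * \int[m]_y (enorm y ^+ 2 * w y).
Proof.
have -> : \int[m]_y (dotv a y ^+ 2 * w y) = \sum_i a ord0 i ^+ 2 * moment i i.
  transitivity (\int[m]_y (\sum_i \sum_j (a ord0 i * a ord0 j) * (y ord0 i * y ord0 j * w y))).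
    apply: eq_Rintegral => y _; rewrite expr2 {1}/dotv !mulr_suml.
    apply: eq_bigr => i _; rewrite /dotv mulr_sumr mulr_suml; apply: eq_bigr => j _; ring.
  rewrite Rintegral_bigsum => [|i]; last first.
    apply: bounded_support_integrable; apply: bounded_support_sum => j.
    exact: bounded_supportZ.
  apply: eq_bigr => i _; rewrite Rintegral_bigsum => [|j]; last first.
    by apply: bounded_support_integrable; exact: bounded_supportZ.
  rewrite (bigD1 i)//= big1 ?addr0 => [|j ji].
    by rewrite RintegralZl// ?expr2//; exact: bounded_support_integrable.
  rewrite RintegralZl//; last exact: bounded_support_integrable.
  by rewrite -/(moment i j) moment_neq ?mulr0// eq_sym.
have -> : \int[m]_y (enorm y ^+ 2 * w y) = \sum_i moment i i.
  transitivity (\int[m]_y (\sum_i (y ord0 i * y ord0 i * w y))).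
    by apply: eq_Rintegral => y _; rewrite enorm_sq /dotv mulr_suml.
  by rewrite Rintegral_bigsum// => i; exact: bounded_support_integrable.
rewrite enorm_sq /dotv mulr_suml mulr_sumr; apply: eq_bigr => i _.
rewrite (eq_bigr (fun=> moment i i)) => [|j _]; last exact: moment_eq.
by rewrite sumr_const card_ord -[moment i i *+ d]mulr_natl; ring.
Qed.

End second_moments.

(** * A Poincare inequality for odd functions *)
Section pairs_ball.
Context {R : realType} {d : nat}.
Local Notation V := 'rV[R]_d.
Local Notation m := (@lebesgue_rV R d).
Local Notation mm := (m \x m)%E.
Local Notation vol := (@ball_volume R d).

(** The indicator of the unit ball of [R^(2d)], seen as pairs of vectors. *)
Definition pair_ball (z : V * V) : R := (enorm z.1 ^+ 2 + enorm z.2 ^+ 2 <= 1)%R%:R.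

Lemma pair_ball01 z : 0 <= pair_ball z <= 1.
Proof. by rewrite /pair_ball ler0n lern1; case: (enorm z.1 ^+ 2 + _ <= 1). Qed.

Lemma measurable_pair_ball : measurable_fun setT pair_ball.
Proof.
pose S := [set z : V * V | enorm z.1 ^+ 2 + enorm z.2 ^+ 2 <= 1].
have mS : measurable S.
  rewrite (_ : S = (fun z => enorm z.1 ^+ 2 + enorm z.2 ^+ 2) @^-1` `]-oo, 1]%classic); last first.
    by apply/seteqP; split => z /=; rewrite in_itv.
  rewrite -[X in measurable X]setTI; apply: (_ : measurable_fun setT _) => //.
  by apply: measurable_funD; apply: measurable_funX;
    apply: (measurableT_comp measurable_enorm).
rewrite (_ : pair_ball = \1_S); first exact: measurable_indic.
apply/funext => z; rewrite /pair_ball indicE; congr (_%:R : R); congr nat_of_bool.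
by apply/idP/idP => [h|/set_mem//]; exact/mem_set.
Qed.

Lemma pair_ball_le z : pair_ball z <= ball_indic 1 z.1 * ball_indic 1 z.2.
Proof.
rewrite /pair_ball !ball_indicE; have [h|_] := leP (_ + _) 1; last by rewrite mulr_ge0.
have n1 := sqr_ge0 (enorm z.1); have n2 := sqr_ge0 (enorm z.2).
rewrite -[enorm z.1 <= 1](@ler_pXn2r _ 2)// ?nnegrE ?enorm_ge0// expr1n.
rewrite -[enorm z.2 <= 1](@ler_pXn2r _ 2)// ?nnegrE ?enorm_ge0// expr1n.
have h1 : enorm z.1 ^+ 2 <= 1 by lra.
have h2 : enorm z.2 ^+ 2 <= 1 by lra.
by rewrite h1 h2 mulr1.
Qed.

Lemma pair_ball_ler1 z (a b : R) : (enorm z.1 <= 1 -> enorm z.2 <= 1 -> a <= b) ->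
  a * pair_ball z <= b * pair_ball z.
Proof.
move=> ab; have := pair_ball_le z; rewrite !ball_indicE.
have [z1|_] := leP (enorm z.1) 1; have [z2|_] := leP (enorm z.2) 1 => /= h.
- by rewrite ler_wpM2r ?ab//; case/andP: (pair_ball01 z).
all: have -> : pair_ball z = 0; [apply/eqP; rewrite eq_le; case/andP: (pair_ball01 z) => -> _;
  rewrite andbT; move: h; rewrite ?mulr0 ?mul0r//|by rewrite !mulr0].
Qed.

Lemma pair_ball_rot (c s : R) (z : V * V) : c ^+ 2 + s ^+ 2 = 1 -> pair_ball (pair_rot c s z) = pair_ball z.
Proof.
move=> cs; rewrite /pair_ball.
have -> // : enorm (pair_rot c s z).1 ^+ 2 + enorm (pair_rot c s z).2 ^+ 2 =
  enorm z.1 ^+ 2 + enorm z.2 ^+ 2.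
case: z => x y; rewrite /pair_rot/= !enorm_sq !dotvDl !dotvDr !dotvZl !dotvZr (dotvC y x).
transitivity ((c ^+ 2 + s ^+ 2) * dotv x x + (c ^+ 2 + s ^+ 2) * dotv y y); first by ring.
by rewrite cs !mul1r.
Qed.

Lemma lebesgue_pair_ball_lty : (\int[mm]_z (pair_ball z)%:E < +oo)%E.
Proof.
have mB : measurable_fun setT (fun z : V * V => (ball_indic 1 z.1 * ball_indic 1 z.2)%:E).
  apply/measurable_EFinP; apply: measurable_funM;
    by apply: (measurableT_comp (measurable_ball_indic 1)).
apply: (@le_lt_trans _ _ (\int[mm]_z (ball_indic 1 z.1 * ball_indic 1 z.2)%:E)%E).
  apply: ge0_le_integral => //.
  - by move=> z _; rewrite lee_fin; case/andP: (pair_ball01 z).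
  - by apply/measurable_EFinP; exact: measurable_pair_ball.
  - by move=> z _; rewrite lee_fin pair_ball_le.
rewrite integral_pair1//; last by move=> z; rewrite lee_fin mulr_ge0// !ball_indicE.
have iB : (\int[m]_y (@ball_indic R d 1 y)%:E = vol%:E)%E.
  by rewrite integral_ball_indic ball_volumeE.
have mb : measurable_fun setT (fun y : V => (ball_indic 1 y)%:E).
  by apply/measurable_EFinP; exact: measurable_ball_indic.
have b0 (y : V) : (0 <= (ball_indic 1 y)%:E)%E by rewrite lee_fin ball_indicE.
have -> : (\int[m]_x \int[m]_y (ball_indic 1 x * ball_indic 1 y)%:E =
    \int[m]_x ((ball_indic 1 x)%:E * vol%:E))%E.
  apply: eq_integral => x _; rewrite -iB -ge0_integralZl//.
rewrite ge0_integralZr//=; last by rewrite lee_fin ltW// ball_volume_gt0.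
by rewrite iB -EFinM ltry.
Qed.

(** The analogue of [bounded_support] for integrands over pairs. *)
Definition pair_dominated (g : V * V -> R) :=
  measurable_fun setT g /\ exists M, forall z, `|g z| <= M * pair_ball z.

Lemma pair_dominated_integrable g : pair_dominated g ->
  mm.-integrable setT (EFin \o g).
Proof.
move=> [mg [M gM]].
have iB : mm.-integrable setT (EFin \o (fun z => M * pair_ball z)).
  have : mm.-integrable setT (EFin \o pair_ball).
    apply/integrableP; split; first by apply/measurable_EFinP; exact: measurable_pair_ball.
    rewrite (eq_integral (fun z => (pair_ball z)%:E)) => [|z _]; first exact: lebesgue_pair_ball_lty.
    by rewrite /= ger0_norm//; case/andP: (pair_ball01 z).
  by move=> /(integrableZl measurableT M); apply: eq_integrable.
apply: le_integrable iB => //; first exact/measurable_EFinP.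
by move=> z _ /=; rewrite lee_fin (le_trans (gM z))// ler_norm.
Qed.

Lemma pair_dominatedI (g : V * V -> R) (M : R) : measurable_fun setT g ->
  (forall z, enorm z.1 <= 1 -> enorm z.2 <= 1 -> `|g z| <= M) ->
  pair_dominated (fun z => g z * pair_ball z).
Proof.
move=> mg gM; split; first by apply: measurable_funM => //; exact: measurable_pair_ball.
exists M => z; have /andP[b0 _] := pair_ball01 z.
by rewrite normrM (ger0_norm b0); apply: pair_ball_ler1; exact: gM.
Qed.

Lemma pair_dominatedZ a g : pair_dominated g -> pair_dominated (fun z => a * g z).
Proof.
move=> [mg [M gM]]; split; first by apply: measurable_funM.
by exists (`|a| * M) => z; rewrite normrM -mulrA ler_wpM2l.
Qed.

Lemma pair_dominatedD g1 g2 : pair_dominated g1 -> pair_dominated g2 ->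
  pair_dominated (fun z => g1 z + g2 z).
Proof.
move=> [mg1 [M1 gM1]] [mg2 [M2 gM2]]; split; first by apply: measurable_funD.
by exists (M1 + M2) => z; rewrite mulrDl (le_trans (ler_normD _ _))// lerD.
Qed.

Lemma Rintegral_rot (c s : R) (g : V * V -> R) : c ^+ 2 + s ^+ 2 = 1 -> s != 0 ->
  measurable_fun setT g -> (forall z, 0 <= g z) ->
  \int[mm]_z g (pair_rot c s z) = \int[mm]_z g z.
Proof.
move=> cs s0 mg g0; rewrite /Rintegral -(@integral_rot _ _ c s (EFin \o g))//.
exact/measurable_EFinP.
Qed.

Lemma measurable_rot (c s : R) : measurable_fun setT (pair_rot c s : V * V -> V * V).
Proof. exact: measurable_pair_lin. Qed.

Lemma iter_rot (t : R) n (z : V * V) : iter n (pair_rot (cos t) (sin t)) z = pair_rot (cos (n%:R * t)) (sin (n%:R * t)) z.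
Proof.
elim: n => [|n ih]; first by rewrite mul0r cos0 sin0 /pair_rot !scale1r oppr0 !scale0r addr0 add0r; case: z.
rewrite iterS ih -natr1 mulrDl mul1r cosD sinD /pair_rot /=; congr pair;
  apply/rowP => i; rewrite !mxE; ring.
Qed.

Lemma sqr_sum_le n (a : 'I_n -> R) : (\sum_j a j) ^+ 2 <= n%:R * \sum_j a j ^+ 2.
Proof.
pose u : 'rV[R]_n := const_mx 1; pose b : 'rV[R]_n := \row_j a j.
have ub : dotv u b = \sum_j a j.
  by rewrite /dotv; apply: eq_bigr => j _; rewrite !mxE mul1r.
have uu : dotv u u = n%:R.
  rewrite /dotv (eq_bigr (fun=> 1)) => [|j _]; last by rewrite !mxE mulr1.
  by rewrite sumr_const card_ord.
have bb : dotv b b = \sum_j a j ^+ 2.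
  by rewrite /dotv; apply: eq_bigr => j _; rewrite !mxE expr2.
rewrite -ub -uu -bb -!enorm_sq -exprMn -[leLHS]real_normK ?num_real//.
rewrite ler_pXn2r// ?nnegrE ?mulr_ge0 ?enorm_ge0//; exact: normr_dotv_le.
Qed.

(** Turning a pair [(x, y)] by a total angle [pi], in [n] equal steps, leads
    from [x] to [-x], and all steps have the same distribution. *)
Lemma half_turn_le (h : V -> R) (M : R) n : measurable_fun setT h ->
  (forall u, enorm u <= 2 -> `|h u| <= M) -> (1 < n)%N ->
  \int[mm]_z ((h z.1 - h (- z.1)) ^+ 2 * pair_ball z) <=
  n%:R ^+ 2 * \int[mm]_z ((h z.1 - h (pair_rot (cos (pi / n%:R)) (sin (pi / n%:R)) z).1) ^+ 2 * pair_ball z).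
Proof.
move=> mh hM n1; set t := pi / n%:R; set rt := pair_rot (cos t) (sin t).
have n0 : 0 < n%:R :> R by rewrite ltr0n (ltn_trans _ n1).
have nt : n%:R * t = pi by rewrite /t mulrC divfK// gt_eqF.
have t0 : 0 < t by rewrite divr_gt0// pi_gt0.
have st : sin t != 0.
  rewrite gt_eqF// sin_gt0_pi// t0/= /t ltr_pdivrMr// ltr_pMr ?pi_gt0//.
  by rewrite ltr1n.
have ct := cos2Dsin2 t.
pose g z := (h z.1 - h (rt z).1) ^+ 2 * pair_ball z.
have mg0 : measurable_fun setT (fun z : V * V => (h z.1 - h (rt z).1) ^+ 2).
  apply: measurable_funX; apply: measurable_funB; first exact: measurableT_comp.
  by apply: (measurableT_comp mh); apply: measurableT_comp => //; exact: measurable_rot.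
have norm2 c s (z : V * V) : enorm z.1 <= 1 -> enorm z.2 <= 1 -> `|c| <= 1 -> `|s| <= 1 ->
    enorm (c *: z.1 + s *: z.2) <= 2.
  move=> z1 z2 c1 s1; rewrite (le_trans (enormD _ _))// !enormZ (_ : 2 = 1 * 1 + 1 * 1); last by ring.
  by apply: lerD; apply: ler_pM => //; exact: enorm_ge0.
have dg : pair_dominated g.
  apply: (pair_dominatedI (M := (M + M) ^+ 2)) => // z z1 z2.
  rewrite normrX; apply: lerXn2r; rewrite ?nnegrE//.
    by rewrite addr_ge0// (le_trans _ (hM 0 _))// enorm0.
  rewrite (le_trans (ler_normB _ _))// lerD//; first by apply: hM; lra.
  by apply: hM; apply: norm2 => //; [exact: cos_max|exact: sin_max].
have gj j : pair_dominated (fun z => g (iter j rt z)).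
  have mi : measurable_fun setT (iter j rt).
    elim: j => [|j ih]; first exact: measurable_id.
    exact: (measurableT_comp (measurable_rot _ _) ih).
  case: dg => mg [C gC]; split; first exact: measurableT_comp.
  exists C => z; rewrite (le_trans (gC _))// le_eqVlt; apply/orP; left; apply/eqP.
  by congr (_ * _); elim: j {mi} => //= j <-; rewrite pair_ball_rot.
have intj j : \int[mm]_z g (iter j rt z) = \int[mm]_z g z.
  elim: j => // j ih; rewrite -[RHS]ih -(@Rintegral_rot (cos t) (sin t) (fun z => g (iter j rt z)))//.
  - by apply: eq_Rintegral => z _; rewrite iterSr.
  - by case: (gj j).
  - by move=> z; rewrite mulr_ge0// ?sqr_ge0//; case/andP: (pair_ball01 (iter j rt z)).
have -> : n%:R ^+ 2 * \int[mm]_z g z = \int[mm]_z (n%:R * \sum_(j < n) g (iter j rt z)).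
  rewrite RintegralZl//; last first.
    by apply: integrable_bigsum => j; apply: pair_dominated_integrable; exact: gj.
  rewrite Rintegral_bigsum => [|j]; last by apply: pair_dominated_integrable; exact: gj.
  rewrite (eq_bigr (fun=> \int[mm]_z g z)) => [|j _]; last exact: intj.
  by rewrite sumr_const card_ord -[X in _ = _ * X]mulr_natl mulrA expr2.
apply: le_Rintegral => //.
- apply: pair_dominated_integrable; apply: (pair_dominatedI (M := (M + M) ^+ 2)).
    apply: measurable_funX; apply: measurable_funB; first exact: measurableT_comp.
    exact: (measurableT_comp mh (measurable_rV_opp measurable_fst)).
  move=> z z1 z2; rewrite normrX; apply: lerXn2r; rewrite ?nnegrE//.
    by rewrite addr_ge0// (le_trans _ (hM 0 _))// enorm0.
  by rewrite (le_trans (ler_normB _ _))// lerD//; apply: hM; rewrite ?enormN; lra.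
- have := @integrable_bigsum _ _ R mm _ (index_enum 'I_n) (fun j z => g (iter j rt z))
    (fun j => pair_dominated_integrable (gj j)).
  by move=> /(integrableZl measurableT n%:R); apply: eq_integrable.
move=> z _; have zn : (iter n rt z).1 = - z.1.
  by rewrite iter_rot nt cospi sinpi /pair_rot/= scale0r addr0 scaleN1r.
have tele k : h z.1 - h (iter k rt z).1 =
    \sum_(j < k) (h (iter j rt z).1 - h (iter j.+1 rt z).1).
  by elim: k => [|k ih]; rewrite ?big_ord0 ?subrr// big_ord_recr/= -ih addrA subrK.
rewrite -zn tele.
rewrite (@le_trans _ _ (n%:R * (\sum_(j < n) (h (iter j rt z).1 - h (iter j.+1 rt z).1) ^+ 2) * pair_ball z))//.
  by rewrite ler_wpM2r ?sqr_sum_le//; case/andP: (pair_ball01 z).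
rewrite -mulrA ler_wpM2l// mulr_suml le_eqVlt; apply/orP; left; apply/eqP.
apply: eq_bigr => j _; rewrite /g iterS; congr (_ * _).
by elim: (j : nat) => //= k ->; rewrite pair_ball_rot.
Qed.

Lemma sin_cos_bounds (t : R) : 0 < t ->
  [/\ `|sin t| <= t, `|1 - cos t| <= t & `|1 - cos t| <= t ^+ 2].
Proof.
move=> t0.
have sinb (s : R) : 0 < s -> `|sin s| <= s.
  move=> s0; have [c _] := @MVT R sin cos 0 s s0 (fun x _ => is_derive_sin x)
    (continuous_subspaceT (@continuous_sin R)).
  rewrite sin0 !subr0 => ->; rewrite normrM (gtr0_norm s0) ler_piMl ?cos_max//.
  exact: ltW.
have [c] := @MVT R cos (fun x => - sin x) 0 t t0 (fun x _ => is_derive_cos x)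
  (continuous_subspaceT (@continuous_cos R)).
rewrite in_itv/= cos0 subr0 => /andP[c0 ct] E.
have -> : 1 - cos t = sin c * t by rewrite -opprB E; ring.
split; first exact: sinb.
- by rewrite normrM (gtr0_norm t0) ler_piMl ?sin_max// ltW.
- rewrite normrM (gtr0_norm t0) expr2 ler_pM2r//.
  by rewrite (le_trans (sinb _ c0))// ltW.
Qed.

(** The mean value theorem between [x] and [x cos t + y sin t], whose difference
    is [t y] up to [O(t^2)]. *)
Lemma rot_step_le (h : V -> R) (K M t : R) (z : V * V) : 0 < t -> 0 <= K ->
  (forall y, differentiable h y) ->
  (forall y, enorm (gradient h y) <= K) ->
  (forall y y', enorm (gradient h y - gradient h y') <= M * enorm (y - y')) ->
  enorm z.1 <= 1 -> enorm z.2 <= 1 ->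
  `|h z.1 - h (pair_rot (cos t) (sin t) z).1| <=
  t * `|dotv (gradient h z.1) z.2| + (K + 4 * `|M|) * t ^+ 2.
Proof.
move=> t0 K0 dh hK hM z1 z2; have [st ct ct2] := sin_cos_bounds t0.
rewrite /pair_rot/=; case: z z1 z2 => x y /= z1 z2.
pose v := (cos t - 1) *: x + sin t *: y.
have -> : cos t *: x + sin t *: y = x + v by rewrite /v scalerBl scale1r addrA addrCA subrr addr0.
have nv : enorm v <= 2 * t.
  rewrite (le_trans (enormD _ _))// !enormZ distrC (_ : 2 * t = t * 1 + t * 1); last by ring.
  by apply: lerD; apply: ler_pM => //; exact: enorm_ge0.
have := descent x v dh hM; set e := h (x + v) - h x - _ => he.
have {}he : `|e| <= 4 * `|M| * t ^+ 2.
  rewrite (le_trans he)// (@le_trans _ _ (`|M| * enorm v ^+ 2))//.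
    by rewrite ler_wpM2r ?sqr_ge0// ler_norm.
  rewrite (_ : 4 * _ * _ = `|M| * (2 * t) ^+ 2); last by ring.
  by rewrite ler_wpM2l// lerXn2r// nnegrE ?enorm_ge0// mulr_ge0// ltW.
have -> : h x - h (x + v) = - (e + dotv (gradient h x) v) by rewrite /e; ring.
rewrite normrN (le_trans (ler_normD _ _))//.
have : `|dotv (gradient h x) v| <= K * t ^+ 2 + t * `|dotv (gradient h x) y|.
  rewrite /v dotvDr !dotvZr (le_trans (ler_normD _ _))// !normrM lerD//.
    rewrite distrC mulrC; apply: ler_pM => //.
    rewrite (le_trans (normr_dotv_le _ _))// -[K]mulr1.
    by apply: ler_pM => //; exact: enorm_ge0.
  by rewrite ler_wpM2r.
lra.
Qed.

(** For fixed [x], the law of [y] is invariant under reflections and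
    transpositions of the coordinates. *)
Lemma pair_moment (A : V -> V) (K : R) : measurable_fun setT A ->
  (forall x, enorm (A x) <= K) ->
  d%:R * \int[mm]_z (dotv (A z.1) z.2 ^+ 2 * pair_ball z) <=
  K ^+ 2 * \int[mm]_z (enorm z.2 ^+ 2 * pair_ball z).
Proof.
move=> mA AK.
have K0 : 0 <= K by rewrite (le_trans (enorm_ge0 (A 0))).
have d1 : pair_dominated (fun z => dotv (A z.1) z.2 ^+ 2 * pair_ball z).
  apply: (pair_dominatedI (M := K ^+ 2)).
    apply: measurable_funX; apply: measurable_dotv => //.
    exact: (measurableT_comp mA measurable_fst).
  move=> z _ z2; rewrite normrX lerXn2r// ?nnegrE//.
  rewrite (le_trans (normr_dotv_le _ _))// -[K]mulr1.
  by apply: ler_pM => //; exact: enorm_ge0.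
have d2 : pair_dominated (fun z => enorm z.2 ^+ 2 * pair_ball z).
  apply: (pair_dominatedI (M := 1)).
    apply: measurable_funX; exact: (measurableT_comp measurable_enorm measurable_snd).
  by move=> z _ z2; rewrite normrX exprn_ile1// ger0_norm ?enorm_ge0.
have [m1 _] := d1; have [m2 _] := d2.
have fin1 := integrable_fin_num measurableT (pair_dominated_integrable d1).
have fin2 := integrable_fin_num measurableT (pair_dominated_integrable d2).
rewrite -lee_fin !EFinM !fineK//=.
have pb0 z : 0 <= pair_ball z by case/andP: (pair_ball01 z).
have e1 : measurable_fun setT (fun z : V * V => (dotv (A z.1) z.2 ^+ 2 * pair_ball z)%:E).
  exact/measurable_EFinP.
have e2 : measurable_fun setT (fun z : V * V => (enorm z.2 ^+ 2 * pair_ball z)%:E).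
  exact/measurable_EFinP.
have p1 z : (0 <= (dotv (A z.1) z.2 ^+ 2 * pair_ball z)%:E)%E.
  by rewrite lee_fin mulr_ge0// sqr_ge0.
have p2 z : (0 <= (enorm z.2 ^+ 2 * pair_ball z)%:E)%E.
  by rewrite lee_fin mulr_ge0// sqr_ge0.
rewrite !integral_pair1//.
have F1 := measurable_fun_fubini_tonelli_F (m2 := m) _ e1 p1.
have F2 := measurable_fun_fubini_tonelli_F (m2 := m) _ e2 p2.
rewrite -ge0_integralZl_EFin//; last first.
  by move=> x _; exact: integral_ge0.
rewrite -ge0_integralZl_EFin//; last 2 first.
  by move=> x _; exact: integral_ge0.
  by rewrite sqr_ge0.
apply: ge0_le_integral => //.
- by move=> x _; rewrite mule_ge0// integral_ge0.
- exact: measurable_funeM.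
- exact: measurable_funeM.
move=> x _.
pose w y := pair_ball (x, y).
have mw : measurable_fun setT w.
  by apply: (measurableT_comp measurable_pair_ball); exact: measurable_pair1.
have bw : bounded_support w.
  split=> //; exists 1, 1 => y; rewrite mul1r ger0_norm//.
  rewrite (le_trans (pair_ball_le _))//= ler_piMl// ball_indicE//.
  by rewrite lern1; case: (_ <= _).
have w1 i y : w (reflect_coord i y) = w y by rewrite /w /pair_ball/= enorm_reflect_coord.
have w2 i j y : w (swap_coord i j y) = w y by rewrite /w /pair_ball/= enorm_swap_coord.
have b1 : bounded_support (fun y => dotv (A x) y ^+ 2 * w y).
  apply: bounded_supportM => //.
    by apply: measurable_funX; apply: measurable_dotv => //; exact: measurable_cst.
  move=> r; exists ((enorm (A x) * r) ^+ 2) => u ur.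
  rewrite normrX lerXn2r// ?nnegrE//.
    by rewrite mulr_ge0 ?enorm_ge0// (le_trans (enorm_ge0 u)).
  by rewrite (le_trans (normr_dotv_le _ _))// ler_wpM2l// enorm_ge0.
have b2 : bounded_support (fun y : V => enorm y ^+ 2 * w y).
  apply: bounded_supportM => //.
    by apply: measurable_funX; exact: measurable_enorm.
  move=> r; exists (r ^+ 2) => u ur.
  by rewrite ger0_norm ?sqr_ge0// lerXn2r// ?nnegrE ?enorm_ge0// (le_trans (enorm_ge0 u)).
have f1 := integrable_fin_num measurableT (bounded_support_integrable b1).
have f2 := integrable_fin_num measurableT (bounded_support_integrable b2).
have := symmetric_second_moment bw w1 w2 (A x).
rewrite /Rintegral => E.
have -> : (\int[m]_y (dotv (A (x, y).1) (x, y).2 ^+ 2 * pair_ball (x, y))%:E =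
   (fine (\int[m]_y (dotv (A x) y ^+ 2 * w y)%:E))%:E)%E by rewrite fineK.
have -> : (\int[m]_y (enorm (x, y).2 ^+ 2 * pair_ball (x, y))%:E =
   (fine (\int[m]_y (enorm y ^+ 2 * w y)%:E))%:E)%E by rewrite fineK.
rewrite -!EFinM lee_fin E ler_wpM2r//.
  by rewrite fine_ge0// integral_ge0// => y _; rewrite lee_fin mulr_ge0 ?sqr_ge0.
by rewrite lerXn2r// ?nnegrE// enorm_ge0.
Qed.

End pairs_ball.

Section poincare.
Context {R : realType} {d : nat}.
Local Notation V := 'rV[R]_d.
Local Notation m := (@lebesgue_rV R d).
Local Notation mm := (m \x m)%E.
Local Notation vol := (@ball_volume R d).

Let pb0 (z : V * V) : 0 <= pair_ball z. Proof. by case/andP: (pair_ball01 z). Qed.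

Lemma sqrD_le2 (a b : R) : (a + b) ^+ 2 <= 2 * a ^+ 2 + 2 * b ^+ 2.
Proof. by have := sqr_ge0 (a - b); lra. Qed.

Let pair_dominated_pair_ball : pair_dominated (@pair_ball R d).
Proof.
split; first exact: measurable_pair_ball.
by exists 1 => z; rewrite mul1r ger0_norm.
Qed.

(** As the number of steps of the half-turn tends to infinity, each step
    contributes the derivative of [h] at [x] along [y]; only the component of [y]
    along the gradient matters, whence the factor [1 / d]. *)
Lemma poincare_half_turn (h : V -> R) (K M : R) : 0 <= K -> elipschitz K h ->
  (forall y, differentiable h y) ->
  (forall y y', enorm (gradient h y - gradient h y') <= M * enorm (y - y')) ->
  d%:R * \int[mm]_z ((h z.1 - h (- z.1)) ^+ 2 * pair_ball z) <=
  2 * pi ^+ 2 * K ^+ 2 * \int[mm]_z (enorm z.2 ^+ 2 * pair_ball z).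
Proof.
move=> K0 hK dh hM.
have gK y : enorm (gradient h y) <= K by exact: gradient_le.
have mg : measurable_fun setT (gradient h).
  apply/measurable_rV_comp => i.
  exact: measurable_elipschitz (gradient_coord_lipschitz i hM).
have mh := measurable_elipschitz hK.
have [B hB] := elipschitz_locally_bounded hK 2.
set E := \int[mm]_z _; set S := \int[mm]_z (enorm _ ^+ 2 * _).
pose Q := \int[mm]_z (dotv (gradient h z.1) z.2 ^+ 2 * pair_ball z).
pose W := \int[mm]_z (@pair_ball R d z).
have dQ : pair_dominated (fun z : V * V => dotv (gradient h z.1) z.2 ^+ 2 * pair_ball z).
  apply: (pair_dominatedI (M := K ^+ 2)).
    apply: measurable_funX; apply: measurable_dotv => //.
    exact: (measurableT_comp mg measurable_fst).
  move=> z _ z2; rewrite normrX lerXn2r// ?nnegrE//.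
  rewrite (le_trans (normr_dotv_le _ _))// -[K]mulr1.
  by apply: ler_pM => //; exact: enorm_ge0.
pose C := K + 4 * `|M|.
have step n : (1 < n)%N -> E <= 2 * pi ^+ 2 * Q + n%:R^-1 ^+ 2 * (2 * C ^+ 2 * pi ^+ 4 * W).
  move=> n1; have n0 : 0 < n%:R :> R by rewrite ltr0n (ltn_trans _ n1).
  rewrite (le_trans (half_turn_le mh hB n1))//.
  set t := pi / n%:R; have t0 : 0 < t by rewrite divr_gt0// pi_gt0.
  have bnd : \int[mm]_z ((h z.1 - h (pair_rot (cos t) (sin t) z).1) ^+ 2 * pair_ball z) <=
      \int[mm]_z (2 * t ^+ 2 * (dotv (gradient h z.1) z.2 ^+ 2 * pair_ball z) +
                  2 * C ^+ 2 * t ^+ 4 * pair_ball z).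
    have pw z : enorm z.1 <= 1 -> enorm z.2 <= 1 ->
        (h z.1 - h (pair_rot (cos t) (sin t) z).1) ^+ 2 <=
        2 * t ^+ 2 * dotv (gradient h z.1) z.2 ^+ 2 + 2 * C ^+ 2 * t ^+ 4.
      move=> z1 z2; rewrite -[leLHS]real_normK ?num_real//.
      have := rot_step_le t0 K0 dh gK hM z1 z2; rewrite -/C => hz.
      apply: (@le_trans _ _ ((t * `|dotv (gradient h z.1) z.2| + C * t ^+ 2) ^+ 2)).
        rewrite lerXn2r// nnegrE// (le_trans _ hz)//.
      rewrite (le_trans (sqrD_le2 _ _))// !exprMn real_normK ?num_real//.
      by rewrite le_eqVlt; apply/orP; left; apply/eqP; ring.
    apply: le_Rintegral => //.
    - apply: pair_dominated_integrable; apply: (pair_dominatedI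
        (M := 2 * t ^+ 2 * K ^+ 2 + 2 * C ^+ 2 * t ^+ 4)).
        apply: measurable_funX; apply: measurable_funB; first exact: (measurableT_comp mh measurable_fst).
        apply: (measurableT_comp mh); apply: (measurableT_comp measurable_fst).
        exact: measurable_rot.
      move=> z z1 z2; rewrite ger0_norm ?sqr_ge0// (le_trans (pw _ z1 z2))// lerD2r.
      have t2 : 0 <= 2 * t ^+ 2 by rewrite mulr_ge0 ?sqr_ge0.
      apply: ler_wpM2l => //.
      rewrite -[leLHS]real_normK ?num_real// lerXn2r// ?nnegrE//.
      rewrite (le_trans (normr_dotv_le _ _))// -[K]mulr1.
      by apply: ler_pM => //; exact: enorm_ge0.
    - apply: pair_dominated_integrable; apply: pair_dominatedD.
        exact: (pair_dominatedZ _ dQ).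
      exact: (pair_dominatedZ _ pair_dominated_pair_ball).
    move=> z _; rewrite mulrA -mulrDl; apply: pair_ball_ler1 => z1 z2.
    exact: pw.
  rewrite (@le_trans _ _ (n%:R ^+ 2 * (2 * t ^+ 2 * Q + 2 * C ^+ 2 * t ^+ 4 * W)))//.
    rewrite ler_wpM2l ?sqr_ge0// (le_trans bnd)// RintegralD//.
    - rewrite !RintegralZl//; exact: pair_dominated_integrable.
    - apply: pair_dominated_integrable; exact: (pair_dominatedZ _ dQ).
    - apply: pair_dominated_integrable; exact: (pair_dominatedZ _ pair_dominated_pair_ball).
  rewrite le_eqVlt; apply/orP; left; apply/eqP; rewrite /t; field.
  by rewrite gt_eqF.
have EQ : E <= 2 * pi ^+ 2 * Q.
  apply: (@le_linear_perturbation _ _ _ (2 * C ^+ 2 * pi ^+ 4 * W)) => s /andP[s0 s1].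
  pose n := (Num.truncn s^-1).+2.
  have n1 : s^-1 < n%:R by rewrite (lt_le_trans (truncnS_gt _))// ler_nat.
  have n0 : 0 < n%:R :> R by rewrite ltr0n.
  have W0 : 0 <= 2 * C ^+ 2 * pi ^+ 4 * W.
    apply: mulr_ge0; last by apply: Rintegral_ge0 => z _; exact: pb0.
    by rewrite mulr_ge0 ?exprn_ge0 ?pi_ge0// mulr_ge0 ?sqr_ge0.
  rewrite (le_trans (step n isT))// lerD2l ler_wpM2r//.
  have ns : n%:R^-1 <= s by rewrite -[s]invrK lef_pV2 ?posrE ?invr_gt0// ltW.
  rewrite (le_trans _ ns)// expr2 ler_piMl// ?invr_ge0 ?(ltW n0)//.
  by rewrite (le_trans ns)// ltW.
have := pair_moment mg gK; rewrite -/Q -/S => QS.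
have p0 : 0 <= 2 * (pi : R) ^+ 2 by rewrite mulr_ge0 ?sqr_ge0.
have := ler_wpM2l (ler0n R d) EQ; have := ler_wpM2l p0 QS; lra.
Qed.

(** A quarter turn exchanges [|x|] and [|y|]. *)
Lemma pair_moment_swap :
  \int[mm]_z (enorm z.2 ^+ 2 * pair_ball z) = \int[mm]_z (enorm z.1 ^+ 2 * pair_ball z).
Proof.
have cs : (0 : R) ^+ 2 + 1 ^+ 2 = 1 by rewrite expr0n expr1n add0r.
have m1 : measurable_fun setT (fun z : V * V => enorm z.1 ^+ 2 * pair_ball z).
  apply: measurable_funM; last exact: measurable_pair_ball.
  by apply: measurable_funX; exact: (measurableT_comp measurable_enorm measurable_fst).
rewrite -[RHS](Rintegral_rot cs (oner_neq0 _))// => [|z]; last by rewrite mulr_ge0 ?sqr_ge0.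
apply: eq_Rintegral => z _; rewrite pair_ball_rot//; congr (_ ^+ 2 * _).
by rewrite /pair_rot/= scale0r add0r scale1r.
Qed.

(** The factor relating integrals of 2-homogeneous functions over the unit
    balls of [R^(2d)] and of [R^d]. *)
Definition slice_factor (y : V) : R := Num.sqrt (1 - enorm y ^+ 2) ^+ (d + 2).

Lemma measurable_slice_factor : measurable_fun setT slice_factor.
Proof.
apply: measurable_funX.
have ms : measurable_fun setT (Num.sqrt : R -> R).
  by apply: continuous_measurable_fun; exact: sqrt_continuous.
apply: (measurableT_comp ms); apply: measurable_funB => //.
by apply: measurable_funX; exact: measurable_enorm.
Qed.

Lemma slice_factor_ge0 y : 0 <= slice_factor y.
Proof. by rewrite exprn_ge0// sqrtr_ge0. Qed.

Lemma slice_factor_le y : slice_factor y <= ball_indic 1 y.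
Proof.
rewrite ball_indicE /slice_factor; have [y1|y1] := leP (enorm y) 1.
  apply: exprn_ile1; first exact: sqrtr_ge0.
  by rewrite -[leRHS]sqrtr1 ler_sqrt// lerBlDr lerDl sqr_ge0.
rewrite ler0_sqrtr ?addn2 ?expr0n// subr_le0 -[leLHS](expr1n _ 2) lerXn2r ?nnegrE ?enorm_ge0//.
exact: ltW.
Qed.

Lemma slice_factor_half y : 2^-1 ^+ (d + 2) * ball_indic 2^-1 y <= slice_factor y.
Proof.
rewrite ball_indicE; have [y1|_] := leP (enorm y) 2^-1; last first.
  by rewrite mulr0 slice_factor_ge0.
rewrite mulr1 lerXn2r ?nnegrE ?sqrtr_ge0 ?invr_ge0//.
have y2 : enorm y ^+ 2 <= 2^-1 ^+ 2 by rewrite lerXn2r ?nnegrE ?enorm_ge0 ?invr_ge0.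
rewrite -[2^-1]ger0_norm ?invr_ge0// -sqrtr_sqr ler_sqrt; lra.
Qed.

Let K2 := \int[m]_y slice_factor y.

Lemma slice_constant_fin : (\int[m]_y (slice_factor y)%:E = K2%:E)%E.
Proof.
rewrite /K2 /Rintegral fineK//; apply: integrable_fin_num => //.
apply: bounded_support_integrable; split; first exact: measurable_slice_factor.
by exists 1, 1 => y; rewrite mul1r ger0_norm ?slice_factor_ge0 ?slice_factor_le.
Qed.

Lemma slice_constant_gt0 : 0 < K2.
Proof.
have h : 0 < (2^-1 : R) by rewrite invr_gt0.
apply: (@lt_le_trans _ _ (\int[m]_y (2^-1 ^+ (d + 2) * @ball_indic R d 2^-1 y))).
  rewrite RintegralZl//; last first.
    by apply: bounded_support_integrable; exact: bounded_support_ball_indic.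
  by rewrite Rintegral_ball_indic// !mulr_gt0 ?exprn_gt0// ball_volume_gt0.
apply: le_Rintegral => //.
- by apply: bounded_support_integrable; exact: (bounded_supportZ _ (bounded_support_ball_indic _)).
- apply: bounded_support_integrable; split; first exact: measurable_slice_factor.
  by exists 1, 1 => y; rewrite mul1r ger0_norm ?slice_factor_ge0 ?slice_factor_le.
- by move=> y _; exact: slice_factor_half.
Qed.

(** For fixed [y], the slice of the unit ball of pairs is a ball of radius
    [r = sqrt (1 - |y|^2)], over which the integral of [Phi] scales as [r^(d + 2)]. *)
Lemma pair_integral_homogeneous (Phi : V -> R) : measurable_fun setT Phi ->
  (forall x, 0 <= Phi x) -> (forall r x, 0 <= r -> Phi (r *: x) = r ^+ 2 * Phi x) ->
  \int[mm]_z (Phi z.1 * pair_ball z) = K2 * \int[m]_x (Phi x * ball_indic 1 x).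
Proof.
move=> mP P0 Pr.
have m1 : measurable_fun setT (fun z : V * V => (Phi z.1 * pair_ball z)%:E).
  apply/measurable_EFinP; apply: measurable_funM; last exact: measurable_pair_ball.
  exact: (measurableT_comp mP measurable_fst).
have mB r : measurable_fun setT (fun x : V => (Phi x * ball_indic r x)%:E).
  by apply/measurable_EFinP; apply: measurable_funM => //; exact: measurable_ball_indic.
have Phi0 : Phi 0 = 0 by have := Pr 0 0 (lexx _); rewrite scale0r expr0n mul0r.
pose I := (\int[m]_x (Phi x * ball_indic 1 x)%:E)%E.
have I0 : (0 <= I)%E by apply: integral_ge0 => x _; rewrite lee_fin mulr_ge0 ?ball_indicE.
have E : (\int[mm]_z (Phi z.1 * pair_ball z)%:E = I * K2%:E)%E.
  rewrite integral_pair2//; last by move=> z; rewrite lee_fin mulr_ge0.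
  rewrite -slice_constant_fin -ge0_integralZl//; last 2 first.
    by apply/measurable_EFinP; exact: measurable_slice_factor.
    by move=> y _; rewrite lee_fin slice_factor_ge0.
  apply: eq_integral => y _ /=.
  have [y1|y1] := ltP (enorm y) 1; last first.
    have y2 : 1 <= enorm y ^+ 2 by rewrite -[leLHS](expr1n _ 2) lerXn2r ?nnegrE ?enorm_ge0.
    rewrite integral0_eq => [|x _].
      by rewrite /slice_factor ler0_sqrtr ?subr_le0// addn2 expr0n mule0.
    rewrite /pair_ball/=; have [h|_] := leP (enorm x ^+ 2 + _) 1; last by rewrite mulr0.
    have : enorm x ^+ 2 = 0 by apply/eqP; rewrite eq_le sqr_ge0 andbT; lra.
    by move/eqP; rewrite sqrf_eq0 enorm_eq0 => /eqP ->; rewrite Phi0 mul0r.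
  set r := Num.sqrt (1 - enorm y ^+ 2).
  have y2 : enorm y ^+ 2 < 1 by rewrite expr_lt1 ?enorm_ge0.
  have r0 : 0 < r by rewrite sqrtr_gt0 subr_gt0.
  have r2 : r ^+ 2 = 1 - enorm y ^+ 2 by rewrite sqr_sqrtr// subr_ge0 ltW.
  have -> : (\int[m]_x (Phi x * pair_ball (x, y))%:E = \int[m]_x (Phi x * ball_indic r x)%:E)%E.
    apply: eq_integral => x _; congr (_ * _)%:E; rewrite /pair_ball ball_indicE/=.
    rewrite -[enorm x <= r](@ler_pXn2r _ 2)// ?nnegrE ?enorm_ge0 ?(ltW r0)// r2.
    by rewrite lerBrDr.
  have := @integral_dilation R d r _ (lt0r_neq0 r0) (mB r).
  have -> : (\int[m]_x (Phi (r *: (x : V))%R * ball_indic r (r *: (x : V))%R)%:E = (r ^+ 2)%:E * I)%E.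
    rewrite /I -ge0_integralZl_EFin//; last 2 first.
      by move=> x _; rewrite lee_fin mulr_ge0 ?ball_indicE.
      by rewrite sqr_ge0.
    apply: eq_integral => x _.
    by rewrite -{2}[r]mulr1 ball_indic_dilation// Pr ?(ltW r0)// -EFinM mulrA.
  rewrite gtr0_norm// => H; rewrite /slice_factor -/r exprD.
  have rd : 0 < r ^+ d by rewrite exprn_gt0.
  rewrite muleC EFinM -muleA H muleA -EFinM mulfV ?mul1e// gt_eqF//.
rewrite /Rintegral E -/I; case: (I) I0 => [a _| _|//] /=; first by rewrite mulrC.
by rewrite gt0_mulye ?lte_fin ?slice_constant_gt0//= mulr0.
Qed.

(** The values of [k] on the sphere are extended 1-homogeneously because the
    passage from pairs to single vectors in [pair_integral_homogeneous] needs
    homogeneity. *)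
Definition homogeneous_extension (k : V -> R) (u : V) : R := enorm u * k (dir u).

(** Oddness gives [k 0 = 0], so that [k] is bounded by [K] on the sphere. *)
Lemma homogeneous_extension_lipschitz (k : V -> R) (K : R) : (0 < d)%N ->
  elipschitz K k -> (forall u, k (- u) = - k u) ->
  elipschitz (3 * K) (homogeneous_extension k).
Proof.
move=> d0 kK kN u v; have K0 := elipschitz_ge0 d0 kK.
have k0 : k 0 = 0 by have := kN 0; rewrite oppr0; lra.
have kd w : `|k (dir w)| <= K.
  have := kK (dir w) 0; rewrite k0 !subr0 => /le_trans; apply.
  by rewrite ler_piMr// enorm_dir_le.
have scale_dir w : enorm w *: dir w = w.
  have [->|w0] := eqVneq w 0; first by rewrite enorm0 scale0r.
  by rewrite /dir scalerA divff ?enorm_eq0// scale1r.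
rewrite /homogeneous_extension.
have -> : enorm u * k (dir u) - enorm v * k (dir v) =
  (enorm u - enorm v) * k (dir u) + enorm v * (k (dir u) - k (dir v)) by ring.
rewrite (le_trans (ler_normD _ _))// !normrM (ger0_norm (enorm_ge0 v)).
have h1 : `|enorm u - enorm v| * `|k (dir u)| <= enorm (u - v) * K.
  by apply: ler_pM => //; exact: enorm_dist.
have h2 : enorm v * `|k (dir u) - k (dir v)| <= K * (2 * enorm (u - v)).
  rewrite (@le_trans _ _ (enorm v * (K * enorm (dir u - dir v))))//.
    by rewrite ler_wpM2l ?enorm_ge0.
  rewrite mulrCA ler_wpM2l// -[enorm v in leLHS](ger0_norm (enorm_ge0 v)) -enormZ.
  have -> : enorm v *: (dir u - dir v) = (enorm v - enorm u) *: dir u + (u - v).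
    by rewrite scalerBr scale_dir scalerBl scale_dir addrA subrK.
  rewrite (le_trans (enormD _ _))// enormZ mulrDl !mul1r lerD2r.
  have := enorm_dir_le u => hd.
  rewrite -[leRHS]mulr1.
  by apply: ler_pM => //; [exact: enorm_ge0|rewrite distrC enorm_dist].
lra.
Qed.

(** The 1-homogeneous extension [h] of [k] is smoothed at scale [s] so that the
    half-turn inequality applies; then [s] tends to 0. *)
Lemma odd_second_moment (c : R) (k : V -> R) (K : R) : smoothing_constant c ->
  (0 < d)%N -> 0 < K -> elipschitz K k -> (forall u, k (- u) = - k u) ->
  d%:R * \int[m]_u (k (dir u) ^+ 2 * ball_indic 1 u) <= 72 * pi ^+ 2 * K ^+ 2 * vol.
Proof.
move=> [c0 hc] d0 K0 kK kN; have K0' := ltW K0.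
pose h := homogeneous_extension k.
have hL : elipschitz (3 * K) h by exact: homogeneous_extension_lipschitz.
have K3 : 0 < 3 * K by rewrite mulr_gt0.
have mh := measurable_elipschitz hL.
have hN u : h (- u) = - h u by rewrite /h /homogeneous_extension enormN dirN kN mulrN.
have k0 : k 0 = 0 by have := kN 0; rewrite oppr0; lra.
have kd w : `|k (dir w)| <= K.
  have := kK (dir w) 0; rewrite k0 !subr0 => /le_trans; apply.
  by rewrite ler_piMr// enorm_dir_le.
have hk u : enorm u <= 1 -> `|h u| <= K.
  move=> u1; rewrite normrM (ger0_norm (enorm_ge0 u)) -[K]mul1r.
  by apply: ler_pM => //; exact: enorm_ge0.
pose S := \int[mm]_z (enorm z.2 ^+ 2 * @pair_ball R d z).
pose W := \int[mm]_z (@pair_ball R d z).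
pose H2 := \int[mm]_z (h z.1 ^+ 2 * @pair_ball R d z).
have dH : pair_dominated (fun z : V * V => h z.1 ^+ 2 * pair_ball z).
  apply: (pair_dominatedI (M := K ^+ 2)).
    by apply: measurable_funX; exact: (measurableT_comp mh measurable_fst).
  by move=> z z1 _; rewrite normrX lerXn2r// ?nnegrE// hk.
have main : 4 * (d%:R * H2) <= 36 * pi ^+ 2 * K ^+ 2 * S.
  apply: (@le_linear_perturbation _ _ _ (d%:R * (72 * K ^+ 2 * W))) => s /andP[s0 s1].
  have [dh lh] := hc d (3 * K) h s d0 K3 hL s0.
  pose g := smoothing h s.
  have gL : elipschitz (3 * K) g by exact: smoothing_lipschitz.
  have mg := measurable_elipschitz gL.
  have := poincare_half_turn (ltW K3) gL dh lh; rewrite -/S.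
  set E := \int[mm]_z _ => PE.
  have [B gB] := elipschitz_locally_bounded gL 1.
  have dE : pair_dominated (fun z : V * V => (g z.1 - g (- z.1)) ^+ 2 * pair_ball z).
    apply: (pair_dominatedI (M := (B + B) ^+ 2)).
      apply: measurable_funX; apply: measurable_funB.
        exact: (measurableT_comp mg measurable_fst).
      exact: (measurableT_comp mg (measurable_rV_opp measurable_fst)).
    move=> z z1 _; rewrite normrX lerXn2r// ?nnegrE//.
      by rewrite addr_ge0// (le_trans _ (gB 0 _))// enorm0.
    by rewrite (le_trans (ler_normB _ _))// lerD//; apply: gB; rewrite ?enormN.
  have HE : 4 * H2 <= 2 * E + 72 * K ^+ 2 * s * W.
    rewrite /H2 /E /W -!RintegralZl//; try exact: pair_dominated_integrable.
    rewrite -RintegralD//; last 2 first.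
    - by apply: pair_dominated_integrable; exact: (pair_dominatedZ _ dE).
    - by apply: pair_dominated_integrable; exact: (pair_dominatedZ _ pair_dominated_pair_ball).
    apply: le_Rintegral => //.
    - by apply: pair_dominated_integrable; exact: (pair_dominatedZ _ dH).
    - apply: pair_dominated_integrable; apply: pair_dominatedD.
        exact: (pair_dominatedZ _ dE).
      exact: (pair_dominatedZ _ pair_dominated_pair_ball).
    move=> z _; rewrite (mulrA 4 (h z.1 ^+ 2)) (mulrA 2 ((g z.1 - g (- z.1)) ^+ 2)) -mulrDl.
    rewrite ler_wpM2r//.
    have := smoothing_close d0 hL s0 z.1; have := smoothing_close d0 hL s0 (- z.1).
    rewrite -/g hN !ler_norml => /andP[a1 a2] /andP[b1 b2].
    have -> : 4 * h z.1 ^+ 2 = ((g z.1 - g (- z.1)) + (2 * h z.1 - (g z.1 - g (- z.1)))) ^+ 2.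
      by ring.
    rewrite (le_trans (sqrD_le2 _ _))// lerD2l.
    have : `|2 * h z.1 - (g z.1 - g (- z.1))| <= 6 * K * s.
      rewrite ler_norml; apply/andP; split; lra.
    move=> e; rewrite -[X in 2 * X]real_normK ?num_real//.
    have e2 : `|2 * h z.1 - (g z.1 - g (- z.1))| ^+ 2 <= (6 * K * s) ^+ 2.
      by rewrite lerXn2r// nnegrE// (le_trans _ e).
    have e3 : K ^+ 2 * s ^+ 2 <= K ^+ 2 * s.
      by rewrite ler_wpM2l ?sqr_ge0// expr2 ler_piMl// ltW.
    lra.
  have := ler_wpM2l (ler0n R d) HE; lra.
have h_hom r x : 0 <= r -> h (r *: x) ^+ 2 = r ^+ 2 * h x ^+ 2.
  move=> r0; rewrite -exprMn; congr (_ ^+ 2).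
  have [->|rn0] := eqVneq r 0.
    by rewrite scale0r mul0r /h /homogeneous_extension enorm0 mul0r.
  have rp : 0 < r by rewrite lt_neqAle eq_sym rn0.
  by rewrite /h /homogeneous_extension enormZ ger0_norm// dir_dilation// mulrA.
have HK : H2 = K2 * \int[m]_x (h x ^+ 2 * ball_indic 1 x).
  apply: (pair_integral_homogeneous (Phi := fun x => h x ^+ 2)) => //.
    exact: measurable_funX.
  by move=> x; rewrite sqr_ge0.
have SK : S = K2 * \int[m]_x (enorm x ^+ 2 * ball_indic 1 x).
  rewrite /S pair_moment_swap.
  apply: (pair_integral_homogeneous (Phi := fun x => enorm x ^+ 2)).
  - by apply: measurable_funX; exact: measurable_enorm.
  - by move=> x; rewrite sqr_ge0.
  - by move=> r x r0; rewrite enormZ ger0_norm// exprMn.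
have bS : bounded_support (fun x : V => enorm x ^+ 2 * ball_indic 1 x).
  apply: bounded_supportM; last exact: bounded_support_ball_indic.
    by apply: measurable_funX; exact: measurable_enorm.
  move=> r; exists (r ^+ 2) => u ur.
  by rewrite ger0_norm ?sqr_ge0// lerXn2r// ?nnegrE ?enorm_ge0// (le_trans (enorm_ge0 u)).
have Sv : \int[m]_x (enorm x ^+ 2 * ball_indic 1 x) <= vol.
  have <- : \int[m]_x (ball_indic 1 x : R) = vol by rewrite Rintegral_ball_indic// expr1n mul1r.
  apply: le_Rintegral => //.
  - exact: bounded_support_integrable.
  - by apply: bounded_support_integrable; exact: bounded_support_ball_indic.
  move=> x _; rewrite ball_indicE; have [x1|_] := leP (enorm x) 1.
    by rewrite mulr1 exprn_ile1 ?enorm_ge0.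
  by rewrite mulr0.
have mk : measurable_fun setT (fun u : V => k (dir u) ^+ 2).
  by apply: measurable_funX; exact: (measurableT_comp (measurable_elipschitz kK) measurable_dir).
have bk r : bounded_support (fun u : V => k (dir u) ^+ 2 * ball_indic r u).
  apply: bounded_supportM => //; last exact: bounded_support_ball_indic.
  by move=> r'; exists (K ^+ 2) => u _; rewrite normrX lerXn2r// nnegrE.
have bh : bounded_support (fun u : V => h u ^+ 2 * ball_indic 1 u).
  apply: bounded_supportM; last exact: bounded_support_ball_indic.
    exact: measurable_funX.
  move=> r; have [B hB] := elipschitz_locally_bounded hL r.
  exists (B ^+ 2) => u ur; rewrite normrX lerXn2r// ?nnegrE//; last exact: hB.
  by rewrite (le_trans _ (hB _ ur)).
pose kI := \int[m]_u (k (dir u) ^+ 2 * ball_indic 1 u).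
have kI0 : 0 <= kI.
  by apply: Rintegral_ge0 => u _; rewrite mulr_ge0 ?sqr_ge0// ball_indicE.
(* on the outer half of the ball, |u|^2 is at least 1/4, and the inner half
   carries at most half of the integral of a 0-homogeneous function *)
have low : 8^-1 * kI <= \int[m]_x (h x ^+ 2 * ball_indic 1 x).
  have half : \int[m]_u (k (dir u) ^+ 2 * ball_indic 2^-1 u) = 2^-1 ^+ d * kI.
    rewrite (@Rintegral_ball_homogeneous _ _ (fun u => k (dir u) ^+ 2))//.
    by move=> u; rewrite dir_dilation// invr_gt0.
  have d2 : 2^-1 ^+ d <= 2^-1 :> R.
    by rewrite -[leRHS]expr1 ler_wiXn2l ?invr_ge0// invf_le1// ler1n.
  apply: (@le_trans _ _ (4^-1 * (kI - 2^-1 ^+ d * kI))).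
    have : 2^-1 ^+ d * kI <= 2^-1 * kI by rewrite ler_wpM2r.
    lra.
  rewrite -half -Rintegral_bounded_supportB// -RintegralZl//; last first.
    by apply: bounded_support_integrable; exact: bounded_supportB.
  apply: le_Rintegral => //.
  - by apply: bounded_support_integrable; apply: bounded_supportZ; exact: bounded_supportB.
  - exact: bounded_support_integrable.
  move=> u _; rewrite -mulrBr /h /homogeneous_extension exprMn !ball_indicE.
  have k2 := sqr_ge0 (k (dir u)).
  have [u1|u1] := leP (enorm u) 1; have [u2|u2] := leP (enorm u) 2^-1.
  - by rewrite subrr !mulr0 mulr1 mulr_ge0 ?sqr_ge0.
  - rewrite subr0 !mulr1 ler_wpM2r//.
    have : 2^-1 ^+ 2 <= enorm u ^+ 2 by rewrite lerXn2r ?nnegrE ?enorm_ge0 ?invr_ge0// ltW.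
    lra.
  - have : 2^-1 < 1 :> R by rewrite invf_lt1// ltr1n.
    lra.
  - by rewrite subr0 !mulr0.
have Kp := slice_constant_gt0.
move: main; rewrite HK SK => main.
have {}main : 4 * (d%:R * \int[m]_x (h x ^+ 2 * ball_indic 1 x)) <=
    36 * pi ^+ 2 * K ^+ 2 * \int[m]_x (enorm x ^+ 2 * ball_indic 1 x).
  by rewrite -(ler_pM2l Kp); lra.
have p2 : 0 <= 36 * (pi : R) ^+ 2 * K ^+ 2 by rewrite mulr_ge0 ?sqr_ge0// mulr_ge0 ?sqr_ge0.
have := ler_wpM2l p2 Sv; have := ler_wpM2l (ler0n R d) low; rewrite -/kI.
lra.
Qed.

End poincare.

(** * Integration over the sphere *)
Lemma ge0_integral_mrestr {R : realType} dT (T : measurableType dT)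
    (mu : {measure set T -> \bar R}) (D : set T) (mD : measurable D) (f : T -> \bar R) :
  measurable_fun setT f -> (forall x, 0 <= f x)%E ->
  (\int[mrestr mu mD]_x f x = \int[mu]_(x in D) f x)%E.
Proof.
move=> mf f0.
have mnD : measurable (~` D) by exact: measurableC.
have nD : mrestr mu mD (~` D) = 0%E by rewrite /mrestr setICl measure0.
rewrite (@ge0_negligible_integral _ _ _ (mrestr mu mD) setT (~` D))//.
rewrite setTD setCK; apply: eq_measure_integral => A mA AD.
have H : mrestr mu mD A = mu A by rewrite /mrestr (setIidl AD).
exact: H.
Qed.

Section sphere_integrals.
Context {R : realType} {d : nat}.
Local Notation V := 'rV[R]_d.
Local Notation m := (@lebesgue_rV R d).
Local Notation vol := (@ball_volume R d).
Variable S : probability V R.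
Hypothesis d_gt0 : (0 < d)%N.
Hypothesis SE : forall A, measurable A -> S A = sphere_uniform A.

Lemma measurable_origin : measurable [set (0 : V)].
Proof.
rewrite (_ : [set 0] = eball 0 0); first exact: measurable_eball.
apply/seteqP; split=> u; rewrite /eball/= subr0; first by move=> ->; rewrite enorm0.
by move=> h; apply/eqP; rewrite -enorm_eq0 eq_le h enorm_ge0.
Qed.

(** The origin is in every ball of radius [r], of volume [O(r)] for [r <= 1]. *)
Lemma lebesgue_origin : m [set (0 : V)] = 0%E.
Proof.
apply/eqP; rewrite eq_le measure_ge0 andbT; apply/lee_addgt0Pr => e e0; rewrite add0e.
have v0 : 0 < vol by exact: ball_volume_gt0.
pose r := Num.min 1 (e / vol).
have r0 : 0 < r by rewrite lt_min ltr01 divr_gt0.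
have sub : [set (0 : V)] `<=` eball 0 r by move=> _ ->; rewrite /eball/= subr0 enorm0 ltW.
apply: (@le_trans _ _ (m (eball 0 r))).
  by apply: le_measure => //; rewrite inE; [exact: measurable_origin|exact: measurable_eball].
rewrite lebesgue_eball// lee_fin -ler_pdivlMr//.
apply: (@le_trans _ _ r); last by rewrite ge_min lexx orbT.
by rewrite -[leRHS]expr1 ler_wiXn2l ?(ltW r0)// ge_min lexx.
Qed.

(** The uniform law on the sphere is the image under [dir] of the uniform law on
    the punctured ball. *)
Lemma ge0_integral_sphere (h : V -> \bar R) : measurable_fun setT h ->
  (forall u, 0 <= h u)%E ->
  (\int[S]_u h u = (vol^-1)%:E * \int[m]_u (h (dir u) * (ball_indic 1 u)%:E))%E.
Proof.
move=> mh h0.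
have v0 : 0 < vol by exact: ball_volume_gt0.
pose D : set V := eball 0 1 `\` [set 0].
have DE y : D y <-> 0 < enorm y <= 1.
  rewrite /D /eball/= subr0; split=> [[h1 h2]|/andP[h1 h2]].
    by rewrite h1 andbT enorm_gt0; apply/eqP.
  by split=> // y0; move: h1; rewrite y0 enorm0 ltxx.
have mD : measurable D by apply: measurableD; [exact: measurable_eball|exact: measurable_origin].
have w0 : 0 <= vol^-1 by rewrite invr_ge0 ltW.
pose nu := mscale (NngNum w0) (mrestr m mD).
have mdir := @measurable_dir R d.
have SP A : measurable A -> S A = pushforward nu dir A.
  move=> mA; rewrite SE// /sphere_uniform /pushforward /nu /= /mscale /= /mrestr EFinM.
  have -> : [set y | 0 < enorm y <= 1 /\ A ((enorm y)^-1 *: y)] = dir @^-1` A `&` D.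
    by apply/seteqP; split=> y /= [h1 h2]; split=> //; apply/DE.
  rewrite fineK// ge0_fin_numE//.
  apply: le_lt_trans (@lebesgue_eball_lty R d 1).
  apply: le_measure; rewrite ?inE; [|exact: measurable_eball|by move=> y [_ []]].
  by apply: measurableI => //; rewrite -[X in measurable X]setTI; exact: mdir.
pose nu' : {measure set V -> \bar R} :=
  measure_function_pushforward__canonical__measure_function_Measure nu mdir.
rewrite (@eq_measure_integral _ _ _ setT nu' S); last by move=> A mA _; exact: SP.
rewrite ge0_integral_pushforward//.
rewrite preimage_setT.
have h0d u : setT u -> (0 <= (h \o dir) u)%E by move=> _; exact: h0.
have mhd : measurable_fun setT (h \o dir) by exact: measurableT_comp.
rewrite ge0_integral_mscale//.
congr (_ * _)%E.
rewrite ge0_integral_mrestr//; last by move=> x; exact: h0.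
have -> : (\int[m]_(x in D) (h \o dir) x = \int[m]_(x in eball 0 1) (h \o dir) x)%E.
  apply: esym; apply: ge0_negligible_integral => //.
  - exact: measurable_origin.
  - exact: measurable_eball.
  - exact: measurable_funTS.
  - by move=> x _; exact: h0.
  - exact: lebesgue_origin.
rewrite integral_mkcond; apply: eq_integral => u _.
rewrite patchE /ball_indic indicE; case: ifP => _; first by rewrite mule1.
by rewrite mule0.
Qed.

Lemma integral_sphere (phi : V -> R) : measurable_fun setT phi ->
  bounded_support (fun u => phi (dir u) * ball_indic 1 u) ->
  (\int[S]_u (phi u)%:E =
   (vol^-1 * \int[m]_u (phi (dir u) * ball_indic 1 u))%R%:E)%E.
Proof.
move=> mphi bphi; have := bounded_support_integrable bphi => iphi.
have mE : measurable_fun setT (EFin \o phi) by exact/measurable_EFinP.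
rewrite integralE !ge0_integral_sphere//; last 2 first.
- exact: measurable_funeneg.
- exact: measurable_funepos.
rewrite /Rintegral EFinM fineK; last exact: integrable_fin_num.
rewrite [in RHS]integralE [RHS]muleBr//; last first.
  apply: fin_num_adde_defl; rewrite fin_numN; apply: integrable_fin_num => //.
  exact: integrable_funeneg.
congr (_ * _ - _ * _)%E; apply: eq_integral => u _; rewrite ?funeposE ?funenegE /= ball_indicE;
  case: leP => _; rewrite ?mulr1 ?mule1// mulr0 mule0 ?oppe0 ?oppr0 maxxx//.
Qed.

End sphere_integrals.

(** * The objective *)
Section objective_facts.
Context {R : realType} {d : nat} {dX : measure_display} {Xi : measurableType dX}.
Local Notation V := 'rV[R]_d.
Variables (P : probability Xi R) (F : V -> Xi -> R) (L : Xi -> R) (G : R).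
Hypotheses (d_gt0 : (0 < d)%N) (G_gt0 : 0 < G).
Hypothesis F_int : forall x, P.-integrable [set: Xi] (fun xi => (F x xi)%:E).
Hypothesis L_meas : measurable_fun [set: Xi] L.
Hypothesis FL : forall xi, elipschitz (L xi) (fun x => F x xi).
Hypothesis L2 : ('E_P[fun xi => (L xi ^+ 2)%R] <= (G ^+ 2)%R%:E)%E.
Local Notation f := (objective P F).

Lemma lipschitz_constant_ge0 xi : 0 <= L xi.
Proof. exact: elipschitz_ge0 (FL xi). Qed.

Lemma measurable_oracle x : measurable_fun setT (F x).
Proof. by apply/measurable_EFinP; have /integrableP[] := F_int x. Qed.

Lemma measurable_oracle_pair : measurable_fun setT (fun p : V * Xi => F p.1 p.2).
Proof. exact: measurable_lipschitz_pair measurable_oracle L_meas FL. Qed.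

Lemma measurable_oracle_comp dT (T : measurableType dT) (a : T -> V) (b : T -> Xi) :
  measurable_fun setT a -> measurable_fun setT b ->
  measurable_fun setT (fun t => F (a t) (b t)).
Proof.
move=> ma mb.
rewrite (_ : (fun t => _) = (fun p : V * Xi => F p.1 p.2) \o (fun t => (a t, b t)))//.
apply: (measurableT_comp measurable_oracle_pair).
exact: measurable_fun_pair.
Qed.

Lemma integral_lipschitz_constant2 : (\int[P]_xi (L xi ^+ 2)%:E <= (G ^+ 2)%:E)%E.
Proof. by move: L2; rewrite unlock. Qed.

Lemma integrable_lipschitz_constant2 : P.-integrable setT (fun xi => (L xi ^+ 2)%:E).
Proof.
apply/integrableP; split; first by apply/measurable_EFinP; exact: measurable_funX.
rewrite (eq_integral (fun xi => (L xi ^+ 2)%:E)) => [|xi _].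
  exact: le_lt_trans integral_lipschitz_constant2 (ltry _).
by rewrite gee0_abs// lee_fin sqr_ge0.
Qed.

(** The inequality [2 a b <= a^2 + b^2] bounds the mean of [L] by its second
    moment. *)
Lemma lipschitz_constant_amgm xi : L xi <= G^-1 / 2 * L xi ^+ 2 + G / 2.
Proof.
have e : G^-1 * (L xi - G) ^+ 2 = G^-1 * L xi ^+ 2 - 2 * L xi + G.
  by field; rewrite gt_eqF.
have : 0 <= G^-1 * (L xi - G) ^+ 2 by rewrite mulr_ge0 ?sqr_ge0// invr_ge0 ltW.
rewrite e; lra.
Qed.

Lemma integrable_lipschitz_constant : P.-integrable setT (EFin \o L).
Proof.
have I : P.-integrable setT (fun xi => (G^-1 / 2 * L xi ^+ 2 + G / 2)%:E).
  under [X in _.-integrable _ X]funext do rewrite EFinD EFinM.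
  apply: integrableD => //; last exact: finite_measure_integrable_cst.
  exact: integrableZl integrable_lipschitz_constant2.
apply: (le_integrable _ _ _ I) => //; first exact/measurable_EFinP.
move=> xi _ /=; rewrite lee_fin !ger0_norm ?lipschitz_constant_amgm ?lipschitz_constant_ge0//.
by rewrite (le_trans _ (lipschitz_constant_amgm xi)) ?lipschitz_constant_ge0.
Qed.

(** [E L <= (E L^2 / G + G) / 2 <= G]. *)
Lemma integral_lipschitz_constant : (\int[P]_xi (L xi)%:E <= G%:E)%E.
Proof.
apply: (@le_trans _ _ (\int[P]_xi (G^-1 / 2 * L xi ^+ 2 + G / 2)%:E)%E).
  apply: ge0_le_integral => //.
  - by move=> xi _; rewrite lee_fin lipschitz_constant_ge0.
  - exact/measurable_EFinP.
  - apply/measurable_EFinP; apply: measurable_funD => //; apply: measurable_funM => //.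
    exact: measurable_funX.
  - by move=> xi _; rewrite lee_fin lipschitz_constant_amgm.
under eq_integral do rewrite EFinD EFinM.
have G2 : 0 <= G^-1 / 2 by rewrite divr_ge0// invr_ge0 ltW.
rewrite integralD//; last 2 first.
- exact: integrableZl integrable_lipschitz_constant2.
- exact: finite_measure_integrable_cst.
rewrite integral_cst// [X in (_ * X)%E]probability_setT mule1.
rewrite integralZl//; last exact: integrable_lipschitz_constant2.
apply: (@le_trans _ _ ((G^-1 / 2)%:E * (G ^+ 2)%:E + (G / 2)%:E)%E).
  by rewrite leeD2r// lee_wpmul2l ?lee_fin// integral_lipschitz_constant2.
rewrite -EFinM -EFinD lee_fin le_eqVlt; apply/orP; left; apply/eqP.
by field; rewrite gt_eqF.
Qed.

Lemma objectiveE x : (\int[P]_xi (F x xi)%:E = (f x)%:E)%E.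
Proof. by rewrite /objective unlock fineK//; exact: integrable_fin_num. Qed.

Lemma objective_lipschitz : elipschitz G f.
Proof.
move=> x y; rewrite -lee_fin -abse_EFin EFinB -!objectiveE -integralB_EFin//; [|exact: F_int..].
apply: le_trans (le_abse_integral _ _ _) _ => //.
  have := integrableB measurableT (F_int x) (F_int y).
  by move=> /integrableP[].
apply: (@le_trans _ _ (\int[P]_xi ((enorm (x - y))%:E * (L xi)%:E))%E).
  apply: ge0_le_integral => //.
  - apply: measurableT_comp => //; have := integrableB measurableT (F_int x) (F_int y).
    by move=> /integrableP[].
  - by apply: emeasurable_funM => //; exact/measurable_EFinP.
  - by move=> xi _; rewrite -EFinB -EFinM abse_EFin lee_fin mulrC; exact: FL.
rewrite integralZl//; last exact: integrable_lipschitz_constant.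
rewrite muleC EFinM lee_wpmul2r ?lee_fin ?enorm_ge0//.
exact: integral_lipschitz_constant.
Qed.

End objective_facts.

(** * The gradient estimator *)
Section estimator.
Context {R : realType} {d : nat} {dX : measure_display} {Xi : measurableType dX}.
Local Notation V := 'rV[R]_d.
Local Notation m := (@lebesgue_rV R d).
Local Notation vol := (@ball_volume R d).
Variables (S : probability V R) (P : probability Xi R).
Variables (F : V -> Xi -> R) (L : Xi -> R) (c G delta : R).
Hypotheses (d_gt0 : (0 < d)%N) (G_gt0 : 0 < G) (delta_gt0 : 0 < delta).
Hypothesis c_smoothing : smoothing_constant c.
Hypothesis SE : forall A, measurable A -> S A = sphere_uniform A.
Hypothesis F_int : forall x, P.-integrable [set: Xi] (fun xi => (F x xi)%:E).
Hypothesis L_meas : measurable_fun [set: Xi] L.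
Hypothesis FL : forall xi, elipschitz (L xi) (fun x => F x xi).
Hypothesis L2 : ('E_P[fun xi => (L xi ^+ 2)%R] <= (G ^+ 2)%R%:E)%E.
Local Notation f := (objective P F).
Local Notation fd := (smoothing f delta).
Local Notation SP := (S \x P)%E.
Local Notation ghat := (sgfm_grad F delta).

Let fG : elipschitz G f.
Proof. exact: objective_lipschitz L2. Qed.

Lemma sgfm_gradE x w xi : ghat x w xi =
  (d%:R / (2 * delta) * (F (x + delta *: w) xi - F (x - delta *: w) xi)) *: w.
Proof. by []. Qed.

Lemma measurable_sgfm_grad dT (T : measurableType dT) (a w : T -> V) (b : T -> Xi) :
  measurable_fun setT a -> measurable_fun setT w -> measurable_fun setT b ->
  measurable_fun setT (fun t => ghat (a t) (w t) (b t)).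
Proof.
move=> ma mw mb.
have mdw : measurable_fun setT (fun t => delta *: w t) by exact: measurable_rV_scale.
apply: measurable_rV_scale => //; apply: measurable_funM => //.
apply: measurable_funB; apply: (measurable_oracle_comp F_int L_meas FL) => //.
  exact: measurable_rV_add.
by apply: measurable_rV_add => //; exact: measurable_rV_opp.
Qed.

Let mghat x : measurable_fun setT (fun p : V * Xi => ghat x p.1 p.2).
Proof. exact: measurable_sgfm_grad. Qed.

Let difference_lipschitz x xi : elipschitz (2 * delta * L xi)
  (fun u => F (x + delta *: u) xi - F (x - delta *: u) xi).
Proof.
move=> u v; have := FL xi (x + delta *: u) (x + delta *: v).
have := FL xi (x - delta *: v) (x - delta *: u).
have -> : x - delta *: v - (x - delta *: u) = delta *: (u - v).
  by rewrite opprD opprK addrACA subrr add0r scalerBr addrC.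
have -> : x + delta *: u - (x + delta *: v) = delta *: (u - v).
  by rewrite opprD addrACA subrr add0r scalerBr.
rewrite enormZ (gtr0_norm delta_gt0) !ler_norml => /andP[a1 a2] /andP[b1 b2].
by apply/andP; split; lra.
Qed.

Let difference_odd x xi u :
  F (x + delta *: (- u)) xi - F (x - delta *: (- u)) xi =
  - (F (x + delta *: u) xi - F (x - delta *: u) xi).
Proof. by rewrite scalerN opprK opprB. Qed.

(** For a fixed sample, [ghat] is a multiple of an odd Lipschitz function of the
    direction, so that its second moment is [O(d L^2)] instead of the trivial
    [d^2 L^2]. *)
Lemma sphere_second_moment x xi :
  (\int[S]_w (enorm (ghat x w xi) ^+ 2)%:E <=
     (72 * pi ^+ 2 * d%:R * L xi ^+ 2)%:E)%E.
Proof.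
pose k u := F (x + delta *: u) xi - F (x - delta *: u) xi.
have kL : elipschitz (2 * delta * L xi) k by exact: difference_lipschitz.
have v0 : 0 < vol by exact: ball_volume_gt0.
have mg : measurable_fun setT (fun w : V => ghat x w xi).
  exact: measurable_sgfm_grad.
have mg2 : measurable_fun setT (fun w : V => (enorm (ghat x w xi) ^+ 2)%:E).
  apply/measurable_EFinP; apply: measurable_funX.
  exact: (measurableT_comp (@measurable_enorm R d) mg).
rewrite (ge0_integral_sphere d_gt0 SE)//; last by move=> u; rewrite lee_fin sqr_ge0.
have k0 : k 0 = 0 by rewrite /k !scaler0 subr0 addr0 subrr.
have kd u : `|k (dir u)| <= 2 * delta * L xi.
  have := kL (dir u) 0; rewrite k0 !subr0 => /le_trans; apply.
  by rewrite ler_piMr ?enorm_dir_le// (elipschitz_ge0 d_gt0 kL).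
have bk : bounded_support (fun u : V => k (dir u) ^+ 2 * ball_indic 1 u).
  apply: bounded_supportM; last exact: bounded_support_ball_indic.
    apply: measurable_funX.
    exact: (measurableT_comp (measurable_elipschitz kL) (@measurable_dir R d)).
  move=> r; exists ((2 * delta * L xi) ^+ 2) => u _.
  by rewrite normrX lerXn2r// nnegrE (elipschitz_ge0 d_gt0 kL).
have bkZ := bounded_supportZ ((d%:R / (2 * delta)) ^+ 2) bk.
have ik : d%:R * \int[m]_u (k (dir u) ^+ 2 * ball_indic 1 u) <=
    72 * pi ^+ 2 * (2 * delta * L xi) ^+ 2 * vol.
  have [L0|L0] := eqVneq (L xi) 0.
    rewrite (_ : (fun u => _) = cst 0); last first.
      apply/funext => u; have := kd u; rewrite L0 mulr0 normr_le0 => /eqP ->.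
      by rewrite expr0n mul0r.
    by rewrite Rintegral_cst// mul0r mulr0 L0 mulr0 expr0n mulr0 mul0r.
  apply: (odd_second_moment c_smoothing d_gt0 _ kL); last exact: difference_odd.
  by rewrite !mulr_gt0// lt_neqAle eq_sym L0 (elipschitz_ge0 d_gt0 (FL xi)).
apply: (@le_trans _ _ ((vol^-1)%:E *
   \int[m]_u ((d%:R / (2 * delta)) ^+ 2 * (k (dir u) ^+ 2 * ball_indic 1 u))%:E)%E).
  rewrite lee_pmul2l// ?lte_fin ?invr_gt0//.
  apply: ge0_le_integral => //.
  - by move=> u _; rewrite mule_ge0 ?lee_fin ?sqr_ge0// ball_indicE.
  - apply: emeasurable_funM; last by apply/measurable_EFinP; exact: measurable_ball_indic.
    exact: (measurableT_comp mg2 (@measurable_dir R d)).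
  - by apply/measurable_EFinP; have [] := bkZ.
  move=> u _; rewrite -EFinM lee_fin mulrA ler_wpM2r ?ball_indicE//.
  rewrite sgfm_gradE enormZ exprMn real_normK ?num_real// exprMn.
  rewrite -exprMn ler_piMr ?sqr_ge0//.
  by rewrite exprn_ile1 ?enorm_ge0 ?enorm_dir_le.
rewrite -[X in (_ * X <= _)%E]fineK; last first.
  by apply: integrable_fin_num => //; exact: bounded_support_integrable bkZ.
rewrite -/(Rintegral _ _ _) -EFinM lee_fin RintegralZl//; last first.
  exact: bounded_support_integrable.
rewrite mulrC ler_pdivrMr//.
have := ler_wpM2l _ ik => /(_ (d%:R / (2 * delta) ^+ 2)) H.
apply: le_trans (_ : _ <= d%:R / (2 * delta) ^+ 2 * (72 * pi ^+ 2 * (2 * delta * L xi) ^+ 2 * vol)) _.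
  rewrite (_ : (d%:R / (2 * delta)) ^+ 2 * _ = d%:R / (2 * delta) ^+ 2 *
    (d%:R * \int[m]_u (k (dir u) ^+ 2 * ball_indic 1 u))); last by field; rewrite gt_eqF.
  by apply: H; rewrite divr_ge0// sqr_ge0.
rewrite le_eqVlt; apply/orP; left; apply/eqP; field; rewrite gt_eqF//.
Qed.

Let mg2 x : measurable_fun setT (fun z : V * Xi => (enorm (ghat x z.1 z.2) ^+ 2)%:E).
Proof.
apply/measurable_EFinP; apply: measurable_funX.
exact: (measurableT_comp (@measurable_enorm R d) (mghat x)).
Qed.

Lemma second_moment x :
  (\int[SP]_z (enorm (ghat x z.1 z.2) ^+ 2)%:E <= (72 * pi ^+ 2 * d%:R * G ^+ 2)%:E)%E.
Proof.
have p0 : 0 <= 72 * (pi : R) ^+ 2 * d%:R by rewrite mulr_ge0// mulr_ge0// sqr_ge0.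
rewrite fubini_tonelli2//; last by move=> z; rewrite lee_fin sqr_ge0.
apply: (@le_trans _ _ (\int[P]_xi ((72 * pi ^+ 2 * d%:R)%:E * (L xi ^+ 2)%:E)%E)%E).
  apply: ge0_le_integral => //.
  - by move=> xi _; apply: integral_ge0 => w _; rewrite lee_fin sqr_ge0.
  - by apply: (measurable_fun_fubini_tonelli_G (m1 := S) _ (mg2 x)) => z; rewrite lee_fin sqr_ge0.
  - by apply: emeasurable_funM => //; apply/measurable_EFinP; exact: measurable_funX.
  by move=> xi _; rewrite -EFinM; exact: sphere_second_moment.
rewrite ge0_integralZl_EFin//; last 2 first.
- by move=> xi _; rewrite lee_fin sqr_ge0.
- by apply/measurable_EFinP; exact: measurable_funX.
by rewrite [leRHS]EFinM lee_wpmul2l ?lee_fin// (integral_lipschitz_constant2 L2).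
Qed.

Lemma integrable_second_moment x :
  SP.-integrable setT (fun z : V * Xi => (enorm (ghat x z.1 z.2) ^+ 2)%:E).
Proof.
apply/integrableP; split=> //.
rewrite (eq_integral (fun z : V * Xi => (enorm (ghat x z.1 z.2) ^+ 2)%:E)) => [|z _].
  exact: le_lt_trans (second_moment x) (ltry _).
by rewrite gee0_abs// lee_fin sqr_ge0.
Qed.

Lemma product_probability : SP setT = 1%E.
Proof.
by rewrite -setXTT product_measure1E// [X in (X * _)%E]probability_setT
  [X in (_ * X)%E]probability_setT mule1.
Qed.

Lemma integrable_cst_product (a : R) : SP.-integrable setT (cst a%:E).
Proof.
apply/integrableP; split=> //; rewrite integral_cst//= product_probability mule1.
exact: ltry.
Qed.

Lemma integral_cst_product (a : R) : (\int[SP]_z cst a%:E z = a%:E)%E.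
Proof. by rewrite integral_cst//= product_probability mule1. Qed.

Lemma integrable_estimator x v :
  SP.-integrable setT (fun z : V * Xi => (dotv v (ghat x z.1 z.2))%:E).
Proof.
have I := integrableZl measurableT (enorm v)
  (integrableD measurableT (integrable_second_moment x) (integrable_cst_product 1)).
apply: le_integrable I => //.
  by apply/measurable_EFinP; apply: measurable_dotv => //.
move=> z _; rewrite /cst -!EFinD -!EFinM !abse_EFin lee_fin.
rewrite (le_trans (normr_dotv_le _ _))// normrM (ger0_norm (enorm_ge0 v)).
rewrite ler_wpM2l ?enorm_ge0// ger0_norm ?addr_ge0 ?sqr_ge0//.
set t := enorm _; have t0 : 0 <= t by exact: enorm_ge0.
have := sqr_ge0 (t - 1); rewrite (_ : (t - 1) ^+ 2 = t ^+ 2 - 2 * t + 1); last by ring.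
lra.
Qed.

(** Averaging over the sample replaces [F] by [f]; then the reflection [w -> - w]
    identifies the two halves of the central difference, and their common value
    is the surface integral of [smoothing_gradientE]. *)
Lemma mean_estimator x v : differentiable fd x ->
  (\int[SP]_z (dotv v (ghat x z.1 z.2))%:E = (dotv v (gradient fd x))%:E)%E.
Proof.
move=> dfd; rewrite -integral12_prod_meas1; last exact: integrable_estimator.
pose phi w := d%:R / (2 * delta) * (f (x + delta *: w) - f (x - delta *: w)) * dotv v w.
rewrite (eq_integral (fun w => (phi w)%:E)) => [|w _]; last first.
  rewrite /fubini_F /=.
  under eq_integral => xi _.
    rewrite sgfm_gradE dotvZr mulrAC EFinM EFinB; over.
  rewrite integralZl//; last exact: integrableB.
  by rewrite integralB// !(objectiveE F_int) -EFinB -EFinM /phi mulrAC.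
have mf := measurable_elipschitz fG.
have mplus (g : V -> V) : measurable_fun setT g ->
    measurable_fun setT (fun u => f (x + delta *: g u)).
  move=> mg'; apply: (measurableT_comp mf).
  by apply: measurable_rV_add => //; exact: measurable_rV_scale.
have mphi : measurable_fun setT phi.
  apply: measurable_funM; last exact: measurable_dotv.
  apply: measurable_funM => //; apply: measurable_funB; first exact: (mplus id).
  under eq_fun do rewrite -scalerN.
  by apply: (mplus -%R); exact: measurable_rV_opp.
pose A u := f (x + delta *: dir u) * dotv (dir u) v * ball_indic 1 u.
have mdir := @measurable_dir R d.
have bA : bounded_support A.
  apply: bounded_supportM; last exact: bounded_support_ball_indic.
    by apply: measurable_funM; [exact: mplus|exact: measurable_dotv].
  move=> r; exists ((`|f x| + G * delta) * enorm v) => u _; rewrite normrM.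
  apply: ler_pM => //; last first.
    by rewrite (le_trans (normr_dotv_le _ _))// ler_piMl ?enorm_ge0 ?enorm_dir_le.
  rewrite -lerBlDl (le_trans (lerB_dist _ _))// (le_trans (fG _ _))//.
  rewrite addrAC subrr add0r enormZ gtr0_norm// ler_wpM2l ?(ltW G_gt0)//.
  by rewrite ler_piMr ?enorm_dir_le// ltW.
have [mA _] := bA.
have bA' : bounded_support (fun u => A (- u)).
  have [mA' [M [r hM]]] := bA.
  split; first exact: (measurableT_comp mA (measurable_rV_opp (@measurable_id _ _ setT))).
  by exists M, r => u; have := hM (- u); rewrite !ball_indicE enormN.
have E u : phi (dir u) * ball_indic 1 u = d%:R / (2 * delta) * (A u + A (- u)).
  rewrite /phi /A dirN dotvNl scalerN !ball_indicE enormN (dotvC v); ring.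
have bE : bounded_support (fun u => phi (dir u) * ball_indic 1 u).
  under [X in bounded_support X]funext do rewrite E.
  exact: (bounded_supportZ _ (bounded_supportD bA bA')).
rewrite (integral_sphere d_gt0 SE mphi bE); congr EFin.
under eq_Rintegral do rewrite E.
rewrite RintegralZl//; last by apply: bounded_support_integrable; exact: bounded_supportD.
rewrite RintegralD//; [|exact: bounded_support_integrable..].
rewrite Rintegral_reflection// dotvC (smoothing_gradientE d_gt0 fG delta_gt0)//.
by rewrite -/A; field; rewrite !gt_eqF// ball_volume_gt0.
Qed.

(** Averaging the descent inequality at [x] over the sample turns the linear
    term into [eta |grad|^2], and the quadratic term into the second moment of
    the estimator times the Lipschitz constant of the gradient. *)
Lemma descent_step (a eta : R) x : 0 <= eta -> (forall y, a <= f y) ->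
  (\int[SP]_z (fd (x - eta *: ghat x z.1 z.2) - a)%:E +
     (eta * enorm (gradient fd x) ^+ 2)%:E <=
   (fd x - a + eta ^+ 2 * (c * G * Num.sqrt d%:R / delta) *
      (72 * pi ^+ 2 * d%:R * G ^+ 2))%:E)%E.
Proof.
move=> eta0 af; set M := c * G * _ / _.
have [c0 /(_ d G f delta d_gt0 G_gt0 fG delta_gt0)[dfd lfd]] := c_smoothing.
have M0 : 0 <= M by rewrite divr_ge0 ?(ltW delta_gt0)// mulr_ge0 ?sqrtr_ge0// mulr_ge0// ltW.
have Z0 y : 0 <= fd y - a by rewrite subr_ge0; exact: (smoothing_ge fG delta_gt0 af).
pose W (z : V * Xi) := ((fd x - a)%:E + ((- eta)%:E * (dotv (gradient fd x) (ghat x z.1 z.2))%:E +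
  (M * eta ^+ 2)%:E * (enorm (ghat x z.1 z.2) ^+ 2)%:E))%E.
have ZW z : ((fd (x - eta *: ghat x z.1 z.2) - a)%:E <= W z)%E.
  rewrite /W -!EFinM -!EFinD lee_fin.
  have := descent x (- (eta *: ghat x z.1 z.2)) dfd lfd.
  rewrite dotvNr dotvZr enormN enormZ exprMn (ger0_norm eta0) ler_norml => /andP[_].
  by rewrite -/M; lra.
have i1 := integrable_cst_product (fd x - a).
have i2 := integrableZl measurableT (- eta) (integrable_estimator x (gradient fd x)).
have i3 := integrableZl measurableT (M * eta ^+ 2) (integrable_second_moment x).
have i23 := integrableD measurableT i2 i3.
have mfd : measurable_fun setT fd.
  exact: measurable_elipschitz (smoothing_lipschitz fG delta_gt0).
apply: (@le_trans _ _ (\int[SP]_z W z + (eta * enorm (gradient fd x) ^+ 2)%:E)%E).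
  rewrite leeD2r//; apply: ge0_le_integral => //.
  - by move=> z _; rewrite lee_fin.
  - apply/measurable_EFinP; apply: measurable_funB => //.
    apply: (measurableT_comp mfd); apply: measurable_rV_add => //.
    by apply: measurable_rV_opp; exact: measurable_rV_scale.
  - by have /integrableP[] := integrableD measurableT i1 i23.
rewrite /W integralD// integralD// !integralZl//; last 2 first.
- exact: integrable_second_moment.
- exact: integrable_estimator.
rewrite mean_estimator// integral_cst_product.
have fA := integrable_fin_num (measurableT) (integrable_second_moment x).
have hA := second_moment x; move: hA; rewrite -(fineK fA).
set A := fine _; rewrite lee_fin => hA.
rewrite -!EFinM -!EFinD lee_fin -enorm_sq.
have : M * eta ^+ 2 * A <= M * eta ^+ 2 * (72 * pi ^+ 2 * d%:R * G ^+ 2).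
  by rewrite ler_wpM2l// mulr_ge0// sqr_ge0.
lra.
Qed.

End estimator.

(** * Independence of the iterates from the future samples *)
Section product_uniqueness.
Context {R : realType} d1 d2 (T1 : measurableType d1) (T2 : measurableType d2).

Lemma measure_prod_unique (m1 m2 : {measure set (T1 * T2) -> \bar R}) :
  (m1 setT < +oo)%E ->
  (forall A B, measurable A -> measurable B -> m1 (A `*` B) = m2 (A `*` B)) ->
  forall M, measurable M -> m1 M = m2 M.
Proof.
move=> m1oo m12.
apply: (measure_unique [set A `*` B | A in measurable & B in measurable] (fun=> setT)).
- exact: measurable_prod_measurableType.
- move=> _ _ [A mA [B mB <-]] [A' mA' [B' mB' <-]].
  exists (A `&` A'); first exact: measurableI.
  exists (B `&` B'); first exact: measurableI.
  by rewrite setXI.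
- by move=> _; exists setT => //; exists setT => //; rewrite setXTT.
- by rewrite bigcup_const.
- by move=> _ [A mA [B mB <-]]; exact: m12.
- by move=> _.
Qed.

End product_uniqueness.

Section triple_uniqueness.
Context {R : realType} d1 d2 d3 (T1 : measurableType d1) (T2 : measurableType d2)
  (T3 : measurableType d3).

(** Rectangles are determined in two stages: for a fixed first side, both
    measures induce measures on the product of the last two factors. *)
Lemma measure_triple_unique (m1 m2 : {measure set (T1 * (T2 * T3)) -> \bar R}) :
  (m1 setT < +oo)%E ->
  (forall A B C, measurable A -> measurable B -> measurable C ->
    m1 (A `*` (B `*` C)) = m2 (A `*` (B `*` C))) ->
  forall M, measurable M -> m1 M = m2 M.
Proof.
move=> m1oo m12; apply: measure_prod_unique => // A M mA mM.
have mAT : measurable (A `*` [set: T2 * T3]) by exact: measurableX.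
have ms : measurable_fun setT (@snd T1 (T2 * T3)) by exact: measurable_snd.
pose s (mu : {measure set (T1 * (T2 * T3)) -> \bar R}) : {measure set (T2 * T3) -> \bar R} :=
  measure_function_pushforward__canonical__measure_function_Measure (mrestr mu mAT) ms.
have sE (mu : {measure set (T1 * (T2 * T3)) -> \bar R}) E : s mu E = mu (A `*` E).
  rewrite /s /= /pushforward /mrestr; congr (mu _).
  by apply/seteqP; split=> -[x y] /=; [move=> [? []]|move=> []].
rewrite -!sE; apply: measure_prod_unique => //.
  rewrite sE; apply: le_lt_trans m1oo.
  by apply: le_measure => //; rewrite inE.
by move=> B C mB mC; rewrite !sE; exact: m12.
Qed.

End triple_uniqueness.

Section joint_law.
Context {R : realType} d0 d1 d2 d3 (T0 : measurableType d0) (T1 : measurableType d1)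
  (T2 : measurableType d2) (T3 : measurableType d3).
Variables (Q : probability T0 R) (X : {mfun T0 >-> T1}) (Y : {mfun T0 >-> T2})
  (Z : {mfun T0 >-> T3}) (S : probability T2 R) (P : probability T3 R).
Hypothesis law : forall A B C, measurable A -> measurable B -> measurable C ->
  Q ((fun o => (X o, (Y o, Z o))) @^-1` (A `*` (B `*` C))) =
  (Q (X @^-1` A) * (S B * P C))%E.

Lemma integral_independent (H : T1 * (T2 * T3) -> \bar R) : measurable_fun setT H ->
  (forall z, 0 <= H z)%E ->
  (\int[Q]_o H (X o, (Y o, Z o)) = \int[Q]_o \int[S \x P]_z H (X o, z))%E.
Proof.
move=> mH H0.
have ms : measurable_fun setT (fun o => (X o, (Y o, Z o))).
  by apply: measurable_fun_pair => //; exact: measurable_fun_pair.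
have E := @ge0_integral_pushforward _ _ _ _ R _ ms Q setT H measurableT mH (fun z _ => H0 z).
rewrite preimage_setT in E; rewrite -[LHS]E.
pose mu : probability T1 R := distribution Q X.
pose prod_prob := lebesgue_integral_fubini_product_measure1__canonical__probability_measure_Probability.
pose SP := prod_prob _ _ _ _ R S P.
pose m1 : {measure set (T1 * (T2 * T3)) -> \bar R} :=
  measure_function_pushforward__canonical__measure_function_Measure Q ms.
pose m2 : {measure set (T1 * (T2 * T3)) -> \bar R} := prod_prob _ _ _ _ R mu SP.
have m12 M : measurable M -> m2 M = m1 M.
  move=> mM; apply: measure_triple_unique => //.
    by apply: le_lt_trans (ltry 1); exact: probability_le1.
  move=> A B C mA mB mC; rewrite [RHS]law//.
  have mBC : measurable (B `*` C) by exact: measurableX.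
  apply: etrans (product_measure1E mu SP mA mBC) _.
  by congr (_ * _)%E; exact: (product_measure1E S P mB mC).
have e : (\int[m1]_z H z = \int[m2]_z H z)%E.
  exact: (eq_measure_integral m2 (m1 := m1) (D := setT) (f := H) (fun M mM _ => esym (m12 M mM))).
rewrite [LHS]e; apply: etrans (fubini_tonelli1 (m1 := mu) (m2 := SP) H mH H0) _.
rewrite ge0_integral_distribution//.
  exact: (measurable_fun_fubini_tonelli_F (m2 := SP) H mH H0).
by move=> y; exact: integral_ge0.
Qed.

Lemma measurable_inner_integral (H : T1 * (T2 * T3) -> \bar R) : measurable_fun setT H ->
  (forall z, 0 <= H z)%E -> measurable_fun setT (fun o => \int[S \x P]_z H (X o, z))%E.
Proof.
move=> mH H0.
pose SP := lebesgue_integral_fubini_product_measure1__canonical__probability_measure_Probability S P.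
have mF := measurable_fun_fubini_tonelli_F (m2 := SP) H mH H0.
exact: (measurableT_comp mF (measurable_funPT X)).
Qed.

End joint_law.

Section process.
Context {R : realType} {d : nat} {dX : measure_display} {Xi : measurableType dX}
  (P : probability Xi R).
Local Notation V := 'rV[R]_d.
Context dO (Omega : measurableType dO) (Q : probability Omega R).
Variables (xi : nat -> {RV Q >-> Xi}) (w : nat -> {RV Q >-> V})
  (rho : {RV Q >-> nat}) (T : nat).
Hypothesis sampling : sgfm_sampling P xi w rho T.
Variables (next : V -> V -> Xi -> V) (x0 : V) (X : nat -> Omega -> V).
Hypothesis next_meas : forall dT (S : measurableType dT) (a b : S -> V) (e : S -> Xi),
  measurable_fun setT a -> measurable_fun setT b -> measurable_fun setT e ->
  measurable_fun setT (fun s => next (a s) (b s) (e s)).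
Hypothesis X0 : forall o, X 0 o = x0.
Hypothesis XS : forall t o, X t.+1 o = next (X t o) (w t o) (xi t o).
Local Notation index := ('I_T + 'I_T + unit)%type.
Local Notation sigma := (sgfm_sigma xi w rho (T := T)).

Lemma measurable_iterate t : measurable_fun setT (X t).
Proof.
elim: t => [|t IH]; first by rewrite (_ : X 0 = cst x0)//; apply/funext.
rewrite (_ : X t.+1 = fun o => next (X t o) (w t o) (xi t o)); last exact/funext.
exact: next_meas.
Qed.

(** The stopping index counts as a future sample at every time. *)
Definition future (t : nat) (i : index) : bool :=
  match i with
  | inl (inl s) => (t <= s)%N
  | inl (inr s) => (t <= s)%N
  | inr _ => true
  end.

Definition future_set t : {set index} := finset (future t).

Lemma in_future t i : (i \in future_set t) = future t i.
Proof. by rewrite finset.in_set. Qed.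

Definition with_sample (t : nat) (B : set V) (C : set Xi) (E : index -> set Omega)
    (i : index) : set Omega :=
  match i with
  | inl (inl s) => if s == t :> nat then xi t @^-1` C else E i
  | inl (inr s) => if s == t :> nat then w t @^-1` B else E i
  | inr _ => E i
  end.

Local Notation events t E := (\bigcap_(i in [set` future_set t]) E i).
Local Notation probs t E := (\prod_(i in future_set t) Q (E i))%E.

Lemma sigma_measurable i A : sigma i A -> measurable A.
Proof.
case: i => [[t|t]|u] /= [B mB <-]; rewrite setTI -[X in measurable X]setTI;
  exact: measurable_funPT.
Qed.

Lemma measurable_events t (E : index -> set Omega) :
  (forall i, sigma i (E i)) -> measurable (events t E).
Proof.
move=> sE; apply: fin_bigcap_measurable => // i _.
exact: sigma_measurable (sE i).
Qed.

Lemma sigma_with_sample t B C E : measurable B -> measurable C ->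
  (forall i, sigma i (E i)) -> forall i, sigma i (with_sample t B C E i).
Proof.
move=> mB mC sE [[s|s]|u] /=; last exact: (sE (inr u)).
- case: eqP => [->|_]; last exact: (sE (inl (inl s))).
  by exists C => //; rewrite setTI.
- case: eqP => [->|_]; last exact: (sE (inl (inr s))).
  by exists B => //; rewrite setTI.
Qed.

Lemma events_with_sample t B C E : (t < T)%N ->
  events t (with_sample t B C E) =
  (w t @^-1` B) `&` (xi t @^-1` C) `&` events t.+1 E.
Proof.
move=> tT; apply/seteqP; split=> o /=.
  move=> h; split; [split|].
  - have := h (inl (inr (Ordinal tT))); rewrite /= eqxx; apply.
    by rewrite !in_future /=.
  - have := h (inl (inl (Ordinal tT))); rewrite /= eqxx; apply.
    by rewrite !in_future /=.
  - move=> [[s|s]|u]; rewrite /= in_future /= => si.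
    + have := h (inl (inl s)); rewrite /= in_future gtn_eqF//; apply.
      exact: ltnW.
    + have := h (inl (inr s)); rewrite /= in_future gtn_eqF//; apply.
      exact: ltnW.
    + by have := h (inr u); rewrite /= in_future; apply.
move=> [[hw hx] h] [[s|s]|u]; rewrite /= in_future /= => si.
- case: eqP => // /eqP st; apply: (h (inl (inl s))).
  by rewrite /= in_future /= ltn_neqAle eq_sym st.
- case: eqP => // /eqP st; apply: (h (inl (inr s))).
  by rewrite /= in_future /= ltn_neqAle eq_sym st.
- by apply: (h (inr u)); rewrite /= in_future.
Qed.

Lemma probs_with_sample t B C E : (t < T)%N ->
  probs t (with_sample t B C E) =
  (Q (w t @^-1` B) * (Q (xi t @^-1` C) * probs t.+1 E))%E.
Proof.
move=> tT.
rewrite (bigD1 (inl (inr (Ordinal tT))))/=; last by rewrite in_future /=.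
rewrite (bigD1 (inl (inl (Ordinal tT))))/=; last by rewrite in_future /= leqnn.
rewrite !eqxx; congr (_ * (_ * _))%E; apply: eq_big => [i|i].
  rewrite !in_future; case: i => [[s|s]|u] //=.
  - rewrite andbT; apply/idP/idP => [/andP[h1 h2]|h].
      by rewrite ltn_neqAle h1 andbT; apply: contra h2 => /eqP h2; apply/eqP; do 2 congr inl; exact/val_inj.
    by rewrite (ltnW h); apply/eqP => -[] h'; move: h; rewrite h' ltnn.
  - rewrite andbT; apply/idP/idP => [/andP[h1 h2]|h].
      by rewrite ltn_neqAle h1 andbT; apply: contra h2 => /eqP h2; apply/eqP; congr (inl (inr _)); exact/val_inj.
    by rewrite (ltnW h); apply/eqP => -[] h'; move: h; rewrite h' ltnn.
case: i => [[s|s]|u] //=; rewrite !in_future /= => /andP[/andP[h1 h2] h3];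
  case: eqP => // h; exfalso; [move/eqP: h3|move/eqP: h2]; apply.
  by congr (inl (inl _)); exact/val_inj.
by congr (inl (inr _)); exact/val_inj.
Qed.
Lemma events_independent t E : (forall i, sigma i (E i)) -> Q (events t E) = probs t E.
Proof. by move=> sE; apply: (sgfm_indep sampling) => i _; exact: sE. Qed.

Local Notation sample t := (fun o => (X t o, (w t o, xi t o))).

Let measurable_sample t : measurable_fun setT (sample t).
Proof.
apply: measurable_fun_pair; first exact: measurable_iterate.
exact: measurable_fun_pair.
Qed.

(** The iterate is independent of the future samples: [X t.+1] is a function of
    [X t], [w t] and [xi t], whose joint law is not affected by conditioning on
    the samples after [t], since this holds on rectangles. *)
Lemma iterate_independent t A E : (t <= T)%N -> measurable A ->
  (forall i, sigma i (E i)) ->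
  Q (X t @^-1` A `&` events t E) = (Q (X t @^-1` A) * probs t E)%E.
Proof.
elim: t A E => [|t IH] A E tT mA sE.
  rewrite -events_independent// (_ : X 0 = cst x0) ?preimage_cst; last exact/funext.
  case: ifP => _; first by rewrite setTI probability_setT mul1e.
  by rewrite set0I measure0 mul0e.
have mD := measurable_events t.+1 sE; set D := events t.+1 E in mD *.
rewrite -events_independent// -/D.
pose m1 : {measure set (V * (V * Xi)) -> \bar R} :=
  measure_function_pushforward__canonical__measure_function_Measure (mrestr Q mD)
    (measurable_sample t).
have QD0 : 0 <= fine (Q D) by exact: fine_ge0.
pose m2 : {measure set (V * (V * Xi)) -> \bar R} :=
  mscale (NngNum QD0)
  (measure_function_pushforward__canonical__measure_function_Measure Q
    (measurable_sample t)).
have m1E M : m1 M = Q (sample t @^-1` M `&` D) by [].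
have m2E M : m2 M = (Q D * Q (sample t @^-1` M))%E.
  by rewrite /m2 /= /mscale /= fineK// fin_num_measure.
have XSE : X t.+1 @^-1` A = sample t @^-1` [set z | A (next z.1 z.2.1 z.2.2)].
  by apply/seteqP; split=> o /=; rewrite XS.
rewrite XSE muleC -m1E -m2E; apply: measure_triple_unique.
- rewrite m1E; apply: le_lt_trans (ltry 1); apply: probability_le1.
  by apply: measurableI => //; rewrite -[X in measurable X]setTI; exact: measurable_sample.
- move=> A0 B C mA0 mB mC; rewrite m1E m2E.
  have rect : sample t @^-1` (A0 `*` (B `*` C)) =
      X t @^-1` A0 `&` ((w t @^-1` B) `&` (xi t @^-1` C)).
    by apply/seteqP; split=> o /= [? []].
  have sT i : sigma i setT.
    by case: i => [[s|s]|u]; exists setT => //; rewrite setTI preimage_setT.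
  have rectE E' : (forall i, sigma i (E' i)) ->
      Q (sample t @^-1` (A0 `*` (B `*` C)) `&` events t.+1 E') =
      (Q (X t @^-1` A0) * (Q (w t @^-1` B) * (Q (xi t @^-1` C) * probs t.+1 E')))%E.
    move=> sE'; rewrite rect -setIA -events_with_sample// IH//; last 2 first.
    - exact: ltnW.
    - exact: sigma_with_sample.
    by rewrite probs_with_sample.
  have := rectE (fun=> setT) sT.
  rewrite (_ : events _ _ = setT); last by rewrite bigcapT.
  rewrite setIT => ->; rewrite rectE// -events_independent// -/D.
  rewrite big1 => [|i _]; last by rewrite probability_setT.
  by rewrite mule1 [RHS]muleC !muleA.
rewrite -[X in measurable X]setTI.
have : measurable_fun setT (fun z : V * (V * Xi) => next z.1 z.2.1 z.2.2).
  apply: next_meas; first exact: measurable_fst.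
    exact: (measurableT_comp measurable_fst measurable_snd).
  exact: (measurableT_comp measurable_snd measurable_snd).
exact.
Qed.

Lemma sample_law t A B C : (t < T)%N -> measurable A -> measurable B -> measurable C ->
  Q (sample t @^-1` (A `*` (B `*` C))) =
  (Q (X t @^-1` A) * (distribution Q (w t) B * P C))%E.
Proof.
move=> tT mA mB mC.
have sT i : sigma i setT.
  by case: i => [[s|s]|u]; exists setT => //; rewrite setTI preimage_setT.
have := iterate_independent (ltnW tT) mA (sigma_with_sample t mB mC sT).
rewrite events_with_sample// probs_with_sample// (_ : events _ _ = setT); last by rewrite bigcapT.
rewrite big1 => [|i _]; last by rewrite probability_setT.
rewrite setIT mule1 -(sgfm_law_xi sampling tT mC) => <-; congr (Q _).
Qed.

Lemma measurable_integral_sample t (H : V * (V * Xi) -> \bar R) :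
  measurable_fun setT H -> (forall z, 0 <= H z)%E ->
  measurable_fun setT (fun o => \int[distribution Q (w t) \x P]_z H (X t o, z))%E.
Proof.
move=> mH H0.
pose X' : {mfun Omega >-> V} :=
  HB.pack (X t) (@isMeasurableFun.Build _ _ _ _ (X t) (measurable_iterate t)).
exact: (measurable_inner_integral X' (distribution Q (w t)) P mH H0).
Qed.

Lemma stop_law t A : (t < T)%N -> measurable A ->
  Q (X t @^-1` A `&` rho @^-1` [set t]) = (Q (X t @^-1` A) * (T%:R^-1)%:E)%E.
Proof.
move=> tT mA.
pose E (i : index) : set Omega := if i is inr _ then rho @^-1` [set t] else setT.
have sE i : sigma i (E i).
  case: i => [[s|s]|u]; [by exists setT => //; rewrite setTI preimage_setT..|].
  by exists [set t] => //; rewrite setTI.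
have := iterate_independent (ltnW tT) mA sE.
rewrite (_ : events _ _ = rho @^-1` [set t]); last first.
  apply/seteqP; split=> o /=.
    by move=> /(_ (inr tt)); apply; rewrite /= in_future.
  by move=> h [[s|s]|u].
rewrite (bigD1 (inr tt))/=; last by rewrite in_future.
rewrite big1 ?mule1 => [|[[s|s]|[]]]; rewrite ?andbF ?probability_setT// ?eqxx ?andbF//.
by rewrite -(sgfm_law_rho sampling tT).
Qed.

Lemma integral_sample t (H : V * (V * Xi) -> \bar R) : (t < T)%N ->
  measurable_fun setT H -> (forall z, 0 <= H z)%E ->
  (\int[Q]_o H (X t o, (w t o, xi t o)) =
   \int[Q]_o \int[distribution Q (w t) \x P]_z H (X t o, z))%E.
Proof.
move=> tT mH H0.
pose X' : {mfun Omega >-> V} :=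
  HB.pack (X t) (@isMeasurableFun.Build _ _ _ _ (X t) (measurable_iterate t)).
apply: (@integral_independent _ _ _ _ _ _ _ _ _ Q X' (w t) (xi t)) => // A B C mA mB mC.
exact: sample_law.
Qed.

Lemma integral_stop t (H : V -> \bar R) : (t < T)%N ->
  measurable_fun setT H -> (forall z, 0 <= H z)%E ->
  (\int[Q]_(o in rho @^-1` [set t]) H (X t o) = (T%:R^-1)%:E * \int[Q]_o H (X t o))%E.
Proof.
move=> tT mH H0.
have mr : measurable (rho @^-1` [set t]).
  by rewrite -[X in measurable X]setTI; exact: measurable_funPT.
have mX := measurable_iterate t.
have mHX : measurable_fun setT (H \o X t) by exact: measurableT_comp.
pose m1 : {measure set V -> \bar R} :=
  measure_function_pushforward__canonical__measure_function_Measure (mrestr Q mr) mX.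
have T0 : 0 <= (T%:R^-1 : R) by rewrite invr_ge0.
pose m2 : {measure set V -> \bar R} := mscale (NngNum T0)
  (measure_function_pushforward__canonical__measure_function_Measure Q mX).
have m12 A : measurable A -> m1 A = m2 A.
  by move=> mA; rewrite [LHS]stop_law//= /mscale /= muleC.
have e : (\int[m1]_z H z = \int[m2]_z H z)%E.
  exact: (eq_measure_integral m2 (m1 := m1) (D := setT) (f := H) (fun M mM _ => m12 M mM)).
have e1 : (\int[m1]_z H z = \int[Q]_(o in rho @^-1` [set t]) H (X t o))%E.
  rewrite -(@ge0_integral_mrestr _ _ _ Q _ mr (H \o X t))//; last by move=> o; exact: H0.
  by rewrite [LHS]ge0_integral_pushforward// preimage_setT.
have e2 : (\int[m2]_z H z = (T%:R^-1)%:E * \int[Q]_o H (X t o))%E.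
  rewrite [LHS]ge0_integral_mscale//; congr (_ * _)%E.
  by rewrite [LHS]ge0_integral_pushforward// preimage_setT.
by rewrite -e1 e e2.
Qed.

End process.

(** * Convergence *)

(** The integral of a nonnegative function is a supremum over the simple
    functions below it, so that its monotonicity holds for functions such as
    [min_norm] whose measurability is unknown. *)
Lemma le_integral_nonmeasurable {R : realType} dT (T : measurableType dT)
    (mu : {measure set T -> \bar R}) (f g : T -> \bar R) :
  (forall x, 0 <= f x)%E -> (forall x, f x <= g x)%E ->
  (\int[mu]_x f x <= \int[mu]_x g x)%E.
Proof.
move=> f0 fg; have g0 x : (0 <= g x)%E by exact: le_trans (fg x).
rewrite !ge0_integralTE//; apply: le_ereal_sup => _ [h hf <-].
by exists h => // x; exact: le_trans (fg x).
Qed.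

Lemma min_norm_ge0 {R : realType} {d : nat} (S : set 'rV[R]_d) : (0 <= min_norm S)%E.
Proof. by apply: le_ereal_inf_tmp => _ [g _ <-]; rewrite lee_fin enorm_ge0. Qed.

Lemma objective_gap_le {R : realType} {d : nat} {dX : measure_display}
    {Xi : measurableType dX} (P : probability Xi R) (F : 'rV[R]_d -> Xi -> R)
    (x0 : 'rV[R]_d) (Delta : R) : (objective_gap P F x0 <= Delta%:E)%E ->
  exists2 a, (forall y, a <= objective P F y) & objective P F x0 - a <= Delta.
Proof.
rewrite /objective_gap; set I := ereal_inf _.
have Ile y : (I <= (objective P F y)%:E)%E by apply: ereal_inf_lbound; exists y.
case: I Ile => [a| |] Ile h.
- exists a => [y|]; first by rewrite -lee_fin.
  by rewrite -lee_fin EFinB.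
- by have := Ile x0.
- by move: h.
Qed.

Section convergence.
Context {R : realType} {d : nat} {dX : measure_display} {Xi : measurableType dX}.
Local Notation V := 'rV[R]_d.
Variables (P : probability Xi R) (F : V -> Xi -> R) (L : Xi -> R) (x0 : V).
Variables (c G Delta delta epsilon eta : R).
Hypotheses (d_gt0 : (0 < d)%N) (G_gt0 : 0 < G) (delta_gt0 : 0 < delta).
Hypotheses (epsilon_gt0 : 0 < epsilon) (eta_gt0 : 0 < eta).
Hypothesis c_smoothing : smoothing_constant c.
Hypothesis F_int : forall x, P.-integrable [set: Xi] (fun xi => (F x xi)%:E).
Hypothesis L_meas : measurable_fun [set: Xi] L.
Hypothesis FL : forall xi, elipschitz (L xi) (fun x => F x xi).
Hypothesis L2 : ('E_P[fun xi => (L xi ^+ 2)%R] <= (G ^+ 2)%R%:E)%E.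
Hypothesis gap : (objective_gap P F x0 <= Delta%:E)%E.
Context dO (Omega : measurableType dO) (Q : probability Omega R).
Variables (xi : nat -> {RV Q >-> Xi}) (w : nat -> {RV Q >-> V})
  (rho : {RV Q >-> nat}) (T : nat).
Hypothesis T_gt0 : (0 < T)%N.
Hypothesis sampling : sgfm_sampling P xi w rho T.
Local Notation f := (objective P F).
Local Notation fd := (smoothing f delta).
Local Notation ghat := (sgfm_grad F delta).
Local Notation X t o := (sgfm_iter F delta eta x0 (fun s => w s o) (fun s => xi s o) t).
Let K := eta ^+ 2 * (c * G * Num.sqrt d%:R / delta) * (72 * pi ^+ 2 * d%:R * G ^+ 2).

Let fG : elipschitz G f.
Proof. exact: objective_lipschitz L2. Qed.

Let next_meas dT (S : measurableType dT) (a b : S -> V) (e : S -> Xi) :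
  measurable_fun setT a -> measurable_fun setT b -> measurable_fun setT e ->
  measurable_fun setT (fun s => a s - eta *: ghat (a s) (b s) (e s)).
Proof.
move=> ma mb me; apply: measurable_rV_add => //; apply: measurable_rV_opp.
by apply: measurable_rV_scale => //; exact: (measurable_sgfm_grad delta F_int L_meas FL).
Qed.

Let mX t : measurable_fun setT (fun o => X t o).
Proof.
exact: (measurable_iterate (xi := xi) (w := w)
  (next := fun x v e => x - eta *: ghat x v e) (X := fun t o => X t o)
  next_meas (fun=> erefl) (fun _ _ => erefl)).
Qed.

Let K_ge0 : 0 <= K.
Proof.
have [c0 _] := c_smoothing.
apply: mulr_ge0; last by rewrite mulr_ge0 ?sqr_ge0// mulr_ge0// mulr_ge0// sqr_ge0.
rewrite mulr_ge0 ?sqr_ge0// divr_ge0 ?(ltW delta_gt0)// mulr_ge0 ?sqrtr_ge0//.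
by rewrite mulr_ge0// ltW.
Qed.

Let measurable_smoothing : measurable_fun setT fd.
Proof. exact: measurable_elipschitz (smoothing_lipschitz fG delta_gt0). Qed.

Let n x := enorm (gradient fd x).

Let measurable_n : measurable_fun setT n.
Proof.
have [_ /(_ d G f delta d_gt0 G_gt0 fG delta_gt0)[_ lfd]] := c_smoothing.
apply: (measurableT_comp (@measurable_enorm R d)); apply: measurable_fun_rV => i.
exact: measurable_elipschitz (gradient_coord_lipschitz i lfd).
Qed.

(** [descent_step] averaged over the law of the iterate, which is independent of
    the sample. *)
Lemma expected_step a t : (t < T)%N -> (forall y, a <= f y) ->
  (\int[Q]_o (fd (X t.+1 o) - a)%:E + eta%:E * \int[Q]_o (n (X t o) ^+ 2)%:E <=
   \int[Q]_o (fd (X t o) - a)%:E + K%:E)%E.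
Proof.
move=> tT af.
have Z0 y : 0 <= fd y - a by rewrite subr_ge0; exact: (smoothing_ge fG delta_gt0 af).
pose H (z : V * (V * Xi)) := (fd (z.1 - eta *: ghat z.1 z.2.1 z.2.2) - a)%:E.
have mH : measurable_fun setT H.
  apply/measurable_EFinP; apply: measurable_funB => //.
  apply: (measurableT_comp measurable_smoothing); apply: next_meas => //.
    exact: (measurableT_comp measurable_fst measurable_snd).
  exact: (measurableT_comp measurable_snd measurable_snd).
have H0 z : (0 <= H z)%E by rewrite lee_fin.
have := integral_sample sampling (next := fun x v e => x - eta *: ghat x v e)
  (X := fun t o => X t o) next_meas (fun=> erefl) (fun _ _ => erefl) tT mH H0.
rewrite {1}/H /= => ->.
pose S : probability V R := distribution Q (w t).
have mHX : measurable_fun setT (fun o => \int[S \x P]_z H (X t o, z))%E.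
  exact: (measurable_integral_sample P (x0 := x0) (w := w) (xi := xi)
    (next := fun x v e => x - eta *: ghat x v e)
    (X := fun t o => X t o) next_meas (fun=> erefl) (fun _ _ => erefl) t mH H0).
have mn2 : measurable_fun setT (fun o => (n (X t o) ^+ 2)%:E).
  apply/measurable_EFinP; apply: measurable_funX.
  exact: (measurableT_comp measurable_n (mX t)).
rewrite -ge0_integralZl_EFin ?(ltW eta_gt0)//; last by move=> o _; rewrite lee_fin sqr_ge0.
rewrite -ge0_integralD//; last 3 first.
- by move=> o _; exact: integral_ge0.
- by move=> o _; rewrite -EFinM lee_fin mulr_ge0 ?(ltW eta_gt0)// sqr_ge0.
- exact: emeasurable_funM.
have mZ : measurable_fun setT (fun o => (fd (X t o) - a)%:E).
  apply/measurable_EFinP; apply: measurable_funB => //.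
  exact: (measurableT_comp measurable_smoothing (mX t)).
have -> : (\int[Q]_o (fd (X t o) - a)%:E + K%:E = \int[Q]_o ((fd (X t o) - a)%:E + K%:E))%E.
  rewrite ge0_integralD//.
  - by rewrite integral_cst// [Y in (_ = _ + _ * Y)%E]probability_setT mule1.
  - by move=> o _; rewrite lee_fin.
apply: ge0_le_integral => //.
- move=> o _; apply: adde_ge0; first exact: integral_ge0.
  by rewrite -EFinM lee_fin mulr_ge0 ?(ltW eta_gt0)// sqr_ge0.
- by apply: emeasurable_funD => //; exact: emeasurable_funM.
- exact: emeasurable_funD.
move=> o _; rewrite -EFinM -EFinD.
apply: (descent_step (S := S) d_gt0 G_gt0 delta_gt0 c_smoothing _ F_int L_meas FL L2) => //.
  by move=> A mA; exact: (sgfm_law_w sampling).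
exact: ltW.
Qed.

Lemma telescoped a t : (t <= T)%N -> (forall y, a <= f y) ->
  (\int[Q]_o (fd (X t o) - a)%:E + eta%:E * \sum_(s < t) \int[Q]_o (n (X s o) ^+ 2)%:E <=
   (fd x0 - a + t%:R * K)%:E)%E.
Proof.
move=> tT af; elim: t tT => [_|t IH tT].
  rewrite big_ord0 mule0 adde0 mul0r addr0 /= integral_cst//.
  by rewrite [Y in (_ * Y <= _)%E]probability_setT mule1.
have n2 s : (0 <= \int[Q]_o (n (X s o) ^+ 2)%:E)%E.
  by apply: integral_ge0 => o _; rewrite lee_fin sqr_ge0.
rewrite big_ord_recr /= ge0_muleDr ?sume_ge0// addeCA.
apply: (@le_trans _ _ (eta%:E * \sum_(s < t) \int[Q]_o (n (X s o) ^+ 2)%:E +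
  (\int[Q]_o (fd (X t o) - a)%:E + K%:E))%E).
  by rewrite leeD2l//; exact: expected_step.
rewrite addeCA addeA.
apply: (@le_trans _ _ ((fd x0 - a + t%:R * K)%:E + K%:E)%E).
  by rewrite leeD2r// IH// ltnW.
by rewrite -EFinD lee_fin -natr1 mulrDl mul1r addrA.
Qed.

Lemma sum_gradients : (eta%:E * \sum_(t < T) \int[Q]_o (n (X t o) ^+ 2)%:E <=
  (Delta + delta * G + T%:R * K)%:E)%E.
Proof.
have [a af fa] := objective_gap_le gap.
have Z0 y : 0 <= fd y - a by rewrite subr_ge0; exact: (smoothing_ge fG delta_gt0 af).
apply: le_trans (_ : _ <= (fd x0 - a + T%:R * K)%:E)%E _.
  apply: le_trans (telescoped (leqnn T) af); rewrite leeDr//.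
  by apply: integral_ge0 => o _; rewrite lee_fin.
rewrite lee_fin lerD2r; have := smoothing_close d_gt0 fG delta_gt0 x0.
by rewrite ler_norml => /andP[_]; lra.
Qed.

(** The gradient norm at the output, as a sum over its possible values. The
    stopping index is less than [T] only almost surely: on the null event [late],
    a term [+oo] makes the pointwise bound by this sum hold everywhere. *)
Let stopped o : \bar R := (\sum_(t < T)
  (n (X t o))%:E * (\1_(rho @^-1` [set val t]) o)%:E)%E.

Let late : set Omega := [set o | (T <= rho o)%N].

Let measurable_stop t : measurable (rho @^-1` [set t]).
Proof. by rewrite -[Y in measurable Y]setTI; exact: measurable_funPT. Qed.

Let lateE : late = ~` \big[setU/set0]_(t < T) (rho @^-1` [set val t]).
Proof.
rewrite -(bigcup_mkord T (fun t => rho @^-1` [set t])); apply/seteqP; split=> o /=.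
  by move=> h [t /= tT e]; move: h; rewrite /late/= e leqNgt tT.
by move=> h; rewrite /late/= leqNgt; apply/negP => rT; apply: h; exists (rho o).
Qed.

Let late0 : Q late = 0%E.
Proof.
rewrite lateE probability_setC; last by apply: bigsetU_measurable => t _; exact: measurable_stop.
rewrite measure_bigsetU_ord//; last first.
  by apply/trivIsetP => s t _ _ st; apply/seteqP; split=> o //= [-> /val_inj/eqP]; apply/negP.
rewrite (eq_bigr (fun=> (T%:R^-1)%:E)); last first.
  by move=> t _; exact: (sgfm_law_rho sampling (ltn_ord t)).
rewrite sumEFin sumr_const card_ord -[_^-1 *+ _]mulr_natr mulVf ?subee//.
by rewrite pnatr_eq0 -lt0n.
Qed.

Lemma stopped_integral : (\int[Q]_o (stopped o + +oo * (\1_late o)%:E) =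
  (T%:R^-1)%:E * \sum_(t < T) \int[Q]_o (n (X t o))%:E)%E.
Proof.
have mlate : measurable late.
  by rewrite lateE; apply: measurableC; apply: bigsetU_measurable => t _; exact: measurable_stop.
have mn t : measurable_fun setT (fun o => (n (X t o))%:E).
  by apply/measurable_EFinP; exact: (measurableT_comp measurable_n (mX t)).
have mi t : measurable_fun setT (fun o => (n (X t o))%:E * (\1_(rho @^-1` [set t]) o)%:E)%E.
  by apply: emeasurable_funM => //; apply/measurable_EFinP; exact: measurable_indic.
have i0 t o : (0 <= (n (X t o))%:E * (\1_(rho @^-1` [set t]) o)%:E)%E.
  by rewrite mule_ge0// lee_fin// enorm_ge0.
rewrite ge0_integralD//; last 3 first.
- by move=> o _; exact: sume_ge0.
- exact: emeasurable_sum.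
- by apply: emeasurable_funM => //; apply/measurable_EFinP; exact: measurable_indic.
rewrite [Y in (_ + Y)%E](_ : _ = 0%E) ?adde0; last first.
  rewrite (_ : (fun o => _) = (cst +oo%E) \_ late).
    by rewrite -integral_mkcond integral_cst// [Y in (_ * Y)%E]late0 mule0.
  by apply/funext => o; rewrite patchE indicE; case: ifP => _; rewrite ?mule1 ?mule0.
rewrite /stopped ge0_integral_sum// ge0_sume_distrr; last first.
  by move=> t _; apply: integral_ge0 => o _; rewrite lee_fin enorm_ge0.
apply: eq_bigr => t _.
rewrite -(integral_stop sampling (next := fun x v e => x - eta *: ghat x v e)
  (X := fun t o => X t o) next_meas (fun=> erefl) (fun _ _ => erefl) (ltn_ord t)
  (H := fun x => (n x)%:E))//; last 2 first.
- exact/measurable_EFinP.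
- by move=> z; rewrite lee_fin enorm_ge0.
rewrite [RHS]integral_mkcond; apply: eq_integral => o _.
by rewrite patchE indicE; case: ifP => _; rewrite ?mule1 ?mule0.
Qed.

(** The minimal norm is at most the norm of the gradient of the smoothed
    objective, and [y <= y^2 / (2 epsilon) + epsilon / 2] reduces its mean to the
    mean of its square, which the telescoped descent controls. *)
Lemma expected_norm_le : Delta + delta * G + T%:R * K <= epsilon ^+ 2 * (eta * T%:R) ->
  (\int[Q]_o min_norm (goldstein_subdiff delta f (X (rho o) o)) <= epsilon%:E)%E.
Proof.
move=> hT.
have [_ /(_ d G f delta d_gt0 G_gt0 fG delta_gt0)[dfd _]] := c_smoothing.
have TR : 0 < T%:R :> R by rewrite ltr0n.
apply: (@le_trans _ _ (\int[Q]_o (stopped o + +oo * (\1_late o)%:E))%E).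
  apply: le_integral_nonmeasurable => o; first exact: min_norm_ge0.
  have [oT|oT] := ltnP (rho o) T; last first.
    have -> : \1_late o = 1 :> R by rewrite indicE mem_set.
    have s0 : (0 <= stopped o)%E.
      by apply: sume_ge0 => t _; rewrite mule_ge0// lee_fin// enorm_ge0.
    by rewrite mule1 addey ?leey//; apply/eqP => e; move: s0; rewrite e.
  have -> : \1_late o = 0 :> R by rewrite indicE memNset// /late/= leqNgt oT.
  rewrite mule0 adde0 /stopped (bigD1 (Ordinal oT))//= big1 ?adde0; last first.
    move=> t tr; rewrite indicE memNset ?mule0//= => e; move/eqP: tr; apply.
    exact/val_inj.
  rewrite indicE mem_set//= mule1.
  apply: (goldstein_min_norm_le d_gt0 fG).
  exact: (smoothing_gradient_goldstein d_gt0 fG delta_gt0 (dfd _)).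
rewrite stopped_integral.
apply: (@le_trans _ _ ((T%:R^-1)%:E * \sum_(t < T)
  (((2 * epsilon)^-1)%:E * \int[Q]_o (n (X t o) ^+ 2)%:E + (epsilon / 2)%:E))%E).
  rewrite lee_wpmul2l ?lee_fin ?invr_ge0//; apply: lee_sum => t _.
  have mn2 : measurable_fun setT (fun o => (n (X t o) ^+ 2)%:E).
    apply/measurable_EFinP; apply: measurable_funX.
    exact: (measurableT_comp measurable_n (mX t)).
  have e20 : 0 <= (2 * epsilon)^-1 by rewrite invr_ge0 mulr_ge0// ltW.
  have -> : ((epsilon / 2)%:E = \int[Q]_o (epsilon / 2)%:E)%E.
    by rewrite integral_cst// [Y in (_ = _ * Y)%E]probability_setT mule1.
  rewrite -ge0_integralZl_EFin//; last by move=> o _; rewrite lee_fin sqr_ge0.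
  rewrite -ge0_integralD//; last 3 first.
  - by move=> o _; rewrite -EFinM lee_fin mulr_ge0// sqr_ge0.
  - exact: emeasurable_funM.
  - by move=> o _; rewrite lee_fin divr_ge0// ltW.
  apply: ge0_le_integral => //.
  - by move=> o _; rewrite lee_fin enorm_ge0.
  - by apply/measurable_EFinP; exact: (measurableT_comp measurable_n (mX t)).
  - by apply: emeasurable_funD => //; exact: emeasurable_funM.
  move=> o _; rewrite -EFinM -EFinD lee_fin; set y := n _.
  have : 0 <= (2 * epsilon)^-1 * (y - epsilon) ^+ 2 by rewrite mulr_ge0 ?sqr_ge0.
  rewrite (_ : _ * (y - epsilon) ^+ 2 = (2 * epsilon)^-1 * y ^+ 2 + epsilon / 2 - y) ?subr_ge0//.
  by field; rewrite gt_eqF.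
have := sum_gradients.
have n2 s : (0 <= \int[Q]_o (n (X s o) ^+ 2)%:E)%E.
  by apply: integral_ge0 => o _; rewrite lee_fin sqr_ge0.
rewrite [Y in (_ -> _ * Y <= _)%E](_ : _ =
  ((2 * epsilon)^-1)%:E * \sum_(t < T) \int[Q]_o (n (X t o) ^+ 2)%:E +
  \sum_(t < T) (epsilon / 2)%:E)%E; last first.
  by rewrite ge0_sume_distrr//; exact: big_split.
have : (0 <= \sum_(t < T) \int[Q]_o (n (X t o) ^+ 2)%:E)%E by exact: sume_ge0.
case: (\sum_(t < T) \int[Q]_o _)%E => [s| |]//.
  rewrite -!EFinM sumEFin sumr_const card_ord -EFinD -EFinM !lee_fin => s0 hs.
  have {}hs : eta * s <= epsilon ^+ 2 * (eta * T%:R) by exact: le_trans hs hT.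
  have hs' : s <= epsilon ^+ 2 * T%:R by rewrite -(ler_pM2l eta_gt0); lra.
  rewrite mulrC ler_pdivrMr// -mulr_natr.
  have : (2 * epsilon)^-1 * s <= (2 * epsilon)^-1 * (epsilon ^+ 2 * T%:R).
    by rewrite ler_wpM2l// invr_ge0 mulr_ge0// ltW.
  rewrite (_ : _ * (epsilon ^+ 2 * _) = epsilon / 2 * T%:R); first lra.
  by field; rewrite gt_eqF.
by rewrite gt0_muley ?lte_fin.
Qed.

End convergence.

(** * The iteration number *)
Section iteration_number.
Context {R : realType}.
Variables (d : nat) (c G Delta delta epsilon : R).
Hypotheses (d_gt0 : (0 < d)%N) (c_gt0 : 0 < c) (G_gt0 : 0 < G) (Delta_gt0 : 0 < Delta).
Hypotheses (delta_gt0 : 0 < delta) (epsilon_gt0 : 0 < epsilon).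
Let kappa : R := 10 + 72 / 10 * pi ^+ 2.
Let Qt : R := d%:R `^ (3 / 2) *
  (G ^+ 4 / epsilon ^+ 4 + Delta * G ^+ 3 / (delta * epsilon ^+ 4)).

Lemma powR32 : d%:R `^ (3 / 2) = d%:R * Num.sqrt d%:R :> R.
Proof.
rewrite (_ : 3 / 2 = 1 + 2^-1); last by field.
rewrite powRD; last by rewrite pnatr_eq0 -lt0n d_gt0 implybT.
by rewrite powRr1// powR12_sqrt.
Qed.

(** With the step size [eta], the accumulated variance [T K] is the fixed
    multiple [72 pi^2 / 100] of [Delta + delta G], and [eta T] is of order
    [sqrt T]. *)
Lemma iteration_number_enough (T : nat) : (0 < T)%N -> kappa ^+ 2 * c * Qt <= T%:R ->
  let eta := 10^-1 * Num.sqrt (delta * (Delta + delta * G) /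
    (c * (d%:R `^ (3 / 2)) * G ^+ 3 * T%:R)) in
  0 < eta /\
  Delta + delta * G + T%:R * (eta ^+ 2 * (c * G * Num.sqrt d%:R / delta) *
    (72 * pi ^+ 2 * d%:R * G ^+ 2)) <= epsilon ^+ 2 * (eta * T%:R).
Proof.
move=> T_gt0 hT eta.
have dR : 0 < d%:R :> R by rewrite ltr0n.
have TR : 0 < T%:R :> R by rewrite ltr0n.
have sd : 0 < Num.sqrt d%:R :> R by rewrite sqrtr_gt0.
pose D0 := Delta + delta * G.
have D0p : 0 < D0 by rewrite addr_gt0// mulr_gt0.
pose A := c * (d%:R * Num.sqrt d%:R) * G ^+ 3.
have Ap : 0 < A by rewrite mulr_gt0 ?exprn_gt0// mulr_gt0// mulr_gt0.
have rad : 0 < delta * D0 / (A * T%:R) by rewrite divr_gt0 ?mulr_gt0.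
have etaE : eta = 10^-1 * Num.sqrt (delta * D0 / (A * T%:R)) by rewrite /eta powR32.
clearbody eta.
have eta0 : 0 < eta by rewrite etaE mulr_gt0 ?invr_gt0 ?sqrtr_gt0.
split=> //.
have eta2 : eta ^+ 2 = delta * D0 / (100 * A * T%:R).
  rewrite etaE exprMn sqr_sqrtr ?ltW//; field.
  by rewrite !gt_eqF.
have -> : Delta + delta * G + T%:R * (eta ^+ 2 * (c * G * Num.sqrt d%:R / delta) *
    (72 * pi ^+ 2 * d%:R * G ^+ 2)) = kappa / 10 * D0.
  rewrite eta2 -/D0 /kappa /A; field.
  by rewrite !gt_eqF.
have kp : 0 < kappa by rewrite /kappa ltr_wpDr// mulr_ge0// sqr_ge0.
rewrite -ler_sqr ?nnegrE; last 2 first.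
- by rewrite mulr_ge0 ?(ltW D0p)// divr_ge0// ltW.
- by rewrite mulr_ge0 ?sqr_ge0// mulr_ge0// ltW.
have -> : (epsilon ^+ 2 * (eta * T%:R)) ^+ 2 = epsilon ^+ 4 * delta * D0 / (100 * A) * T%:R.
  rewrite !exprMn eta2; field.
  by rewrite !gt_eqF.
have -> : (kappa / 10 * D0) ^+ 2 = epsilon ^+ 4 * delta * D0 / (100 * A) * (kappa ^+ 2 * c * Qt).
  rewrite /Qt powR32 /A /D0; field.
  by rewrite !gt_eqF.
rewrite ler_pM2l// divr_gt0 ?mulr_gt0// exprn_gt0//.
Qed.

End iteration_number.

Theorem theorem3p4 (R : realType) (c : R) (c_smoothing : smoothing_constant c) :
  exists C : R, 0 < C /\
  forall (d : nat) (dX : measure_display) (Xi : measurableType dX)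
    (P : probability Xi R) (F : 'rV[R]_d -> Xi -> R) (L : Xi -> R)
    (x0 : 'rV[R]_d) (G Delta delta epsilon : R),
    (0 < d)%N ->
    (forall x, P.-integrable [set: Xi] (fun xi => (F x xi)%:E)) ->
    measurable_fun [set: Xi] L ->
    (forall xi, elipschitz (L xi) (fun x => F x xi)) ->
    0 < G ->
    ('E_P[fun xi => (L xi ^+ 2)%R] <= (G ^+ 2)%R%:E)%E ->
    (0 < objective_gap P F x0)%E ->
    0 < Delta ->
    (objective_gap P F x0 <= Delta%:E)%E ->
    0 < delta ->
    0 < epsilon < 1 ->
    exists T : nat, (0 < T)%N /\
    let eta := 10^-1 *
      Num.sqrt (delta * (Delta + delta * G) /
                (c * (d%:R `^ (3 / 2)) * G ^+ 3 * T%:R)) in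
    (forall (dO : measure_display) (Omega : measurableType dO)
       (Q : probability Omega R) (xi : nat -> {RV Q >-> Xi})
       (w : nat -> {RV Q >-> 'rV[R]_d}) (rho : {RV Q >-> nat}),
       sgfm_sampling P xi w rho T ->
       (\int[Q]_omega
          min_norm (goldstein_subdiff delta (objective P F)
            (sgfm_iter F delta eta x0 (fun t => w t omega)
               (fun t => xi t omega) (rho omega)))
        <= epsilon%:E)%E) /\
    (forall (ws : nat -> 'rV[R]_d) (xis : nat -> Xi),
       (sgfm_oracle_calls F delta eta x0 ws xis T)%:R <=
       C * Num.max 1 (d%:R `^ (3 / 2) *
             (G ^+ 4 / epsilon ^+ 4 +
              Delta * G ^+ 3 / (delta * epsilon ^+ 4)))).
Proof.
pose kappa : R := 10 + 72 / 10 * pi ^+ 2.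
have c_gt0 : 0 < c by have [] := c_smoothing.
have C0 : 0 < kappa ^+ 2 * c + 1.
  by rewrite ltr_wpDl// mulr_ge0 ?sqr_ge0// ltW.
exists (2 * (kappa ^+ 2 * c + 1)); split; first by rewrite mulr_gt0.
move=> d dX Xi P F L x0 G Delta delta epsilon d_gt0 F_int L_meas FL G_gt0 L2 _
  Delta_gt0 gap delta_gt0 /andP[epsilon_gt0 _].
pose Qt := d%:R `^ (3 / 2) *
  (G ^+ 4 / epsilon ^+ 4 + Delta * G ^+ 3 / (delta * epsilon ^+ 4)).
have Qt0 : 0 <= Qt.
  apply: mulr_ge0; first exact: powR_ge0.
  by apply: addr_ge0; rewrite ltW// divr_gt0 ?mulr_gt0 ?exprn_gt0.
have Y0 : 0 <= kappa ^+ 2 * c * Qt by rewrite mulr_ge0// mulr_ge0 ?sqr_ge0// ltW.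
exists (Num.truncn (kappa ^+ 2 * c * Qt)).+1; split=> //.
set T := (Num.truncn _).+1; move=> eta.
have hT : kappa ^+ 2 * c * Qt <= T%:R by rewrite ltW// truncnS_gt.
have [|eta_gt0 etaP] := iteration_number_enough d_gt0 c_gt0 G_gt0 Delta_gt0 delta_gt0
  epsilon_gt0 (T := T) _ hT; first by [].
split=> [dO Omega Q xi w rho sampling|ws xis].
  exact: (expected_norm_le d_gt0 G_gt0 delta_gt0 epsilon_gt0 eta_gt0 c_smoothing
    F_int L_meas FL L2 gap _ sampling etaP).
rewrite /sgfm_oracle_calls /= big_const_ord iter_addn_0 natrM -mulrA ler_pM2l//.
have TY : T%:R <= kappa ^+ 2 * c * Qt + 1 by rewrite -natr1 lerD2r truncn_le.
apply: (le_trans TY); rewrite mulrDl mul1r; apply: lerD.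
  apply: ler_wpM2l; first by rewrite mulr_ge0 ?sqr_ge0// ltW.
  by rewrite le_max lexx orbT.
by rewrite le_max lexx.
Qed.
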